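(* Let $L>0$, $0\le v<1$, $\eta>0$ with $\eta\ne1$, and let $\phi^0\in\mathcal H_L(\mathbf I_0)$ and $\phi^1\in L^2(\mathbf I_0)$. Let $\phi$ be the solution of Problem (WP), with coefficients $(a_n)_{n\in\mathbb Z}$. Then the energy $E_v(t)=\frac12\int_{\mathbf I_t}\phi_t^2(x,t)+\phi_x^2(x,t)\,dx$ satisfies, for $t\ge0$, $$(1-v)\left(\frac2L\sum_{n\in\mathbb Z}|\omega_na_n|^2\right)e^{-\frac{1-v^2}{L}\ln|\gamma_\eta|\,t}\le E_v(t)\le\gamma_\eta^2(1+v)\left(\frac2L\sum_{n\in\mathbb Z}|\omega_na_n|^2\right)e^{-\frac{1-v^2}{L}\ln|\gamma_\eta|\,t}$$ and $$\frac{1}{\gamma_\eta^2\gamma_v}E_v(0)\,e^{-\frac{1-v^2}{L}\ln|\gamma_\eta|\,t}\le E_v(t)\le\gamma_\eta^2\gamma_v\,E_v(0)\,e^{-\frac{1-v^2}{L}\ln|\gamma_\eta|\,t}.$$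
   Context: Setting. $L>0$ is the length of the string, $0\le v<1$ its speed, $\eta>0$, $\eta\ne1$, the damping factor. For $t\ge 0$ let $\mathbf I_t:=(vt,L+vt)$, so $\mathbf I_0=(0,L)$. Subscripts $x,t$ denote partial derivatives. Functions $\phi^0,\phi^1,\phi$ are real-valued. Problem (WP): - $\phi_{tt}-\phi_{xx}=0$ for $x\in\mathbf I_t$, $t>0$; - $(1-\eta v)\phi_x(vt,t)-(\eta-v)\phi_t(vt,t)=0$ for $t>0$; - $\phi(L+vt,t)=0$ for $t>0$; - $\phi(x,0)=\phi^0(x)$, $\phi_t(x,0)=\phi^1(x)$ for $x\in\mathbf I_0$. Function space: $\mathcal H_{L+vt}(\mathbf I_t):=\{w\in H^1(\mathbf I_t): w(L+vt)=0\}$; in particular $\mathcal H_L(\mathbf I_0)=\{w\in H^1(0,L): w(L)=0\}$. Constants: $\gamma_v:=\frac{1+v}{1-v}$, $\gamma_\eta:=\frac{1+\eta}{1-\eta}$ (negative if $\eta>1$), $L_2:=\frac{2L}{1-v}$, and for $n\in\mathbb Z$ $$\omega_n:=\frac{2n+1}{2}i\pi-\frac12\ln\gamma_\eta\ \text{ if }0<\eta<1,\qquad \omega_n:=ni\pi-\frac12\ln|\gamma_\eta|\ \text{ if }\eta>1.$$ The solution $\phi$ lies in $C([0,T];\mathcal H_{L+vt}(\mathbf I_t))\cap C^1([0,T];L^2(\mathbf I_t))$ for $T>0$ and is given by $$\phi(x,t)=\sum_{n\in\mathbb Z}a_n\left(\gamma_\eta e^{\frac{1-v}{L}\omega_n(t+x)}+e^{\frac{1+v}{L}\omega_n(t-x)}\right),\quad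 x\in\mathbf I_t,\ t\ge0,$$ with coefficients $$a_n=\frac{1}{4\gamma_\eta\omega_n}\int_0^{L_2}\left(\tilde\phi^0_x+\tilde\phi^1\right)e^{-\frac{1-v}{L}\omega_n x}\,dx .$$ Here the extensions to $(0,L_2)$ are: $\tilde\phi^0_x(x)=\phi^0_x(x)$, $\tilde\phi^1(x)=\phi^1(x)$ for $x\in(0,L)$, and, for $x\in(L,L_2)$, $$\tilde\phi^0_x(x)=\frac1{\gamma_v}\phi^0_x\left(-\frac{x}{\gamma_v}+\frac{2L}{1+v}\right),\qquad \tilde\phi^1(x)=-\frac1{\gamma_v}\phi^1\left(-\frac{x}{\gamma_v}+\frac{2L}{1+v}\right).$$ *)

(* Defs.v *)
From HB Require Import structures.
From mathcomp Require Import all_boot all_order all_algebra.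
From mathcomp Require Import all_classical all_reals all_analysis.
From mathcomp Require Import complex.

Set Implicit Arguments.
Unset Strict Implicit.
Unset Printing Implicit Defensive.

Import Order.TTheory GRing.Theory Num.Theory.
Import numFieldNormedType.Exports.

Local Open Scope classical_set_scope.
Local Open Scope ring_scope.
Local Open Scope complex_scope.

Section Sobolev.
Context {R : realType}.
Local Notation mu := (@lebesgue_measure R).

Definition L2 (D : set R) (f : R -> R) : Prop := f \_ D \in Lfun mu 2%:E.

(* Square of the L^2(D) norm of f - g, in [0, +oo]. *)
Definition L2dist2 (D : set R) (f g : R -> R) : \bar R :=
  (\int[mu]_(x in D) ((f x - g x) ^+ 2)%:E)%E.

(* psi belongs to C^1_c(]a, b[), and is extended by 0. *)
Definition C1c (a b : R) (psi : R -> R) : Prop :=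
  [/\ forall x, derivable psi x 1, continuous (derive1 psi) &
      exists K : set R, [/\ compact K, K `<=` `]a, b[ &
        forall x, ~ K x -> psi x = 0]].

(* w belongs to H^1(]a, b[), with weak derivative g. *)
Definition H1 (a b : R) (w g : R -> R) : Prop :=
  [/\ L2 `]a, b[ w, L2 `]a, b[ g &
      forall psi, C1c a b psi ->
        \int[mu]_(x in `]a, b[) (w x * derive1 psi x) =
        - \int[mu]_(x in `]a, b[) (g x * psi x)].

(* H^1(]a, b[) functions vanishing at b; w is the representative that is
   continuous on the closed interval, so that w b is the trace. *)
Definition H1_right0 (a b : R) (w g : R -> R) : Prop :=
  [/\ H1 a b w g, {within `[a, b], continuous w} & w b = 0].

(* psi belongs to C^1_c(Q), and is extended by 0; the variables are (x, t). *)
Definition C1c2 (Q : set (R * R)) (psi : R -> R -> R) : Prop :=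
  [/\ forall x t, derivable (psi ^~ t) x 1 /\ derivable (psi x) t 1,
      continuous (fun p : R * R => derive1 (psi ^~ p.2) p.1),
      continuous (fun p : R * R => derive1 (psi p.1) p.2) &
      exists K : set (R * R), [/\ compact K, K `<=` Q &
        forall x t, ~ K (x, t) -> psi x t = 0]].

End Sobolev.

Section ComplexValued.
Context {R : realType}.

Definition cexp (z : R[i]) : R[i] :=
  (expR (complex.Re z) * cos (complex.Im z)) +i*
  (expR (complex.Re z) * sin (complex.Im z)).

Definition cintegral (D : set R) (F : R -> R[i]) : R[i] :=
  (\int[lebesgue_measure]_(x in D) complex.Re (F x)) +i*
  (\int[lebesgue_measure]_(x in D) complex.Im (F x)).

Definition cmod (z : R[i]) : R := ComplexField.Normc.normc z.

End ComplexValued.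

Section String.
Context {R : realType}.
Variables (L v eta : R).
Local Notation mu := (@lebesgue_measure R).

Definition It (t : R) : set R := `]v * t, L + v * t[.

Definition Qdom : set (R * R) := [set p | 0 < p.2 /\ It p.2 p.1].

Definition gamma_v : R := (1 + v) / (1 - v).
Definition gamma_eta : R := (1 + eta) / (1 - eta).
Definition L_2 : R := 2 * L / (1 - v).

Definition omega (n : int) : R[i] :=
  if eta < 1 then
    (- (ln gamma_eta / 2)) +i* ((2 * n%:~R + 1) / 2 * pi)
  else (- (ln `|gamma_eta| / 2)) +i* (n%:~R * pi).

Definition reflect_pt (x : R) : R := - (x / gamma_v) + 2 * L / (1 + v).

Definition dphi0_ext (dphi0 : R -> R) (x : R) : R :=
  if x < L then dphi0 x else gamma_v^-1 * dphi0 (reflect_pt x).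

Definition phi1_ext (phi1 : R -> R) (x : R) : R :=
  if x < L then phi1 x else - (gamma_v^-1 * phi1 (reflect_pt x)).

Definition wave_coef (dphi0 phi1 : R -> R) (n : int) : R[i] :=
  (1 / ((4 * gamma_eta)%:C * omega n)) *
  cintegral `]0, L_2[ (fun x =>
    (dphi0_ext dphi0 x + phi1_ext phi1 x)%:C *
    cexp (- (((1 - v) / L * x)%:C * omega n))).

(* u(., t), t >= 0, is a continuous curve in L^2(It t); curves in these
   time-dependent spaces are compared after translation to ]0, L[. *)
Definition contL2 (u : R -> R -> R) : Prop :=
  (forall t, 0 <= t -> L2 (It t) (u ^~ t)) /\
  (forall t, 0 <= t ->
    L2dist2 `]0, L[ (fun y => u (y + v * s) s) (fun y => u (y + v * t) t)
      @[s --> within [set s | 0 <= s] (nbhs t)] --> 0%E).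

(* phi is in C([0, oo[; H^1(It t)), vanishes at the right endpoint of It t,
   and has space derivative phix. *)
Definition contH1 (phi phix : R -> R -> R) : Prop :=
  [/\ forall t, 0 <= t ->
        H1_right0 (v * t) (L + v * t) (phi ^~ t) (phix ^~ t),
      contL2 phi & contL2 phix].

(* phi is in C^1([0, oo[; L^2(It t)), with (Eulerian) time derivative phit:
   the difference quotients at fixed x converge in L^2 on the set where they
   make sense. *)
Definition contC1L2 (phi phit : R -> R -> R) : Prop :=
  [/\ contL2 phi, contL2 phit &
      forall t, 0 <= t ->
        L2dist2 (It t `&` It s)
          (fun x => (phi x s - phi x t) / (s - t)) (phit ^~ t)
          @[s --> within [set s | 0 <= s] (dnbhs t)] --> 0%E].

(* phi_tt - phi_xx = 0 in the weak sense in the space-time domain. *)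
Definition weak_wave (phix phit : R -> R -> R) : Prop :=
  forall psi, C1c2 Qdom psi ->
    \int[mu]_(t in `]0, +oo[) \int[mu]_(x in It t)
      (phit x t * derive1 (psi x) t - phix x t * derive1 (psi ^~ t) x) = 0.

(* (1 - eta v) phi_x - (eta - v) phi_t = 0 on the moving left endpoint.
   phi_x and phi_t are only L^2 in space, so the vanishing of this
   combination at x = v t is that of its L^2(]0, T[) trace, i.e., of the limit
   of its mean squares over the strips 0 < x - v t < h. *)
Definition left_bc (phix phit : R -> R -> R) : Prop :=
  forall T, 0 < T ->
    ((h^-1)%:E * \int[mu]_(t in `]0%R, T[) \int[mu]_(x in `](v * t)%R, (v * t + h)%R[)
       (((1 - eta * v) * phix x t - (eta - v) * phit x t) ^+ 2)%:E)%E
      @[h --> 0^'+] --> 0%E.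

(* The condition at the right endpoint is part of [contH1]. *)
Record WP_solution (phi0 phi1 : R -> R) (phi phix phit : R -> R -> R) : Prop :=
  { WP_H1 : contH1 phi phix;
    WP_C1 : contC1L2 phi phit;
    WP_wave : weak_wave phix phit;
    WP_left : left_bc phix phit;
    WP_init0 : forall x, It 0 x -> phi x 0 = phi0 x;
    WP_init1 : {ae mu, forall x, It 0 x -> phit x 0 = phi1 x} }.

Definition energy (phix phit : R -> R -> R) (t : R) : \bar R :=
  ((2^-1)%:E * \int[mu]_(x in It t) (phit x t ^+ 2 + phix x t ^+ 2)%:E)%E.

Definition modal_sum (dphi0 phi1 : R -> R) : \bar R :=
  ((2 / L)%:E *
   \esum_(n in [set: int]) (cmod (omega n * wave_coef dphi0 phi1 n) ^+ 2)%:E)%E.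

Definition decay (t : R) : R :=
  expR (- ((1 - v ^+ 2) / L * ln `|gamma_eta| * t)).

End String.

(* Main.v *)
Require Import Defs.
From HB Require Import structures.
From mathcomp Require Import all_boot all_order all_algebra.
From mathcomp Require Import all_classical all_reals all_analysis.
From mathcomp Require Import complex.
From mathcomp Require Import measurable_realfun ring lra.

Set Implicit Arguments.
Unset Strict Implicit.
Unset Printing Implicit Defensive.

Import Order.TTheory GRing.Theory Num.Theory.
Import numFieldNormedType.Exports.

Local Open Scope classical_set_scope.
Local Open Scope ring_scope.

(** The right derivative phi_t + phi_x is transported along the lines x + t =
const, so that phi_t + phi_x = P(x + t) for a single function P on ]0, +oo[, the
profile. Integrating this identity along a line x - t = const up to the right
end, where phi vanishes, gives d'Alembert's formula
   2 phi(x, t) = F(x + t) - F(L + gamma_v (L + t - x)),   F' = P,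
hence phi_t - phi_x = - gamma_v P(L + gamma_v (L + t - x)): the left derivative
at time t is the profile further ahead. At the left end the damping condition
becomes P(s + L_2) = - P(s) / gamma_eta.

Therefore P(s)^2 exp(c s), where c = 2 ln |gamma_eta| / L_2, has period L_2. Let J
be its integral over a period. With a = (1 + v) t,
   4 E_v(t) = \int_a^(a + L) P^2 + gamma_v \int_(a + L)^(a + L_2) P^2,
and gamma_v >= 1, and exp(c s) varies by the factor gamma_eta^2 over a period;
so J / gamma_eta^2 <= 4 E_v(t) exp(c a) <= gamma_v J, where exp(- c a) is the decay
factor of the theorem. Comparing the times t and 0 gives the second estimate.

For the first one, P on ]0, L_2[ is the sum of the extended initial data, and the
numbers omega_n a_n are, up to the factor 1 / (4 gamma_eta), the Fourier
coefficients of P(x) exp(c x / 2) for an orthogonal system of exponentials.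
Parseval's identity turns (2 / L) \sum |omega_n a_n|^2 into
J / (4 (1 - v) gamma_eta^2).

The solution is only H^1 in space, with difference quotients in time that
converge in L^2, and the equation holds weakly. Each step is therefore carried out
for integrals over moving intervals, and pointwise identities are recovered
almost everywhere at the end, from the equality of the integrals over all small
intervals ([ae_eq0_integral]). The steps are [transport] and [rightder_ae],
[dalembert] and [leftder_ae], [profile_shift], [energy_profile] and
[profile_energy_bounds], [parseval] and [modal_sum_energy]. *)

(** * Square-integrable functions on the line *)

Section L2toolbox.
Context {R : realType}.
Local Notation mu := (@lebesgue_measure R).
Implicit Types (f g h : R -> R) (D : set R).

(** Functions on an interval are extended by 0, so that all inner products are
taken in L^2 of the whole line. *)
Definition Sq f : Prop := f \in Lfun mu 2%:E.
Definition Int f : Prop := mu.-integrable setT (EFin \o f).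
Definition ip f g : R := \int[mu]_x (f x * g x).

Lemma SqP f : Sq f <-> measurable_fun setT f /\ Int (fun x => f x ^+ 2).
Proof.
split=> [fL|[mf fI]].
  split; last exact: Lfun2_integrable_sqr.
  by move: fL; rewrite /Sq inE => /andP[/[!inE]/= mf _].
rewrite /Sq inE; apply/andP; split; rewrite inE//= /finite_norm unlock.
rewrite poweR_lty//.
move/integrableP : fI => [_]; apply: le_lt_trans; rewrite le_eqVlt; apply/orP; left; apply/eqP.
apply: eq_integral => x _ /=.
by rewrite powR_mulrn// normrX.
Qed.

Lemma Sq_meas f : Sq f -> measurable_fun setT f.
Proof. by case/SqP. Qed.

Lemma Int_meas f : Int f -> measurable_fun setT f.
Proof. by move/measurable_int/measurable_EFinP. Qed.

Lemma Int_ext f g : f =1 g -> Int f -> Int g.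
Proof. by move=> /funext ->. Qed.

Lemma IntD f g : Int f -> Int g -> Int (fun x => f x + g x).
Proof. by move=> If Ig; apply: (integrableD measurableT If Ig). Qed.

Lemma IntZ (k : R) f : Int f -> Int (fun x => k * f x).
Proof. by move=> If; apply: (integrableZl measurableT k If). Qed.

Lemma IntN f : Int f -> Int (fun x => - f x).
Proof. by move=> /(IntZ (-1)); apply: Int_ext => x; rewrite mulN1r. Qed.

Lemma IntB f g : Int f -> Int g -> Int (fun x => f x - g x).
Proof. by move=> If /IntN; exact: IntD. Qed.

Lemma Int_le f g : measurable_fun setT f -> (forall x, `|f x| <= `|g x|) ->
  Int g -> Int f.
Proof.
move=> mf fg; apply: le_integrable => //; first exact/measurable_EFinP.
by move=> x _; rewrite /= lee_fin.
Qed.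

Lemma ip_int f g : Sq f -> Sq g -> Int (fun x => f x * g x).
Proof. by move=> Sf Sg; apply/Lfun1_integrable; apply: Lfun2_mul_Lfun1. Qed.

Lemma Sq_ext f g : f =1 g -> Sq f -> Sq g.
Proof. by move=> /funext ->. Qed.

Lemma Sq_le f g : measurable_fun setT f -> (forall x, `|f x| <= `|g x|) ->
  Sq g -> Sq f.
Proof.
move=> mf fg /SqP[mg Ig]; apply/SqP; split => //; apply: Int_le Ig.
  exact: measurable_funX.
by move=> x; rewrite !normrX lerXn2r// nnegrE.
Qed.

Lemma SqZ (k : R) f : Sq f -> Sq (fun x => k * f x).
Proof.
move=> /SqP[mf If]; apply/SqP; split; first exact: measurable_funM.
by apply: Int_ext (IntZ (k ^+ 2) If) => x /=; rewrite exprMn.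
Qed.

Lemma SqD f g : Sq f -> Sq g -> Sq (fun x => f x + g x).
Proof.
move=> /[dup] Sf /SqP[mf If] /[dup] Sg /SqP[mg Ig]; apply/SqP; split.
  exact: measurable_funD.
apply: Int_ext (IntD (IntD If Ig) (IntZ 2 (ip_int Sf Sg))) => x /=; ring.
Qed.

Lemma SqN f : Sq f -> Sq (fun x => - f x).
Proof. by move/(SqZ (-1)); apply: Sq_ext => x; rewrite mulN1r. Qed.

Lemma SqB f g : Sq f -> Sq g -> Sq (fun x => f x - g x).
Proof. by move=> Sf /SqN; exact: SqD. Qed.

Lemma Sq0 : Sq (fun=> 0).
Proof.
apply/SqP; split=> //; rewrite /Int.
by apply: eq_integrable (integrable0 _ _) => // x _ /=; rewrite expr0n.
Qed.

Lemma measurable_restr D f : measurable D -> measurable_fun D f ->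
  measurable_fun setT (f \_ D).
Proof. by move=> mD mf; apply/(measurable_restrictT _ mD). Qed.

Lemma Sq_restr D f : measurable D -> Sq f -> Sq (f \_ D).
Proof.
move=> mD Sf; apply: Sq_le (Sf).
  apply: measurable_restr => //; apply: measurable_funTS; exact: Sq_meas.
by move=> x; rewrite patchE; case: ifP => // _; rewrite normr0.
Qed.

Lemma Int_restr D f : measurable D -> Int f -> Int (f \_ D).
Proof.
move=> mD If; apply: Int_le (If).
  apply: measurable_restr => //; apply: measurable_funTS; exact: Int_meas.
by move=> x; rewrite patchE; case: ifP => // _; rewrite normr0.
Qed.

Lemma Int_restrE D f : measurable D ->
  Int (f \_ D) <-> mu.-integrable D (EFin \o f).
Proof.
move=> mD; rewrite integrable_mkcond// /Int.
rewrite (_ : EFin \o f \_ D = (EFin \o f) \_ D)//.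
by apply/funext => x; rewrite !patchE /= patchE; case: ifP.
Qed.

Lemma restr_restr (D E : set R) f : (f \_ D) \_ E = f \_ (D `&` E).
Proof.
apply/funext => x; rewrite !patchE in_setI.
by case: (x \in E); case: (x \in D).
Qed.

Lemma restr_sub (D E : set R) f : E `<=` D -> (f \_ D) \_ E = f \_ E.
Proof. by move=> ED; rewrite restr_restr setIidr. Qed.

Lemma Int_restrS D E f : measurable E -> E `<=` D -> Int (f \_ D) -> Int (f \_ E).
Proof. by move=> mE ED; rewrite -(restr_sub f ED); exact: Int_restr. Qed.

Lemma Sq_restrS D E f : measurable E -> E `<=` D -> Sq (f \_ D) -> Sq (f \_ E).
Proof. by move=> mE ED; rewrite -(restr_sub f ED); exact: Sq_restr. Qed.

Lemma Sq_bounded (a b M : R) f : measurable_fun setT f ->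
  (forall x, `|f x| <= M) -> (forall x, ~ `[a, b]%classic x -> f x = 0) -> Sq f.
Proof.
move=> mf fM f0; apply/SqP; split=> //.
have -> : (fun x => f x ^+ 2) = (fun x => f x ^+ 2) \_ `[a, b].
  apply/funext => x; rewrite patchE; case: ifPn => // /negP; rewrite inE => H.
  by rewrite f0// expr0n.
apply/Int_restrE => //; apply: measurable_bounded_integrable => //.
- by rewrite /= lebesgue_measure_itv/=; case: ifP => _; rewrite ltry.
- apply: measurable_funTS; exact: measurable_funX.
- exists (M ^+ 2); split; first by rewrite num_real.
  move=> K MK x _ /=; apply: le_trans (ltW MK); rewrite normrX.
  rewrite lerXn2r// ?nnegrE//.
  by rewrite (le_trans _ (fM x)).
Qed.

Lemma Sq_indic (a b : R) : Sq (\1_(`[a, b]%classic)).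
Proof.
apply: (@Sq_bounded a b 1) => //.
  by move=> x; rewrite indicE; case: (x \in _); rewrite ?normr1 ?normr0.
by move=> x xab; rewrite indicE memNset.
Qed.

Lemma Sq_Int (a b : R) f : Sq f -> (forall x, ~ `[a, b]%classic x -> f x = 0) ->
  Int f.
Proof.
move=> Sf f0; apply: Int_ext (ip_int Sf (Sq_indic a b)) => x /=.
rewrite indicE; have [xab|xab] := boolP (x \in `[a, b]%classic).
  by rewrite mulr1.
by rewrite mulr0 f0// => H; move/negP: xab; apply; rewrite inE.
Qed.

Lemma Sq_bounded_restr (M a b : R) f : measurable_fun setT f -> (forall x, `|f x| <= M) ->
  Sq (f \_ `]a, b[).
Proof.
move=> mf fM; apply: (@Sq_bounded a b M).
- by apply: measurable_restr => //; exact: measurable_funTS.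
- by move=> x; rewrite patchE; case: ifP => _ //; rewrite normr0 (le_trans _ (fM x)).
- by move=> x xn; rewrite patchE memNset// => /subset_itv_oo_cc.
Qed.

Lemma L2_integrable a b f : L2 `]a, b[ f -> Int (f \_ `]a, b[).
Proof.
by move=> Lf; apply: (@Sq_Int a b) => // x xn; rewrite patchE memNset// => /subset_itv_oo_cc.
Qed.

Lemma ipC f g : ip f g = ip g f.
Proof. by apply: eq_Rintegral => x _; rewrite mulrC. Qed.

Lemma ipDl f g h : Sq f -> Sq g -> Sq h ->
  ip (fun x => f x + g x) h = ip f h + ip g h.
Proof.
move=> Sf Sg Sh; rewrite -RintegralD//; try exact: ip_int.
by apply: eq_Rintegral => x _; rewrite mulrDl.
Qed.

Lemma ipZl (k : R) f h : Sq f -> Sq h -> ip (fun x => k * f x) h = k * ip f h.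
Proof.
move=> Sf Sh; rewrite -RintegralZl//; last exact: ip_int.
by apply: eq_Rintegral => x _; rewrite mulrA.
Qed.

Lemma ip_extl f g h : f =1 g -> ip f h = ip g h.
Proof. by move=> /funext ->. Qed.

Lemma ipBl f g h : Sq f -> Sq g -> Sq h ->
  ip (fun x => f x - g x) h = ip f h - ip g h.
Proof.
move=> Sf Sg Sh; rewrite -mulN1r -ipZl// -ipDl//; last exact: SqZ.
by apply: ip_extl => x; rewrite mulN1r.
Qed.

Lemma ipDr f g h : Sq f -> Sq g -> Sq h ->
  ip h (fun x => f x + g x) = ip h f + ip h g.
Proof. by move=> *; rewrite ipC ipDl// ![ip _ h]ipC. Qed.

Lemma ipBr f g h : Sq f -> Sq g -> Sq h ->
  ip h (fun x => f x - g x) = ip h f - ip h g.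
Proof. by move=> *; rewrite ipC ipBl// ![ip _ h]ipC. Qed.

Lemma ipZr (k : R) f h : Sq f -> Sq h -> ip h (fun x => k * f x) = k * ip h f.
Proof. by move=> *; rewrite ipC ipZl// ipC. Qed.

Lemma ip_ge0 f : 0 <= ip f f.
Proof. by apply: Rintegral_ge0 => x _; rewrite -expr2 sqr_ge0. Qed.

(** The polynomial t |-> ip (f + t g) (f + t g) is nonnegative; take t at its minimum. *)
Lemma cauchy_schwarz f g : Sq f -> Sq g -> ip f g ^+ 2 <= ip f f * ip g g.
Proof.
move=> Sf Sg.
have H t : 0 <= ip f f + 2 * t * ip f g + t ^+ 2 * ip g g.
  have := ip_ge0 (fun x => f x + t * g x).
  have St := SqZ t Sg.
  rewrite ipDl// ?ipDr// ?ipZl// ?ipZr//; last exact: SqD.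
  by rewrite (ipC g f) => /le_trans; apply; lra.
have := ip_ge0 g; rewrite le_eqVlt => /predU1P[g0|g0].
  (* the polynomial is then affine in t, so its slope must vanish *)
  rewrite -g0 mulr0; have [->|fg0] := eqVneq (ip f g) 0; first by rewrite expr0n.
  exfalso; have := H (- (ip f f + 1) / (2 * ip f g)).
  rewrite -g0 mulr0 addr0.
  rewrite (_ : 2 * _ * _ = - (ip f f + 1)); last by field.
  lra.
have := H (- ip f g / ip g g).
rewrite (_ : _ + _ + _ = (ip f f * ip g g - ip f g ^+ 2) / ip g g); last first.
  by field; rewrite gt_eqF.
by rewrite pmulr_lge0 ?invr_gt0// subr_ge0.
Qed.

Lemma norm_ip_le f g : Sq f -> Sq g -> `|ip f g| <= Num.sqrt (ip f f) * Num.sqrt (ip g g).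
Proof.
move=> Sf Sg; rewrite -sqrtrM ?ip_ge0// -sqrtr_sqr ler_wsqrtr//; exact: cauchy_schwarz.
Qed.

Lemma ip_cvg (T : Type) (F : set_system T) {FF : Filter F}
   (f g : T -> R -> R) (f0 g0 : R -> R) :
   Sq f0 -> Sq g0 ->
   (\forall s \near F, Sq (f s)) -> (\forall s \near F, Sq (g s)) ->
   ip (fun x => f s x - f0 x) (fun x => f s x - f0 x) @[s --> F] --> 0 ->
   ip (fun x => g s x - g0 x) (fun x => g s x - g0 x) @[s --> F] --> 0 ->
   ip (f s) (g s) @[s --> F] --> ip f0 g0.
Proof.
move=> S0 T0 Sf Sg cf cg.
have csf : Num.sqrt (ip (fun x => f s x - f0 x) (fun x => f s x - f0 x)) @[s --> F] --> 0.
  rewrite -(sqrtr0 R); apply: continuous_cvg => //; exact: sqrt_continuous.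
have csg : Num.sqrt (ip (fun x => g s x - g0 x) (fun x => g s x - g0 x)) @[s --> F] --> 0.
  rewrite -(sqrtr0 R); apply: continuous_cvg => //; exact: sqrt_continuous.
apply/subr_cvg0.
have bnd : (Num.sqrt (ip (fun x => f s x - f0 x) (fun x => f s x - f0 x)) *
   Num.sqrt (ip (fun x => g s x - g0 x) (fun x => g s x - g0 x)) +
   Num.sqrt (ip (fun x => f s x - f0 x) (fun x => f s x - f0 x)) * Num.sqrt (ip g0 g0)
   + Num.sqrt (ip f0 f0) * Num.sqrt (ip (fun x => g s x - g0 x) (fun x => g s x - g0 x)))
   @[s --> F] --> 0 * 0 + 0 * Num.sqrt (ip g0 g0) + Num.sqrt (ip f0 f0) * 0.
  apply: cvgD; last by apply: cvgM => //; exact: cvg_cst.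
  by apply: cvgD; apply: cvgM => //; exact: cvg_cst.
rewrite !mul0r mulr0 !addr0 in bnd.
apply/norm_cvg0P.
apply: (@squeeze_cvgr _ _ _ _ (fun=> 0)); [|exact: cvg_cst|exact: bnd].
near=> s.
have Ss : Sq (f s) by near: s.
have Ts : Sq (g s) by near: s.
have Sd := SqB Ss S0. have Td := SqB Ts T0.
rewrite normr_ge0/=.
have -> : ip (f s) (g s) - ip f0 g0 =
   ip (fun x => f s x - f0 x) (fun x => g s x - g0 x) +
   ip (fun x => f s x - f0 x) g0 + ip f0 (fun x => g s x - g0 x).
  by rewrite !ipBl// !ipBr//; ring.
rewrite (le_trans (ler_normD _ _))// lerD ?norm_ip_le//.
by rewrite (le_trans (ler_normD _ _))// lerD ?norm_ip_le//.
Unshelve. all: by end_near. Qed.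

End L2toolbox.

(** * Affine changes of variable *)

Section Affine.
Context {R : realType}.
Local Notation mu := (@lebesgue_measure R).

Lemma measurable_affine (k c : R) : measurable_fun setT (fun x : R => k * x + c).
Proof. by apply: measurable_funD => //; apply: measurable_funM. Qed.

Lemma measurable_shift (w : R -> R) (b : R) : measurable_fun setT w ->
  measurable_fun setT (fun x : R => w (x + b)).
Proof. by move=> mw; apply: (measurableT_comp mw); exact: measurable_funD. Qed.

Let pushaff (k c : R) : {measure set (measurableTypeR R) -> \bar R} :=
  measure_function_pushforward__canonical__measure_function_Measure mu
    (measurable_affine k c : @measurable_fun _ _ (measurableTypeR R)
       (measurableTypeR R) setT (fun x : R => k * x + c)).

(** Both sides are measures in A that agree on the intervals ]a, b], which
determines Lebesgue measure. *)
Lemma measure_affine (k c : R) (A : set R) : k != 0 -> measurable A ->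
  mu A = (`|k|%:E * mu ((fun x => k * x + c)%R @^-1` A))%E.
Proof.
move=> k0 mA.
pose m := mscale (NngNum (normr_ge0 k)) (pushaff k c).
have -> : (`|k|%:E * mu ((fun x => k * x + c)%R @^-1` A))%E = m A by [].
apply: lebesgue_measure_unique => // X [[a b] _ <-] /=.
rewrite /m /mscale /= /pushforward lebesgue_measure_itv/= lte_fin.
have [kp|kn] : 0 < k \/ k < 0 by case: (ltgtP k 0) k0 => // ?; [right|left].
- have -> : (fun x => k * x + c) @^-1` `]a, b] = `](a - c) / k, (b - c) / k]%classic.
    apply/seteqP; split => x /=; rewrite !in_itv/= ltr_pdivrMr// ler_pdivlMr//
     ltrBlDr lerBrDr; by rewrite (mulrC x).
  rewrite lebesgue_measure_itv/= lte_fin ltr_pM2r ?invr_gt0// ltrD2r.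
  case: ifP => _; last by rewrite mule0.
  rewrite -!EFinD -EFinM gtr0_norm//; congr EFin; field. by rewrite gt_eqF.
- have -> : (fun x => k * x + c) @^-1` `]a, b] = `[(b - c) / k, (a - c) / k[%classic.
    apply/seteqP; split => x /=; rewrite !in_itv/= ltr_ndivlMr// ler_ndivrMr//
     ltrBlDr lerBrDr (mulrC x); by rewrite andbC.
  rewrite lebesgue_measure_itv/= lte_fin ltr_nM2r ?invr_lt0// ltrD2r.
  case: ifP => _; last by rewrite mule0.
  rewrite -!EFinD -EFinM ltr0_norm//; congr EFin; field. by rewrite lt_eqF.
Qed.

Lemma ge0_integral_affine (k c : R) (f : R -> \bar R) : k != 0 ->
  measurable_fun setT f -> (forall x, 0 <= f x)%E ->
  (\int[mu]_x f x = `|k|%:E * \int[mu]_x f (k * x + c)%R)%E.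
Proof.
move=> k0 mf f0.
pose m := mscale (NngNum (normr_ge0 k)) (pushaff k c).
rewrite (eq_measure_integral m); last first.
  by move=> A mA _; rewrite /m /mscale/= (measure_affine c k0 mA).
rewrite ge0_integral_mscale//; congr (_ * _)%E.
exact: (ge0_integral_pushforward (measurable_affine k c : @measurable_fun _ _ (measurableTypeR R) (measurableTypeR R) setT (fun x : R => k * x + c)) mu measurableT).
Qed.

Lemma Int_affine (k c : R) (f : R -> R) : k != 0 -> Int f ->
  Int (fun x => f (k * x + c)).
Proof.
move=> k0 /integrableP[/measurable_EFinP mf iF].
apply/integrableP; split.
  by apply/measurable_EFinP; apply: measurableT_comp => //; exact: measurable_affine.
move: iF; rewrite (@ge0_integral_affine k c)//; last by do 2 apply: measurableT_comp => //.
set J := integral _ _ _; rewrite -/J.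
have kp : (0 < `|k|%:E)%E by rewrite lte_fin normr_gt0.
have : (0 <= J)%E by apply: integral_ge0.
by case: J => [r| |]//= _; rewrite ?ltry// gt0_muley// .
Qed.

(** The case of nonnegative functions, applied to the positive and negative parts. *)
Lemma integral_affine (k c : R) (f : R -> R) : k != 0 -> Int f ->
  \int[mu]_x f x = `|k| * \int[mu]_x f (k * x + c).
Proof.
move=> k0 If; have mf := Int_meas If; have Ik := Int_affine c k0 If.
have E (h : R -> R) : (\int[mu]_x (h x)%:E = \int[mu]_x (EFin \o h)^\+ x -
    \int[mu]_x (EFin \o h)^\- x)%E by exact: integralE.
have Ek : (\int[mu]_x (f (k * x + c)%R)%:E =
    \int[mu]_x (EFin \o f)^\+ (k * x + c)%R -
    \int[mu]_x (EFin \o f)^\- (k * x + c)%R)%E.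
  rewrite E; congr (_ - _)%E; apply: eq_integral => x _.
    by rewrite !funeposE.
  by rewrite !funenegE.
rewrite /Rintegral E Ek.
have pp : measurable_fun setT (fun x => (EFin \o f) ^\+ x)%E.
  exact/measurable_funepos/measurable_EFinP.
have nn : measurable_fun setT (fun x => (EFin \o f) ^\- x)%E.
  exact/measurable_funeneg/measurable_EFinP.
rewrite (@ge0_integral_affine k c _ k0 pp)//.
rewrite (@ge0_integral_affine k c _ k0 nn)//.
rewrite -[`|k| in RHS]/(fine (`|k|%:E)) -fineM//; last first.
  by rewrite -Ek; exact: integrable_fin_num.
have aux (a b : \bar R) : a \is a fin_num ->
    fine (`|k|%:E * a - `|k|%:E * b)%E = fine (`|k|%:E * (a - b))%E.
  by move=> af; rewrite muleBr// fin_num_adde_defr.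
apply: aux; have := integrable_pos_fin_num measurableT Ik.
by congr (_ \is a fin_num); apply: eq_integral => x _; rewrite !funeposE.
Qed.

Lemma Sq_affine (k c : R) (f : R -> R) : k != 0 -> Sq f ->
  Sq (fun x => f (k * x + c)).
Proof.
move=> k0 /SqP[mf If]; apply/SqP; split; last exact: (Int_affine c k0 If).
by apply: measurableT_comp => //; exact: measurable_affine.
Qed.

Lemma ip_affine (k c : R) (f g : R -> R) : k != 0 -> Sq f -> Sq g ->
  ip f g = `|k| * ip (fun x => f (k * x + c)) (fun x => g (k * x + c)).
Proof. by move=> k0 Sf Sg; rewrite /ip (integral_affine c k0 (ip_int Sf Sg)). Qed.

Lemma ae_affine (k c : R) (P : R -> Prop) : k != 0 ->
  {ae mu, forall x, P x} -> {ae mu, forall x, P (k * x + c)}.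
Proof.
move=> k0 [A [mA A0 PA]].
exists ((fun x => k * x + c) @^-1` A); split.
- have := measurable_affine k c measurableT mA; by rewrite setTI.
- apply/eqP; move: A0; rewrite (measure_affine c k0 mA) => /eqP.
  by rewrite mule_eq0 eqe normr_eq0 (negbTE k0).
- move=> x /= nP; exact: PA.
Qed.

End Affine.

(** * Primitives and null functions *)

Section Primitive.
Context {R : realType}.
Local Notation mu := (@lebesgue_measure R).
Implicit Types (f g : R -> R).

Lemma ae_imp (P Q : R -> Prop) : (forall x, P x -> Q x) ->
  {ae mu, forall x, P x} -> {ae mu, forall x, Q x}.
Proof. by move=> PQ; apply: filterS; first exact: (ae_filter_ringOfSetsType mu). Qed.

Lemma ae_and (P Q : R -> Prop) : {ae mu, forall x, P x} ->
  {ae mu, forall x, Q x} -> {ae mu, forall x, P x /\ Q x}.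
Proof. by move=> aP aQ; apply: filterI; first exact: (ae_filter_ringOfSetsType mu). Qed.

Lemma dominated_cvg (u : nat -> R -> R) f g : (forall n, measurable_fun setT (u n)) ->
  (forall x, u n x @[n --> \oo] --> f x) -> (forall n x, `|u n x| <= g x) ->
  Int g -> Int f /\ \int[mu]_x u n x @[n --> \oo] --> \int[mu]_x f x.
Proof.
move=> mu_ uf ug Ig.
have mf : measurable_fun setT f.
  by apply: (@measurable_fun_cvg _ _ _ setT u) => // x _; exact: uf.
have If : Int f.
  apply: Int_le Ig => // x.
  have g0 : 0 <= g x by apply: le_trans (ug 0%N x).
  rewrite (ger0_norm g0).
  have : `|u n x| @[n --> \oo] --> `|f x| by apply: cvg_norm; exact: uf.
  by move=> H; apply: (ler_cvg_to H (cvg_cst (g x))); near=> n; exact: ug.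
split=> //.
have [|||||_ _ H] := @dominated_convergence _ _ R mu setT measurableT
  (fun n => EFin \o u n) (EFin \o f) (EFin \o g).
- by move=> n; apply/measurable_EFinP; exact: mu_.
- exact/measurable_EFinP.
- by apply: aeW => x _; apply: cvg_EFin; [exact: nearW|exact: uf].
- by [].
- by apply: aeW => x n _; rewrite /= lee_fin.
have := fine_cvg (_ : _ --> (fine (\int[mu]_x (EFin \o f) x)%E)%:E).
apply.
by rewrite fineK//; exact: integrable_fin_num.
Unshelve. all: by end_near. Qed.

Lemma Rintegral_restr f (D : set R) : \int[mu]_(x in D) f x = \int[mu]_x (f \_ D) x.
Proof. exact: Rintegral_mkcond. Qed.

Definition primitive f x : R := \int[mu]_(t in `]-oo, x]) f t.

Lemma Int_subset f (D : set R) : measurable D -> Int f -> mu.-integrable D (EFin \o f).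
Proof. by move=> mD; apply: integrableS. Qed.

Lemma primitiveB f a b : Int f -> a <= b ->
  primitive f b - primitive f a = \int[mu]_(t in `]a, b[) f t.
Proof.
move=> If ab.
rewrite /primitive (@Rintegral_itvB _ f -oo%O (BRight b) a)//; last exact: Int_subset.
by rewrite -Rintegral_itv_bndo_bndc//; exact: Int_subset.
Qed.

Lemma primitive_continuous f : Int f -> continuous (primitive f).
Proof.
move=> If x; apply/cvgrPdist_lt => e e0.
have [d [d0 dP]] := integral_normr_continuous If e0.
have H a b : a <= b -> b - a < d -> `|primitive f b - primitive f a| < e.
  move=> ab bad; rewrite primitiveB//; apply: le_lt_trans.
    by apply: le_normr_Rintegral => //; exact: Int_subset.
  apply: dP => //; rewrite /= lebesgue_measure_itv/=; case: ifP => _; last by rewrite lte_fin.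
  by rewrite -EFinD lte_fin.
near=> y.
have yx : `|x - y| < d by near: y; apply: cvgr_dist_lt => //.
have [xy|yx'] := leP x y.
  by rewrite distrC H// (le_lt_trans (ler_norm _))// distrC.
by rewrite H// ?ltW// (le_lt_trans (ler_norm _)).
Unshelve. all: by end_near. Qed.

Lemma Int_locally f : Int f -> locally_integrable setT f.
Proof. by move=> If; apply: open_integrable_locally => //; exact: openT. Qed.

Lemma primitive_derive_ae f : Int f ->
  {ae mu, forall x, derivable (primitive f) x 1 /\ derive1 (primitive f) x = f x}.
Proof.
move=> If; apply: FTC1Ny; last exact: Int_locally.
by move=> y; exact: Int_subset.
Qed.

(** The primitive of f is constant on ]A, B[, and its derivative is f almost
everywhere. All pointwise identities below are obtained in this way, from
equalities of integrals over intervals. *)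
Lemma ae_eq0_integral f A B : Int f ->
  (forall a b, A < a -> a < b -> b < B -> \int[mu]_(x in `]a, b[) f x = 0) ->
  {ae mu, forall x, A < x < B -> f x = 0}.
Proof.
move=> If f0; apply: ae_imp (primitive_derive_ae If) => x [_ <-] /andP[Ax xB].
rewrite derive1E (@near_eq_derive _ _ _ _ (cst (primitive f x)) x 1)//.
  by rewrite derive_cst.
near=> y.
have Ay : A < y by near: y; exact: lt_nbhsr.
have yB : y < B by near: y; exact: lt_nbhsl.
rewrite /cst; have [xy|yx|->//] := ltgtP x y.
  by apply/eqP; rewrite -subr_eq0 primitiveB// ?ltW// f0.
by apply/eqP; rewrite eq_sym -subr_eq0 primitiveB// ?ltW// f0.
Unshelve. all: by end_near. Qed.

End Primitive.

(** * Smooth plateau functions *)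

Section Spline.
Context {R : realType}.
Local Notation mu := (@lebesgue_measure R).
Implicit Types (f g : R -> R).

(** Reads off the derivative of a piecewise polynomial from a single estimate,
without a case distinction at the knots. *)
Lemma is_derive_quadratic f (x d C : R) :
  (forall y, `|f y - f x - d * (y - x)| <= C * (y - x) ^+ 2) ->
  is_derive x 1 f d.
Proof.
move=> H.
have cv : h^-1 *: (f (h *: 1 + x) - f x) @[h --> 0^'] --> d.
  apply/cvgrPdist_le => e e0; near=> h.
  have h0 : h != 0 by near: h; exact: nbhs_dnbhs_neq.
  rewrite /GRing.scale/= mulr1.
  have -> : d - h^-1 * (f (h + x) - f x) = - (h^-1 * (f (h + x) - f x - d * (h + x - x))).
    by field.
  rewrite normrN normrM normfV ler_pdivrMl ?normr_gt0//.
  apply: le_trans (H _) _; rewrite addrK -real_normK ?num_real// expr2 mulrCA ler_wpM2l//.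
  have : `|h| * (`|C| + 1) <= e.
    rewrite -ler_pdivlMr; last by rewrite ltr_wpDl.
    near: h. apply: dnbhs0_le. by rewrite divr_gt0// ltr_wpDl.
  apply: le_trans; rewrite mulrC ler_wpM2l//.
  by rewrite (le_trans (ler_norm _))// lerDl.
apply: DeriveDef; last by apply/cvg_lim.
by apply/cvg_ex; exists d.
Unshelve. all: by end_near. Qed.

Definition pospart (x : R) : R := Num.max x 0.

Lemma pospart_lip x y : `|pospart y - pospart x| <= `|y - x|.
Proof.
rewrite /pospart; have [y0|y0] := leP y 0; have [x0|x0] := leP x 0;
  rewrite ?subrr ?subr0 ?sub0r ?normrN ?normr0//.
- by rewrite gtr0_norm// distrC gtr0_norm; lra.
- by rewrite !gtr0_norm; lra.
Qed.

Lemma pospart2_quadratic x y : `|pospart y ^+ 2 - pospart x ^+ 2 - 2 * pospart x * (y - x)| <= (y - x) ^+ 2.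
Proof.
rewrite /pospart; have [y0|y0] := leP y 0; have [x0|x0] := leP x 0.
- by rewrite expr0n/= mulr0 mul0r !subr0 normr0 sqr_ge0.
- have := mulr_ge0_le0 (ltW x0) y0; rewrite expr0n/= ler_norml => ?.
  by apply/andP; split; nra.
- have := mulr_ge0_le0 (ltW y0) x0; rewrite expr0n/= ler_norml => ?.
  by apply/andP; split; nra.
- rewrite (_ : _ - _ - _ = (y - x) ^+ 2); last by ring.
  by rewrite ger0_norm// sqr_ge0.
Qed.

Lemma is_derive_pospart2 (x : R) : is_derive x 1 (fun y => pospart y ^+ 2) (2 * pospart x).
Proof.
apply: (@is_derive_quadratic _ _ _ 1) => y; rewrite mul1r; exact: pospart2_quadratic.
Qed.

Lemma is_derive_pospart3 (x : R) : is_derive x 1 (fun y => pospart y ^+ 3) (3 * pospart x ^+ 2).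
Proof.
have -> : (fun y => pospart y ^+ 3) = (fun y => y * pospart y ^+ 2).
  by apply/funext => y; rewrite /pospart; case: leP => _; rewrite ?expr0n/= ?mulr0// exprS.
have H := is_derive_pospart2 x.
apply: is_derive_eq; rewrite /GRing.scale/=.
by rewrite /pospart; case: leP => _; ring.
Qed.

Lemma is_derive_shift (f f' : R -> R) (k b x : R) :
  is_derive (k * x + b) 1 f (f' (k * x + b)) ->
  is_derive x 1 (fun y => f (k * y + b)) (k * f' (k * x + b)).
Proof.
move=> H.
have H2 : is_derive x 1 (fun y => k * y + b) k.
  by apply: is_derive_eq; rewrite /GRing.scale/= mulr1 addr0.
have := @is_derive1_comp _ f (fun y => k * y + b) x _ _ H H2.
by rewrite mulrC.
Qed.

(** [spline1] is the quadratic B-spline with knots 0, 1, 2, 3, a bump of integral 1;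
[spline0] is its primitive, a step from 0 to 1, and [spline2] its derivative,
which is Lipschitz. *)
Definition spline0 (x : R) : R := (pospart x ^+ 3 - 3 * pospart (x - 1) ^+ 3 + 3 * pospart (x - 2) ^+ 3 - pospart (x - 3) ^+ 3) / 6.
Definition spline1 (x : R) : R := (pospart x ^+ 2 - 3 * pospart (x - 1) ^+ 2 + 3 * pospart (x - 2) ^+ 2 - pospart (x - 3) ^+ 2) / 2.
Definition spline2 (x : R) : R := pospart x - 3 * pospart (x - 1) + 3 * pospart (x - 2) - pospart (x - 3).

Lemma is_derive_shift1 (f f' : R -> R) (b x : R) :
  is_derive (x - b) 1 f (f' (x - b)) ->
  is_derive x 1 (fun y => f (y - b)) (f' (x - b)).
Proof.
move=> H; have := @is_derive_shift f f' 1 (- b) x; rewrite !mul1r => /(_ H).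
by under eq_fun do rewrite mul1r.
Qed.

Lemma is_derive_spline0 (x : R) : is_derive x 1 spline0 (spline1 x).
Proof.
have D0 := is_derive_pospart3 x.
have D1 := @is_derive_shift1 (fun y => pospart y ^+ 3) (fun y => 3 * pospart y ^+ 2) 1 x (is_derive_pospart3 (x - 1)).
have D2 := @is_derive_shift1 (fun y => pospart y ^+ 3) (fun y => 3 * pospart y ^+ 2) 2 x (is_derive_pospart3 (x - 2)).
have D3 := @is_derive_shift1 (fun y => pospart y ^+ 3) (fun y => 3 * pospart y ^+ 2) 3 x (is_derive_pospart3 (x - 3)).
rewrite /spline0; apply: is_derive_eq; rewrite /spline1 /GRing.scale/=; by field.
Qed.

Lemma is_derive_spline1 (x : R) : is_derive x 1 spline1 (spline2 x).
Proof.
have D0 := is_derive_pospart2 x.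
have D1 := @is_derive_shift1 (fun y => pospart y ^+ 2) (fun y => 2 * pospart y) 1 x (is_derive_pospart2 (x - 1)).
have D2 := @is_derive_shift1 (fun y => pospart y ^+ 2) (fun y => 2 * pospart y) 2 x (is_derive_pospart2 (x - 2)).
have D3 := @is_derive_shift1 (fun y => pospart y ^+ 2) (fun y => 2 * pospart y) 3 x (is_derive_pospart2 (x - 3)).
rewrite /spline1; apply: is_derive_eq; rewrite /spline2 /GRing.scale/=; by field.
Qed.

Lemma spline0_le0 x : x <= 0 -> spline0 x = 0.
Proof. by move=> x0; rewrite /spline0 /pospart; do 4 (case: leP => ?; try lra). Qed.
Lemma spline0_ge3 x : 3 <= x -> spline0 x = 1.
Proof.
rewrite le_eqVlt => /predU1P[<-|x0]; rewrite /spline0 /pospart.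
  by do 4 (case: leP => ?; try lra); field.
by do 4 (case: leP => ?; try lra); field.
Qed.
Lemma spline1_out x : ~~ (0 <= x <= 3) -> spline1 x = 0.
Proof.
move/negP => H; have [x0|x0] : x < 0 \/ 3 < x.
  case: (ltP x 0) => x0; [by left|right].
  by rewrite ltNge; apply/negP => ?; apply: H; apply/andP.
by rewrite /spline1 /pospart; do 4 (case: leP => ?; try lra).
by rewrite /spline1 /pospart; do 4 (case: leP => ?; try lra); field.
Qed.
Lemma spline2_out x : ~~ (0 <= x <= 3) -> spline2 x = 0.
Proof.
move/negP => H; have [x0|x0] : x < 0 \/ 3 < x.
  case: (ltP x 0) => x0; [by left|right].
  by rewrite ltNge; apply/negP => ?; apply: H; apply/andP.
by rewrite /spline2 /pospart; do 4 (case: leP => ?; try lra).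
by rewrite /spline2 /pospart; do 4 (case: leP => ?; try lra); field.
Qed.

Lemma spline2_lip x y : `|spline2 y - spline2 x| <= 8 * `|y - x|.
Proof.
have H b : `|pospart (y - b) - pospart (x - b)| <= `|y - x|.
  by apply: le_trans (pospart_lip _ _) _; rewrite opprB addrA subrK.
have := H 0; have := H 1; have := H 2; have := H 3.
rewrite /spline2 !subr0 !ler_norml => /andP[? ?] /andP[? ?] /andP[? ?] /andP[? ?].
apply/andP; split; lra.
Qed.

Lemma lipschitz_derive_bound (f f' : R -> R) (M : R) : (forall x : R, is_derive x 1 f (f' x)) ->
  (forall x, `|f' x| <= M) -> forall x y, `|f y - f x| <= M * `|y - x|.
Proof.
move=> fd fM.
have H a b : a < b -> `|f b - f a| <= M * `|b - a|.
  move=> ab; have [|c _ ->] := @MVT R f f' a b ab (fun z _ => fd z).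
  - apply: continuous_subspaceT => z; apply: differentiable_continuous.
    by apply/derivable1_diffP; case: (fd z).
  - by rewrite normrM ler_wpM2r.
move=> x y; have [xy|yx|->] := ltgtP x y; last by rewrite !subrr normr0 mulr0.
  exact: H.
by rewrite distrC (distrC y) H.
Qed.

Lemma taylor_lipschitz_derive (f f' : R -> R) (M : R) : (forall x : R, is_derive x 1 f (f' x)) ->
  (forall x y, `|f' y - f' x| <= M * `|y - x|) ->
  forall x y, `|f y - f x - f' x * (y - x)| <= M * (y - x) ^+ 2.
Proof.
move=> fd fM.
have M0 : 0 <= M.
  by have := le_trans (normr_ge0 _) (fM 0 1); rewrite subr0 normr1 mulr1.
have cont a b : {within `[a, b], continuous f}.
  apply: continuous_subspaceT => z; apply: differentiable_continuous.
  by apply/derivable1_diffP; case: (fd z).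
have H a b x : a < b -> x \in `[a, b] -> `|f b - f a - f' x * (b - a)| <= M * (b - a) ^+ 2.
  move=> ab; rewrite in_itv/= => /andP[ax xb].
  have [//|c + ->] := @MVT R f f' a b ab (fun z _ => fd z).
  rewrite in_itv/= => /andP[ac cb].
  rewrite -mulrBl normrM expr2 mulrA (gtr0_norm (_ : 0 < b - a)) ?subr_gt0//.
  rewrite ler_wpM2r ?subr_ge0 ?(ltW ab)//; apply: le_trans (fM _ _) _.
  rewrite ler_wpM2l//.
  by rewrite ler_norml; apply/andP; split; lra.
move=> x y; have [xy|yx|->] := ltgtP x y; last by rewrite !subrr mulr0 subrr normr0 expr0n mulr0.
  by apply: H => //; rewrite in_itv/= lexx ltW.
rewrite -normrN (_ : - (f y - f x - f' x * (y - x)) = f x - f y - f' x * (x - y)); last by ring.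
by rewrite -(sqrrN (y - x)) opprB H// in_itv/= lexx ltW.
Qed.

Lemma spline2_bound x : `|spline2 x| <= 24.
Proof.
have [/andP[x0 x3]|/spline2_out->] := boolP (0 <= x <= 3); last by rewrite normr0.
have := spline2_lip 0 x; rewrite [spline2 0](_ : _ = 0) ?subr0 ?(ger0_norm x0)//.
  by move=> /le_trans; apply; lra.
by rewrite /spline2 /pospart; do 4 (case: leP => ?; try lra).
Qed.

Lemma spline1_bound x : `|spline1 x| <= 72.
Proof.
have [/andP[x0 x3]|/spline1_out->] := boolP (0 <= x <= 3); last by rewrite normr0.
have := lipschitz_derive_bound is_derive_spline1 spline2_bound 0 x; rewrite [spline1 0](_ : _ = 0) ?subr0 ?(ger0_norm x0)//.
  by move=> /le_trans; apply; lra.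
by rewrite /spline1 /pospart; do 4 (case: leP => ?; try lra).
Qed.

Lemma spline0_bound x : `|spline0 x| <= 216.
Proof.
have [x0|x0] := leP x 0; first by rewrite spline0_le0// normr0.
have [x3|x3] := leP 3 x; first by rewrite spline0_ge3// normr1; lra.
have := lipschitz_derive_bound is_derive_spline0 spline1_bound 0 x; rewrite (@spline0_le0 0)// !subr0 (gtr0_norm x0).
by move=> /le_trans; apply; lra.
Qed.

Lemma spline1_integral : \int[mu]_x spline1 x = 1.
Proof.
have -> : \int[mu]_x spline1 x = \int[mu]_(x in `[0, 3]) spline1 x.
  rewrite [RHS]Rintegral_restr; apply: eq_Rintegral => x _; rewrite patchE; case: ifPn => // /negP.
  by rewrite inE/= in_itv/= => H; rewrite spline1_out//; apply/negP.
have cS x : {for x, continuous spline0}.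
  by apply: differentiable_continuous; apply/derivable1_diffP; case: (is_derive_spline0 x).
rewrite /Rintegral (@continuous_FTC2 _ spline1 spline0)//=.
- by rewrite spline0_ge3// spline0_le0// subr0.
- apply: continuous_subspaceT => x.
  by apply: differentiable_continuous; apply/derivable1_diffP; case: (is_derive_spline1 x).
- split.
  + by move=> x _; case: (is_derive_spline0 x).
  + by apply: cvg_at_right_filter; exact: cS.
  + by apply: cvg_at_left_filter; exact: cS.
- by move=> x _; rewrite derive1E; case: (is_derive_spline0 x).
Qed.

End Spline.

Section Plateau.
Context {R : realType}.
Local Notation mu := (@lebesgue_measure R).
Implicit Types (f g : R -> R).

(** The plateau rises from c + h to c + 4 h and descends from d - 4 h to d - h,
where h is this length; since 8 h <= d - c, the two ramps are disjoint. *)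
Definition ramp (c d : R) (n : nat) : R := (d - c) / (n + 8)%:R.
Definition plateau (c d : R) (n : nat) (x : R) : R :=
  spline0 ((x - c) / ramp c d n - 1) - spline0 ((x - d) / ramp c d n + 4).
Definition plateau1 (c d : R) (n : nat) (x : R) : R :=
  (ramp c d n)^-1 * (spline1 ((x - c) / ramp c d n - 1) - spline1 ((x - d) / ramp c d n + 4)).
Definition plateau2 (c d : R) (n : nat) (x : R) : R :=
  (ramp c d n)^-1 ^+ 2 * (spline2 ((x - c) / ramp c d n - 1) - spline2 ((x - d) / ramp c d n + 4)).

(** The Lipschitz bound on x2 makes the difference quotients of x1 converge
uniformly, which is what differentiating a pairing in time asks for. *)
Record C2_bump (c d : R) (x0 x1 x2 : R -> R) (M : R) : Prop := C2Bump {
  bump_der0 : forall x : R, is_derive x 1 x0 (x1 x);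
  bump_der1 : forall x : R, is_derive x 1 x1 (x2 x);
  bump_bound : forall x, [/\ `|x0 x| <= M, `|x1 x| <= M & `|x2 x| <= M];
  bump_lip : forall x y, `|x2 y - x2 x| <= M * `|y - x|;
  bump_supp : forall x, ~~ (c <= x <= d) -> [/\ x0 x = 0, x1 x = 0 & x2 x = 0] }.

Lemma ramp_gt0 c d n : c < d -> 0 < ramp c d n.
Proof. by move=> cd; rewrite divr_gt0// subr_gt0. Qed.

Lemma is_derive_rescale (f f' : R -> R) (c h b x : R) : (forall y : R, is_derive y 1 f (f' y)) ->
  is_derive x 1 (fun y => f ((y - c) / h + b)) (h^-1 * f' ((x - c) / h + b)).
Proof.
move=> H; have := @is_derive_shift R f f' h^-1 (b - c / h) x (H _).
have E y : h^-1 * y + (b - c / h) = (y - c) / h + b by ring.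
by rewrite E; under eq_fun do rewrite E.
Qed.

Lemma is_derive_plateau c d n (x : R) : is_derive x 1 (plateau c d n) (plateau1 c d n x).
Proof.
have H1 := is_derive_rescale c (ramp c d n) (-1) x is_derive_spline0.
have H2 := is_derive_rescale d (ramp c d n) 4 x is_derive_spline0.
by rewrite /plateau; apply: is_derive_eq; rewrite /plateau1 mulrBr.
Qed.

Lemma is_derive_plateau1 c d n (x : R) : is_derive x 1 (plateau1 c d n) (plateau2 c d n x).
Proof.
have H1 := is_derive_rescale c (ramp c d n) (-1) x is_derive_spline1.
have H2 := is_derive_rescale d (ramp c d n) 4 x is_derive_spline1.
rewrite /plateau1; apply: is_derive_eq; rewrite /plateau2 /GRing.scale/=.
by ring.
Qed.

Lemma plateau_bound c d n x : `|plateau c d n x| <= 432.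
Proof.
rewrite /plateau (le_trans (ler_normB _ _))//.
have := spline0_bound ((x - c) / ramp c d n - 1); have := spline0_bound ((x - d) / ramp c d n + 4).
lra.
Qed.

(** The argument of the first spline is at least 3 as soon as that of the second
is nonnegative: at every point at most one ramp is active. *)
Lemma plateau_arg c d n x : c < d ->
  (x - c) / ramp c d n - 1 = (x - d) / ramp c d n + 4 + n%:R + 3.
Proof.
move=> cd; have w0 := ramp_gt0 n cd.
have E : (d - c) / ramp c d n = n%:R + 8.
  by rewrite /ramp invf_div mulrCA divff ?mulr1 ?natrD// subr_eq0 gt_eqF.
have -> : (x - c) / ramp c d n = (x - d) / ramp c d n + (d - c) / ramp c d n by ring.
by rewrite E; ring.
Qed.

Lemma plateau_out c d n x : c < d -> ~~ (c + ramp c d n <= x <= d - ramp c d n) ->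
  [/\ plateau c d n x = 0, plateau1 c d n x = 0 & plateau2 c d n x = 0].
Proof.
move=> cd /negP H; have A := plateau_arg n x cd; have n0 := ler0n R n.
have [x0|x0] : x < c + ramp c d n \/ d - ramp c d n < x.
  case: (ltP x (c + ramp c d n)) => x0; [by left|right].
  by rewrite ltNge; apply/negP => ?; apply: H; apply/andP.
- have a0 : (x - c) / ramp c d n - 1 < 0.
    have w0 := ramp_gt0 n cd.
    by rewrite subr_lt0 ltr_pdivrMr// mul1r ltrBlDl.
  rewrite /plateau /plateau1 /plateau2 !spline0_le0 ?spline1_out ?spline2_out ?subrr ?mulr0//; try lra;
   by apply/negP => /andP[]; lra.
- have a0 : 3 < (x - d) / ramp c d n + 4.
    have w0 := ramp_gt0 n cd.
    rewrite -ltrBlDr ltr_pdivlMr// (_ : 3 - 4 = -1) ?mulN1r; last by ring.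
    by rewrite ltrBrDl.
  rewrite /plateau /plateau1 /plateau2 !spline0_ge3 ?spline1_out ?spline2_out ?subrr ?mulr0//; try lra;
   by apply/negP => /andP[]; lra.
Qed.

Lemma plateau_eq1 c d n x : c < d -> c + 4 * ramp c d n <= x <= d - 4 * ramp c d n ->
  plateau c d n x = 1.
Proof.
move=> cd /andP[x0 x1]; have w0 := ramp_gt0 n cd.
rewrite /plateau spline0_ge3 ?spline0_le0 ?subr0//.
- by rewrite -lerBrDr sub0r ler_pdivrMr//; lra.
- by rewrite lerBrDr ler_pdivlMr//; lra.
Qed.

Lemma plateau_C2_bump c d n : c < d ->
  exists M, C2_bump (c + ramp c d n) (d - ramp c d n) (plateau c d n) (plateau1 c d n) (plateau2 c d n) M.
Proof.
move=> cd; have w0 := ramp_gt0 n cd; set h := ramp c d n.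
exists (432 + h^-1 * 144 + h^-1 ^+ 2 * 48 + h^-1 ^+ 2 * (16 * h^-1)).
have hi : 0 < h^-1 by rewrite invr_gt0.
have p1 : 0 <= h^-1 * 144 by rewrite mulr_ge0// ltW.
have p2 : 0 <= h^-1 ^+ 2 * 48 by rewrite mulr_ge0// sqr_ge0.
have p3 : 0 <= h^-1 ^+ 2 * (16 * h^-1) by rewrite mulr_ge0// ?sqr_ge0// mulr_ge0// ltW.
split.
- exact: is_derive_plateau.
- exact: is_derive_plateau1.
- move=> x; split.
  + by apply: le_trans (plateau_bound c d n x) _; lra.
  + rewrite /plateau1 normrM (gtr0_norm hi).
    have : h^-1 * `|spline1 ((x - c) / h - 1) - spline1 ((x - d) / h + 4)| <= h^-1 * 144.
      rewrite ler_pM2l//; apply: le_trans (ler_normB _ _) _.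
      have := spline1_bound ((x - c) / h - 1); have := spline1_bound ((x - d) / h + 4); lra.
    by move=> /le_trans; apply; lra.
  + rewrite /plateau2 normrM (ger0_norm (sqr_ge0 _)).
    have : h^-1 ^+ 2 * `|spline2 ((x - c) / h - 1) - spline2 ((x - d) / h + 4)| <= h^-1 ^+ 2 * 48.
      rewrite ler_wpM2l ?sqr_ge0//; apply: le_trans (ler_normB _ _) _.
      have := spline2_bound ((x - c) / h - 1); have := spline2_bound ((x - d) / h + 4); lra.
    by move=> /le_trans; apply; lra.
- move=> x y; rewrite /plateau2 -mulrBr normrM (ger0_norm (sqr_ge0 _)).
  have H : h^-1 ^+ 2 * `|spline2 ((y - c) / h - 1) - spline2 ((y - d) / h + 4) -
      (spline2 ((x - c) / h - 1) - spline2 ((x - d) / h + 4))| <= h^-1 ^+ 2 * (16 * h^-1) * `|y - x|.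
    rewrite -[leRHS]mulrA ler_wpM2l ?sqr_ge0//.
    have L b e : `|spline2 ((y - b) / h + e) - spline2 ((x - b) / h + e)| <= 8 * h^-1 * `|y - x|.
      apply: le_trans (spline2_lip _ _) _.
      rewrite (_ : _ - _ = (y - x) * h^-1); last by ring.
      by rewrite normrM (gtr0_norm hi) mulrAC mulrA.
    rewrite (_ : _ - _ - _ = (spline2 ((y - c) / h - 1) - spline2 ((x - c) / h - 1)) -
       (spline2 ((y - d) / h + 4) - spline2 ((x - d) / h + 4))); last by ring.
    apply: le_trans (ler_normB _ _) _.
    have := L c (-1); have := L d 4; lra.
  apply: le_trans H _; rewrite ler_wpM2r//; lra.
- by move=> x; exact: plateau_out.
Qed.

Lemma ramp_cvg0 c d : ramp c d n @[n --> \oo] --> 0.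
Proof.
rewrite /ramp -(mulr0 (d - c)); apply: cvgM; first exact: cvg_cst.
have := @cvg_harmonic R; rewrite -(cvg_shiftn 7) => H.
by under eq_fun do rewrite addnS -(addnC 7)%N addnC /= in H *.
Qed.

Lemma plateau_cvg c d x : c < d -> plateau c d n x @[n --> \oo] --> (\1_`]c, d[ x : R).
Proof.
move=> cd; rewrite indicE; have [|/negP] := boolP (x \in _).
  rewrite inE/= in_itv/= => /andP[cx xd].
  have C1 : c + 4 * ramp c d n @[n --> \oo] --> c + 4 * 0.
    by apply: cvgD; [exact: cvg_cst|apply: cvgM; [exact: cvg_cst|exact: ramp_cvg0]].
  have C2 : d - 4 * ramp c d n @[n --> \oo] --> d - 4 * 0.
    by apply: cvgB; [exact: cvg_cst|apply: cvgM; [exact: cvg_cst|exact: ramp_cvg0]].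
  rewrite mulr0 ?addr0 ?subr0 in C1 C2.
  apply: cvg_near_cst; near=> n; apply: plateau_eq1 => //; apply/andP; split.
    by near: n; apply: cvgr_le C1 _ cx.
  by near: n; apply: cvgr_ge C2 _ xd.
rewrite inE/= in_itv/= => H; apply: cvg_near_cst; apply: nearW => n.
have w0 := ramp_gt0 n cd.
have [//|] := @plateau_out c d n x cd.
apply/negP => /andP[? ?]; apply: H; apply/andP; split; lra.
Unshelve. all: by end_near. Qed.

Lemma derivable_measurable (f f' : R -> R) : (forall x : R, is_derive x 1 f (f' x)) ->
  measurable_fun setT f.
Proof.
move=> H; apply: continuous_measurable_fun => x.
by apply: differentiable_continuous; apply/derivable1_diffP; case: (H x).
Qed.

Lemma lipschitz_continuous (f : R -> R) M : (forall x y, `|f y - f x| <= M * `|y - x|) ->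
  continuous f.
Proof.
move=> H x; have M0 : 0 <= M.
  by have := le_trans (normr_ge0 _) (H 0 1); rewrite subr0 normr1 mulr1.
apply/cvgrPdist_le => e e0; near=> y.
rewrite distrC (le_trans (H _ _))//.
have : `|x - y| <= e / (M + 1).
  by near: y; apply: cvgr_dist_le => //; rewrite divr_gt0// ltr_wpDl//.
rewrite distrC ler_pdivlMr ?ltr_wpDl// => /(le_trans _); apply.
by rewrite mulrC ler_wpM2l// lerDl.
Unshelve. all: by end_near. Qed.

End Plateau.

Section Concentration.
Context {R : realType}.
Local Notation mu := (@lebesgue_measure R).
Implicit Types (f g : R -> R).

Lemma within_bounded (m : R -> R) c d : c < d -> {within `[c, d], continuous m} ->
  exists2 M, 0 <= M & forall x, c <= x <= d -> `|m x| <= M.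
Proof.
move=> cd cm.
have [a _ Ha] := EVT_max (ltW cd) cm; have [b _ Hb] := EVT_min (ltW cd) cm.
exists (`|m a| + `|m b|); first by rewrite addr_ge0.
move=> x xcd; have xi : x \in `[c, d] by rewrite in_itv.
have := Ha _ xi; have := Hb _ xi => h1 h2.
rewrite ler_norml; apply/andP; split.
  by have := ler_norm (- m b); rewrite normrN; have := normr_ge0 (m a); lra.
by have := ler_norm (m a); have := normr_ge0 (m b); lra.
Qed.

Lemma within_measurable (m : R -> R) c d : {within `[c, d], continuous m} ->
  measurable_fun setT (m \_ `[c, d]).
Proof.
move=> cm; apply: measurable_restr => //.
by apply: subspace_continuous_measurable_fun.
Qed.

Lemma within_integrable (m : R -> R) c d : {within `[c, d], continuous m} ->
  Int (m \_ `[c, d]).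
Proof.
move=> cm; apply/Int_restrE => //; apply: continuous_compact_integrable => //.
exact: segment_compact.
Qed.

Lemma continuous_integrable_oo (m : R -> R) c d : {within `[c, d], continuous m} ->
  mu.-integrable `]c, d[ (EFin \o m).
Proof.
move=> cm; apply: (@integrableS _ _ _ mu `[c, d]) => //; first exact: subset_itv_oo_cc.
by apply: continuous_compact_integrable => //; exact: segment_compact.
Qed.

Lemma continuous_integrable_itv (f : R -> R) (a b : R) : continuous f -> mu.-integrable `]a, b[ (EFin \o f).
Proof. by move=> cf; apply: continuous_integrable_oo; exact: continuous_subspaceT. Qed.

Lemma IntM_bounded f g M : Int f -> measurable_fun setT g -> (forall x, `|g x| <= M) ->
  Int (fun x => f x * g x).
Proof.
move=> If mg gM; apply: Int_le (IntZ M If).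
  by apply: measurable_funM => //; exact: Int_meas.
move=> x; rewrite !normrM mulrC ler_wpM2r//.
by apply: le_trans (gM x) _; exact: ler_norm.
Qed.

Lemma cvg_to_right (T : Type) (F : set_system T) {FF : Filter F} (f : T -> R) (l : R) :
  f x @[x --> F] --> l -> (\forall x \near F, l < f x) -> f x @[x --> F] --> l^'+.
Proof.
move=> fl lf P HP; have := fl _ HP => H; rewrite /nbhs/= in H *.
by apply: filterS2 H lf => x /= h /h.
Qed.

Lemma cvg_to_left (T : Type) (F : set_system T) {FF : Filter F} (f : T -> R) (l : R) :
  f x @[x --> F] --> l -> (\forall x \near F, f x < l) -> f x @[x --> F] --> l^'-.
Proof.
move=> fl lf P HP; have := fl _ HP => H; rewrite /nbhs/= in H *.
by apply: filterS2 H lf => x /= h /h.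
Qed.

(** Each ramp of [plateau1] is a rescaled [spline1], of mass 1, that shrinks to an
end point. Weak formulations tested with plateaus thus yield values at the end
points of functions that are continuous up to the boundary. *)
Lemma plateau1_concentrates (m : R -> R) c d : c < d -> {within `[c, d], continuous m} ->
  \int[mu]_(x in `]c, d[) (m x * plateau1 c d n x) @[n --> \oo] --> m c - m d.
Proof.
move=> cd cm; have [M M0 HM] := within_bounded cd cm.
have [cl cr cl'] : [/\ {in `]c, d[, continuous m}, m x @[x --> c^'+] --> m c &
    m x @[x --> d^'-] --> m d] by apply/(continuous_within_itvP _ cd).
pose mt : R -> R := m \_ `[c, d].
have mtE x : c <= x <= d -> mt x = m x.
  by move=> xcd; rewrite /mt patchE mem_set//= in_itv.
have mtb x : `|mt x| <= M.
  rewrite /mt patchE; case: ifPn => [|_]; last by rewrite normr0.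
  by rewrite inE/= in_itv/= => /HM.
have mtm : measurable_fun setT mt by exact: within_measurable.
have mtI : Int mt by exact: within_integrable.
have S1m : measurable_fun setT (@spline1 R) by apply: derivable_measurable is_derive_spline1.
have S1I : Int (@spline1 R).
  apply: (@Sq_Int _ 0 3); last by move=> x xn; apply: spline1_out; apply/negP.
  apply: (@Sq_bounded _ 0 3 72) => //; first exact: spline1_bound.
  by move=> x xn; apply: spline1_out; apply/negP.
pose w := ramp c d.
have w0 n : 0 < w n by exact: ramp_gt0.
have pieceI n e b : Int (fun x => mt x * ((w n)^-1 * spline1 ((x - e) / w n + b))).
  apply: (@IntM_bounded _ _ ((w n)^-1 * 72)) => //.
    apply: measurable_funM => //; apply: (@measurableT_comp _ _ _ _ _ _ (@spline1 R)) => //.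
    apply: measurable_funD => //; apply: measurable_funM => //.
    exact: measurable_funB.
  by move=> x; rewrite normrM gtr0_norm ?invr_gt0// ler_pM2l ?invr_gt0// spline1_bound.
(* each ramp, rescaled to unit size *)
have ramp_lim e b (l : R) : (forall y : R, 0 < y < 3 -> mt (w n * (y - b) + e) @[n --> \oo] --> l) ->
  \int[mu]_x (mt x * ((w n)^-1 * spline1 ((x - e) / w n + b))) @[n --> \oo] --> l.
  move=> H.
  have E n : \int[mu]_x (mt x * ((w n)^-1 * spline1 ((x - e) / w n + b))) =
     \int[mu]_x (mt (w n * (x - b) + e) * spline1 x).
    rewrite (@integral_affine _ (w n) (e - w n * b)) ?gt_eqF// gtr0_norm// -RintegralZl//; last first.
      by apply: (@Int_affine _ _ _ (fun x => mt x * ((w n)^-1 * spline1 ((x - e) / w n + b)))) => //; rewrite gt_eqF.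
    apply: eq_Rintegral => x _.
    have -> : w n * x + (e - w n * b) = w n * (x - b) + e by ring.
    have -> : (w n * (x - b) + e - e) / w n + b = x by field; rewrite gt_eqF.
    by field; rewrite gt_eqF.
  under eq_fun do rewrite E.
  rewrite -[l]mulr1 -spline1_integral -RintegralZl//.
  have [|x|n x||_] := @dominated_cvg R (fun n x => mt (w n * (x - b) + e) * spline1 x)
    (fun x => l * spline1 x) (fun x => M * `|spline1 x|).
  - move=> n; apply: measurable_funM => //.
    apply: (@measurableT_comp _ _ _ _ _ _ mt) => //.
    apply: measurable_funD => //; apply: measurable_funM => //.
    exact: measurable_funB.
  - have [x03|/negP x03] := boolP (0 < x < 3).
      by apply: cvgM; [exact: H|exact: cvg_cst].
    have -> : spline1 x = 0 :> R.
      have [->|x0] := eqVneq x 0; first by rewrite /spline1 /pospart; do 4 (case: leP => ?; try lra).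
      have [->|x3] := eqVneq x 3; first by rewrite /spline1 /pospart; do 4 (case: leP => ?; try lra); field.
      apply: spline1_out; apply/negP => /andP[h0 h3]; apply: x03.
      by rewrite !lt_neqAle eq_sym x0 h0 x3.
    under eq_fun do rewrite mulr0.
    by rewrite mulr0; exact: cvg_cst.
  - by rewrite normrM ler_wpM2r.
  - by apply: IntZ; exact: integrable_norm.
  - by [].
have wc k : w n * k @[n --> \oo] --> 0.
  by rewrite -(mul0r k); apply: cvgM; [exact: ramp_cvg0|exact: cvg_cst].
(* so the rescaled ramps stay inside [c, d] *)
have w8 n : 8 * w n <= d - c.
  have := @plateau_arg R c d n 0 cd; rewrite -/(w n) => E.
  have : (d - c) / w n = n%:R + 8.
    have : (d - c) / w n = (0 - c) / w n - (0 - d) / w n by ring.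
    move=> ->; lra.
  have n0 := ler0n R n.
  move=> E2; rewrite -ler_pdivlMr// E2; lra.
have R1 := ramp_lim c (-1) (m c); have R2 := ramp_lim d 4 (m d).
have E n : \int[mu]_(x in `]c, d[) (m x * plateau1 c d n x) =
  \int[mu]_x (mt x * ((w n)^-1 * spline1 ((x - c) / w n + (-1)))) -
  \int[mu]_x (mt x * ((w n)^-1 * spline1 ((x - d) / w n + 4))).
  rewrite -RintegralB//; try exact: pieceI.
  rewrite Rintegral_restr; apply: eq_Rintegral => x _; rewrite -mulrBr -mulrBr.
  rewrite patchE; case: ifPn => [|/negP].
    rewrite inE/= in_itv/= => /andP[? ?].
    by rewrite mtE// !ltW.
  rewrite inE/= in_itv/= => xn.
  have [_ + _] : [/\ plateau c d n x = 0, plateau1 c d n x = 0 & plateau2 c d n x = 0].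
    apply: plateau_out => //; apply/negP => /andP[h1 h2]; apply: xn.
    by apply/andP; have := w0 n; rewrite -/(w n) in h1 h2; split; lra.
  by rewrite /plateau1 -/(w n) => ->; rewrite mulr0.
under eq_fun do rewrite E.
apply: cvgB.
- apply: R1 => y /andP[y0 y3].
  have H : w n * (y - -1) + c @[n --> \oo] --> c^'+.
    apply: cvg_to_right; last by apply: nearW => n; rewrite ltrDr mulr_gt0//; lra.
    by rewrite -[X in _ --> X]add0r; apply: cvgD; [exact: wc|exact: cvg_cst].
  have K : m (w n * (y - -1) + c) @[n --> \oo] --> m c by exact: cvg_comp H cr.
  apply: cvg_trans K; apply: near_eq_cvg; apply: nearW => n /=.
  have wn := w0 n; have w8n := w8 n.
  have wy : 0 <= w n * y <= w n * 3 by rewrite mulr_ge0 ?(ltW wn) ?(ltW y0)// ler_pM2l// ltW.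
  by rewrite mtE//; apply/andP; split; lra.
- apply: R2 => y /andP[y0 y3].
  have H : w n * (y - 4) + d @[n --> \oo] --> d^'-.
    apply: cvg_to_left; last by apply: nearW => n; rewrite gtrDr pmulr_rlt0//; lra.
    by rewrite -[X in _ --> X]add0r; apply: cvgD; [exact: wc|exact: cvg_cst].
  have K : m (w n * (y - 4) + d) @[n --> \oo] --> m d by exact: cvg_comp H cl'.
  apply: cvg_trans K; apply: near_eq_cvg; apply: nearW => n /=.
  have wn := w0 n; have w8n := w8 n.
  have wy : 0 <= w n * y <= w n * 3 by rewrite mulr_ge0 ?(ltW wn) ?(ltW y0)// ler_pM2l// ltW.
  by rewrite mtE//; apply/andP; split; lra.
Qed.

End Concentration.

(** * Weak derivatives and the fundamental theorem *)

Section WeakDerivative.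
Context {R : realType}.
Local Notation mu := (@lebesgue_measure R).
Implicit Types (f g w : R -> R).

Lemma cvg_eqfun (T : Type) (F : set_system T) (V : topologicalType) (u u' : T -> V) (l : V) :
  u =1 u' -> u x @[x --> F] --> l -> u' x @[x --> F] --> l.
Proof. by move=> /funext ->. Qed.

Lemma derive1_eq (f f' : R -> R) : (forall x : R, is_derive x 1 f (f' x)) -> derive1 f = f'.
Proof. by move=> H; apply/funext => x; rewrite derive1E; case: (H x). Qed.

Lemma C2_bump_continuous c d (x0 x1 x2 : R -> R) M : C2_bump c d x0 x1 x2 M ->
  [/\ continuous x0, continuous x1 & continuous x2].
Proof.
case=> d0 d1 _ lp _; split; last exact: lipschitz_continuous lp.
- by move=> x; apply: differentiable_continuous; apply/derivable1_diffP; case: (d0 x).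
- by move=> x; apply: differentiable_continuous; apply/derivable1_diffP; case: (d1 x).
Qed.

Lemma plateau_C1c (a b c d : R) n : a <= c -> c < d -> d <= b -> C1c a b (plateau c d n).
Proof.
move=> ac cd db; have [M T] := plateau_C2_bump n cd; have w0 := ramp_gt0 n cd.
have [_ c1 _] := C2_bump_continuous T; case: T => d0 d1 _ _ sp.
split.
- by move=> x; case: (d0 x).
- by rewrite (derive1_eq d0).
- exists `[c + ramp c d n, d - ramp c d n]%classic; split.
  + exact: segment_compact.
  + by move=> x /=; rewrite !in_itv/= => /andP[? ?]; apply/andP; split; lra.
  + move=> x /= xn; have [|->//] := sp x; apply/negP => h; apply: xn.
    by rewrite in_itv.
Qed.

Lemma plateau_measurable (c d : R) n : measurable_fun setT (plateau c d n).
Proof. exact: derivable_measurable (is_derive_plateau c d n). Qed.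

Lemma integral_plateau_cvg f (c d : R) : c < d -> Int f ->
  \int[mu]_x (f x * plateau c d n x) @[n --> \oo] --> \int[mu]_(x in `]c, d[) f x.
Proof.
move=> cd If.
have -> : \int[mu]_(x in `]c, d[) f x = \int[mu]_x (f x * \1_`]c, d[ x).
  rewrite Rintegral_restr; apply: eq_Rintegral => x _; rewrite patchE indicE.
  by case: ifP => _; rewrite ?mulr1 ?mulr0.
have [|x|n x||//] := @dominated_cvg R (fun n x => f x * plateau c d n x) (fun x => f x * \1_`]c, d[ x)
   (fun x => 432 * `|f x|).
- by move=> n; apply: measurable_funM; [exact: Int_meas|exact: plateau_measurable].
- by apply: cvgM; [exact: cvg_cst|exact: plateau_cvg].
- by rewrite normrM mulrC ler_wpM2r// plateau_bound.
- by apply: IntZ; exact: integrable_norm.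
Qed.

(** Test the weak derivative with plateaus on ]c, d[: their derivatives
concentrate at c and d, where w is continuous. *)
Lemma H1_FTC a b w g : H1 a b w g -> {within `[a, b], continuous w} ->
  forall c d, a <= c -> c < d -> d <= b -> w d - w c = \int[mu]_(x in `]c, d[) g x.
Proof.
move=> [L2w L2g wk] cw c d ac cd db.
have sub : `]c, d[ `<=` `]a, b[.
  by move=> x /=; rewrite !in_itv/= => /andP[? ?]; apply/andP; split; lra.
have cw' : {within `[c, d], continuous w}.
  apply: continuous_subspaceW cw => x /=; rewrite !in_itv/= => /andP[? ?].
  by apply/andP; split; lra.
have C1 := plateau1_concentrates cd cw'.
have C2 := integral_plateau_cvg cd (L2_integrable L2g).
have E n : \int[mu]_(x in `]c, d[) (w x * plateau1 c d n x) =
   - \int[mu]_x ((g \_ `]a, b[) x * plateau c d n x).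
  have := wk _ (plateau_C1c n ac cd db).
  rewrite (derive1_eq (is_derive_plateau c d n)) => H.
  transitivity (\int[mu]_(x in `]a, b[) (w x * plateau1 c d n x)).
    rewrite Rintegral_restr [RHS]Rintegral_restr; apply: eq_Rintegral => x _; rewrite !patchE.
    have [xcd|/negP xcd] := boolP (x \in `]c, d[%classic).
      by rewrite mem_set//; apply: sub; rewrite inE in xcd.
    case: ifP => // _.
    have [|_ -> _] := @plateau_out R c d n x cd; last by rewrite mulr0.
    have w0 := ramp_gt0 n cd; apply/negP => /andP[? ?]; apply: xcd; rewrite inE/= in_itv/=.
    by apply/andP; split; lra.
  rewrite H; congr (- _); rewrite Rintegral_restr; apply: eq_Rintegral => x _; rewrite !patchE.
  by case: ifP => // _; rewrite mul0r.
have EQ : w c - w d = - \int[mu]_(x in `]c, d[) (g \_ `]a, b[) x.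
  by apply: (cvg_unique (@Rhausdorff R) (cvg_eqfun E C1)); exact: cvgN.
have -> : w d - w c = \int[mu]_(x in `]c, d[) (g \_ `]a, b[) x by lra.
rewrite Rintegral_restr [RHS]Rintegral_restr; apply: eq_Rintegral => x _; rewrite !patchE.
have [xcd|//] := boolP (x \in `]c, d[%classic).
by rewrite mem_set//; apply: sub; rewrite inE in xcd.
Qed.

End WeakDerivative.

(** * Pairings of the solution with travelling test functions *)

Section Pairing.
Context {R : realType}.
Variables (L v : R).
Hypothesis hL : 0 < L.
Local Notation mu := (@lebesgue_measure R).
Implicit Types (f g w : R -> R) (u : R -> R -> R).
Local Notation It := (It L v).
Local Notation contL2 := (contL2 L v).

Lemma measurable_It t : measurable (It t). Proof. exact: measurable_itv. Qed.
Lemma in_It t x : It t x = (v * t < x < L + v * t).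
Proof. by rewrite /Defs.It/= in_itv. Qed.

(** The slice at time t, brought back to the fixed interval on which [contL2]
compares slices. *)
Definition moved u t : R -> R := (fun y => u (y + v * t) t) \_ `]0, L[.

Lemma movedE u t y : moved u t y = ((u ^~ t) \_ (It t)) (1 * y + v * t).
Proof.
rewrite /moved !patchE mul1r.
have -> : (y + v * t \in It t) = (y \in `]0, L[%classic); last by [].
apply/idP/idP; rewrite !inE/= in_It in_itv/= => /andP[? ?]; apply/andP; split; lra.
Qed.

Lemma Sq_moved u t : L2 (It t) (u ^~ t) -> Sq (moved u t).
Proof.
move=> H; have := @Sq_affine R 1 (v * t) _ (oner_neq0 _) H.
by apply: Sq_ext => y; rewrite movedE.
Qed.

(** The slice u(., t) tested with a function carried along the lines
x + sg t = const; sg = 1 and sg = -1 are the two families of characteristics. *)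
Definition pairing u w (sg : R) t : R := \int[mu]_(x in It t) (u x t * w (x + sg * t)).

Lemma pairing_moved u w sg t : L2 (It t) (u ^~ t) -> Sq (w \_ `](v + sg) * t, L + (v + sg) * t[) ->
  pairing u w sg t = ip (moved u t) ((fun y => w (y + (v + sg) * t)) \_ `]0, L[).
Proof.
move=> Su Sw.
have -> : pairing u w sg t = ip ((u ^~ t) \_ (It t))
    (fun x => (w \_ `](v + sg) * t, L + (v + sg) * t[) (x + sg * t)).
  rewrite /pairing Rintegral_restr; apply: eq_Rintegral => x _; rewrite !patchE.
  case: ifPn => [|_]; last by rewrite mul0r.
  rewrite inE in_It => /andP[? ?]; rewrite mem_set//= in_itv/=.
  by apply/andP; split; lra.
have Sw' : Sq (fun x => (w \_ `](v + sg) * t, L + (v + sg) * t[) (x + sg * t)).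
  have := @Sq_affine R 1 (sg * t) _ (oner_neq0 _) Sw; apply: Sq_ext => x.
  by rewrite mul1r.
rewrite (ip_affine (v * t) (oner_neq0 _) Su Sw') normr1 mul1r.
apply: eq_Rintegral => y _; rewrite -movedE !patchE mul1r.
have -> : y + v * t + sg * t = y + (v + sg) * t by ring.
have -> : (y + (v + sg) * t \in `](v + sg) * t, L + (v + sg) * t[%classic) = (y \in `]0, L[%classic); last by [].
apply/idP/idP; rewrite !inE/= !in_itv/= => /andP[? ?]; apply/andP; split; lra.
Qed.

Lemma L2dist2_ip (D : set R) f g : measurable D -> Sq (f \_ D) -> Sq (g \_ D) ->
  L2dist2 D f g = (ip (fun x => (f \_ D) x - (g \_ D) x) (fun x => (f \_ D) x - (g \_ D) x))%:E.
Proof.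
move=> mD Sf Sg; have Sd := SqB Sf Sg.
rewrite /L2dist2 /ip /Rintegral fineK; last first.
  by apply: integrable_fin_num => //; exact: (ip_int Sd Sd).
rewrite [LHS]integral_mkcond; apply: eq_integral => x _; rewrite !patchE.
by case: ifP => // _; rewrite subrr mulr0.
Qed.

Lemma contL2_moved u (t : R) : contL2 u -> 0 <= t ->
  ip (fun y => moved u s y - moved u t y) (fun y => moved u s y - moved u t y)
    @[s --> within [set s | 0 <= s] (nbhs t)] --> 0.
Proof.
move=> [Lu cu] t0.
have C : fine (L2dist2 `]0, L[ (fun y => u (y + v * s) s) (fun y => u (y + v * t) t))
    @[s --> within [set s | 0 <= s] (nbhs t)] --> 0 by exact: fine_cvg (cu t t0).
apply: cvg_trans C; apply: near_eq_cvg; rewrite near_withinE; apply: nearW => s /= s0.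
by rewrite L2dist2_ip//; apply: Sq_moved; exact: Lu.
Qed.

Lemma ip_le_bounded (f : R -> R) (a b M : R) : a <= b -> Sq f -> (forall x, `|f x| <= M) ->
  (forall x, ~ `[a, b]%classic x -> f x = 0) -> ip f f <= M ^+ 2 * (b - a).
Proof.
move=> ab Sf fM f0.
have -> : M ^+ 2 * (b - a) = \int[mu]_x (M ^+ 2 * \1_`[a, b] x).
  rewrite RintegralZl//; last exact: integrable_indic_itv.
  congr (_ * _); rewrite /Rintegral integral_indic// setIT /= lebesgue_measure_itv/=.
  by rewrite lte_fin; move: ab; rewrite le_eqVlt => /predU1P[->|->//]; rewrite ltxx subrr.
apply: le_Rintegral => //.
- exact: ip_int.
- by apply: (IntZ (M ^+ 2)); exact: integrable_indic_itv.
- move=> x _; rewrite indicE -expr2; have [xab|/negP xab] := boolP (x \in `[a, b]%classic).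
    by rewrite mulr1 -real_normK ?num_real// lerXn2r// nnegrE// (le_trans _ (fM x)).
  by rewrite f0 ?expr0n ?mulr0// => h; apply: xab; rewrite inE.
Qed.

Lemma Sq_continuous_restr w (M a b : R) : continuous w -> (forall x, `|w x| <= M) ->
  Sq (w \_ `]a, b[).
Proof. by move=> /continuous_measurable_fun; exact: Sq_bounded_restr. Qed.

Lemma sqr_dist_cvg0 (C D t : R) : (C * `|s - t|) ^+ 2 * D @[s --> nbhs t] --> 0.
Proof.
have H : (C * `|s - t|) ^+ 2 * D @[s --> nbhs t] --> (C * `|t - t|) ^+ 2 * D.
  apply: (@cvgM _ _ _ _ (fun s => (C * `|s - t|) ^+ 2) (fun=> D)); last exact: cvg_cst.
  apply: (@cvg_comp _ _ _ (fun s => C * `|s - t|) (fun x => x ^+ 2)); last exact: exprn_continuous.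
  apply: cvgM; first exact: cvg_cst.
  by apply: cvg_norm; apply: cvgB; [exact: cvg_id|exact: cvg_cst].
by rewrite subrr normr0 mulr0 expr0n mul0r in H.
Qed.

(** Once the slices are brought back to ]0, L[, the pairing is the inner product
of two curves that are continuous in L^2. *)
Lemma pairing_cvg u w sg M (t : R) : contL2 u -> measurable_fun setT w -> (forall x, `|w x| <= M) ->
  let W s := (fun y => w (y + (v + sg) * s)) \_ (`]0, L[%classic : set R) in
  ip (fun x => W s x - W t x) (fun x => W s x - W t x) @[s --> nbhs t] --> 0 -> 0 <= t ->
  pairing u w sg s @[s --> within [set s | 0 <= s] (nbhs t)] --> pairing u w sg t.
Proof.
move=> cu mw wM W cW t0; have [Lu _] := cu.
have SW s : Sq (W s) by apply: (Sq_bounded_restr (M := M)); [exact: measurable_shift|move=> x; exact: wM].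
have E s : 0 <= s -> pairing u w sg s = ip (moved u s) (W s).
  by move=> s0; apply: pairing_moved; [exact: Lu|exact: Sq_bounded_restr].
rewrite (E _ t0).
have : ip (moved u s) (W s) @[s --> within [set s | 0 <= s] (nbhs t)] --> ip (moved u t) (W t).
  apply: ip_cvg => //.
  - exact: Sq_moved (Lu _ t0).
  - by rewrite near_withinE; apply: nearW => s /= s0; apply: Sq_moved; exact: Lu.
  - exact: nearW.
  - exact: contL2_moved.
  - exact: cvg_within_filter.
apply: cvg_trans; apply: near_eq_cvg; rewrite near_withinE; apply: nearW => s /= s0.
by rewrite E.
Qed.

Lemma pairing_continuous u w sg M (t : R) : contL2 u -> (forall x, `|w x| <= M) ->
  (forall x y, `|w y - w x| <= M * `|y - x|) -> 0 <= t ->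
  pairing u w sg s @[s --> within [set s | 0 <= s] (nbhs t)] --> pairing u w sg t.
Proof.
move=> cu wM wl; have cw := lipschitz_continuous wl.
have mw : measurable_fun setT w by exact: continuous_measurable_fun.
have M0 : 0 <= M by apply: le_trans (wM 0).
apply: (pairing_cvg cu mw wM).
apply: (@squeeze_cvgr _ _ _ _ (fun=> 0) (fun s => (M * `|v + sg| * `|s - t|) ^+ 2 * (L - 0))).
- apply: nearW => s; rewrite ip_ge0/=; apply: ip_le_bounded => //; first exact: ltW.
  + by apply: SqB; apply: (Sq_bounded_restr (M := M)) => //; exact: measurable_shift.
  + move=> x; rewrite !patchE; case: ifP => _; last by rewrite subrr normr0 !mulr_ge0.
    apply: le_trans (wl _ _) _; rewrite -mulrA ler_wpM2l// -normrM.
    by rewrite (_ : x + (v + sg) * s - _ = (v + sg) * (s - t))//; ring.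
  + move=> x xn; rewrite !patchE memNset ?subrr// => xab; apply: xn.
    exact: subset_itv_oo_cc xab.
- exact: cvg_cst.
- exact: sqr_dist_cvg0.
Qed.

End Pairing.

Section TimeDerivative.
Context {R : realType}.
Variables (L v : R).
Hypothesis hL : 0 < L.
Local Notation mu := (@lebesgue_measure R).
Implicit Types (f g w : R -> R) (u : R -> R -> R).
Local Notation It := (It L v).
Local Notation contL2 := (contL2 L v).
Local Notation pair := (pairing L v).

Lemma pairing_ip u w sg t (D : set R) : (forall x, It t x -> w (x + sg * t) != 0 -> D x) ->
  D `<=` It t ->
  pair u w sg t = ip ((u ^~ t) \_ D) (fun x => w (x + sg * t)).
Proof.
move=> HD DI; rewrite /pairing /ip Rintegral_restr; apply: eq_Rintegral => x _; rewrite !patchE.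
have [xD|/negP xD] := boolP (x \in D).
  by rewrite mem_set//; apply: DI; rewrite inE in xD.
case: ifPn => [xI|_]; last by rewrite mul0r.
have [->|w0] := eqVneq (w (x + sg * t)) 0; first by rewrite !mulr0.
by exfalso; apply: xD; rewrite inE; apply: HD => //; rewrite inE in xI.
Qed.

Lemma cvg_unwithin (T : Type) (V : topologicalType) (F : set_system T) {FF : Filter F}
   (A : set T) (f : T -> V) (l : V) : (\forall s \near F, A s) ->
   f s @[s --> within A F] --> l -> f s @[s --> F] --> l.
Proof.
move=> hA C P HP; have := C P HP; rewrite /nbhs/= /within/= => H.
by apply: filterS2 hA H => x /= Ax; apply.
Qed.

Lemma affine_gt0_near (k b t : R) : 0 < k * t + b -> \forall s \near t, 0 < k * s + b.
Proof.
move=> h; have C : k * s + b @[s --> t] --> k * t + b.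
  by apply: cvgD; [apply: cvgM; [exact: cvg_cst|exact: cvg_id]|exact: cvg_cst].
exact: cvgr_gt C _ h.
Qed.

Lemma ip0 g : ip (fun=> 0) g = 0.
Proof. by rewrite /ip; under eq_Rintegral do rewrite mul0r; rewrite Rintegral_cst// mul0r. Qed.

(** For s close to t, the travelling test function is supported in both It t and
It s, where [contC1L2] controls the difference quotients of phi. *)
Lemma support_near w sg (c d t : R) : 0 < t -> (forall x, ~~ (c <= x <= d) -> w x = 0) ->
  v * t < c - sg * t -> d - sg * t < L + v * t ->
  \forall s \near t^', [/\ 0 <= s, s != t,
   (forall x, w (x + sg * s) != 0 -> (It t `&` It s) x) &
   forall x, w (x + sg * t) != 0 -> (It t `&` It s) x].
Proof.
move=> t0 w0 ct dt.
  have supp s x : w (x + sg * s) != 0 -> c - sg * s <= x <= d - sg * s.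
    move=> h; have : c <= x + sg * s <= d by apply: contraNT h => /w0 ->.
    by move=> /andP[? ?]; apply/andP; split; lra.
  have n0 : \forall s \near t^', s != t by exact: nbhs_dnbhs_neq.
  have lin k b : 0 < k * t + b -> \forall s \near t^', 0 < k * s + b.
    by move=> h; apply: nbhs_dnbhs; exact: affine_gt0_near.
  have A : \forall s \near t^', 0 < 1 * s + 0 by apply: lin; lra.
  have B1 : \forall s \near t^', 0 < - sg * s + (c - v * t) by apply: lin; lra.
  have B2 : \forall s \near t^', 0 < sg * s + (L + v * t - d) by apply: lin; lra.
  have B3 : \forall s \near t^', 0 < (- sg - v) * s + c by apply: lin; lra.
  have B4 : \forall s \near t^', 0 < (v + sg) * s + (L - d) by apply: lin; lra.
  have B5 : \forall s \near t^', 0 < - v * s + (c - sg * t) by apply: lin; lra.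
  have B6 : \forall s \near t^', 0 < v * s + (L - d + sg * t) by apply: lin; lra.
  near=> s.
  have a : 0 < 1 * s + 0 by near: s.
  have b1 : 0 < - sg * s + (c - v * t) by near: s.
  have b2 : 0 < sg * s + (L + v * t - d) by near: s.
  have b3 : 0 < (- sg - v) * s + c by near: s.
  have b4 : 0 < (v + sg) * s + (L - d) by near: s.
  have b5 : 0 < - v * s + (c - sg * t) by near: s.
  have b6 : 0 < v * s + (L - d + sg * t) by near: s.
  split; [lra | by near: s | |].
  - by move=> x /supp /andP[h1 h2]; split; rewrite in_It; apply/andP; split; lra.
  - by move=> x /supp /andP[h1 h2]; split; rewrite in_It; apply/andP; split; lra.
Unshelve. all: by end_near. Qed.

(** A product rule. The increment of phi contributes its L^2 derivative phit; the
contribution l of the increment of the test function is left as a hypothesis,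
because it is computed differently for smooth functions and for indicators. *)
Lemma pairing_derive phi phit w sg (c d M l t : R) : contC1L2 L v phi phit ->
  0 < t -> measurable_fun setT w -> (forall x, `|w x| <= M) ->
  (forall x, ~~ (c <= x <= d) -> w x = 0) ->
  v * t < c - sg * t -> d - sg * t < L + v * t ->
  ip (fun x => w (x + sg * s) - w (x + sg * t)) (fun x => w (x + sg * s) - w (x + sg * t))
    @[s --> t^'] --> 0 ->
  (s - t)^-1 * (\int[mu]_(x in It t) (phi x t * (w (x + sg * s) - w (x + sg * t))))
     @[s --> t^'] --> l ->
  (s - t)^-1 * (pair phi w sg s - pair phi w sg t) @[s --> t^'] -->
    pair phit w sg t + l.
Proof.
move=> [[Lphi _] [Lphit _] dphi] t0 mw wM w0 ct dt W1 W2.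
have Sw s : Sq (fun x => w (x + sg * s)).
  apply: (@Sq_bounded _ (c - sg * s) (d - sg * s) M) => //.
    apply: (measurableT_comp mw); exact: measurable_funD.
  move=> x; rewrite /= in_itv/= => h; apply: w0; apply/negP => /andP[? ?]; apply: h.
  by apply/andP; split; lra.
pose D s := It t `&` It s.
have mD s : measurable (D s) by apply: measurableI; exact: measurable_It.
pose good s := [/\ 0 <= s, s != t, (forall x, w (x + sg * s) != 0 -> D s x) &
   forall x, w (x + sg * t) != 0 -> D s x].
have near_s : \forall s \near t^', good s by exact: (support_near t0 w0 ct dt).
pose Q s := (fun x => (phi x s - phi x t) / (s - t)) \_ (D s).
have Sphi s s' : 0 <= s -> D s' `<=` It s -> Sq ((phi ^~ s) \_ (D s')).
  by move=> s0 h; exact: Sq_restrS (mD s') h (Lphi s s0).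
have DIt s : D s `<=` It t by move=> x [].
have DIs s : D s `<=` It s by move=> x [].
have SQ s : 0 <= s -> Sq (Q s).
  move=> s0; have := SqZ (s - t)^-1 (SqB (Sphi s s s0 (DIs s)) (Sphi t s (ltW t0) (DIt s))).
  apply: Sq_ext => x; rewrite /Q !patchE; case: ifP => _; last by rewrite subrr mulr0.
  by rewrite mulrC.
have Sphit s : Sq ((phit ^~ t) \_ (D s)).
  exact: Sq_restrS (mD s) (DIt s) (Lphit t (ltW t0)).
pose G s := fun x => Q s x - ((phit ^~ t) \_ (D s)) x.
have GC : ip (fun x => G s x - 0) (fun x => G s x - 0) @[s --> t^'] --> 0.
  have C : fine (L2dist2 (D s) (fun x => (phi x s - phi x t) / (s - t)) (phit ^~ t))
      @[s --> t^'] --> 0.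
    apply: fine_cvg; apply: (@cvg_unwithin _ _ _ _ [set s | 0 <= s]).
      by apply: filterS near_s => s [].
    exact: dphi (ltW t0).
  apply: cvg_trans C; apply: near_eq_cvg; near=> s.
  have [s0 _ _ _] : good s by near: s.
  rewrite L2dist2_ip//; last exact: SQ.
  by rewrite /= /ip; apply: eq_Rintegral => x _; rewrite /G !subr0.
have T1 : ip (G s) (fun x => w (x + sg * s)) @[s --> t^'] --> ip (fun=> 0) (fun x => w (x + sg * t)).
  apply: ip_cvg => //.
  - exact: Sq0.
  - near=> s; apply: SqB => //; apply: SQ.
    by have [] : good s by near: s.
  - exact: nearW.
have T2 : ip ((phit ^~ t) \_ (It t)) (fun x => w (x + sg * s)) @[s --> t^'] -->
   ip ((phit ^~ t) \_ (It t)) (fun x => w (x + sg * t)).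
  apply: ip_cvg => //.
  - by apply: Lphit; exact: ltW.
  - by apply: nearW => s; apply: Lphit; exact: ltW.
  - exact: nearW.
  - apply: (@cvg_eqfun _ _ _ (fun=> 0)); last exact: cvg_cst.
    move=> s; rewrite -[LHS](ip0 (fun=> 0)) /ip; apply: eq_Rintegral => x _.
    by rewrite subrr.
rewrite ip0 in T1.
have T : ip (G s) (fun x => w (x + sg * s)) + ip ((phit ^~ t) \_ (It t)) (fun x => w (x + sg * s)) +
    (s - t)^-1 * (\int[mu]_(x in It t) (phi x t * (w (x + sg * s) - w (x + sg * t))))
    @[s --> t^'] --> 0 + ip ((phit ^~ t) \_ (It t)) (fun x => w (x + sg * t)) + l.
  by apply: cvgD => //; apply: cvgD.
rewrite add0r in T.
rewrite (@pairing_ip phit w sg t (It t))//.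
apply: cvg_trans T; apply: near_eq_cvg; near=> s => /=.
have [s0 st ws wt] : good s by near: s.
have st0 : s - t != 0 by rewrite subr_eq0.
rewrite (@pairing_ip phi w sg s (D s)) //; last by move=> x _; exact: ws.
rewrite (@pairing_ip phi w sg t (D s)) //; last by move=> x _; exact: wt.
have -> : \int[mu]_(x in It t) (phi x t * (w (x + sg * s) - w (x + sg * t))) =
   ip ((phi ^~ t) \_ (D s)) (fun x => w (x + sg * s) - w (x + sg * t)).
  rewrite Rintegral_restr; apply: eq_Rintegral => x _; rewrite !patchE.
  have [xD|/negP xD] := boolP (x \in D s).
    by rewrite (mem_set (DIt _ _ (set_mem xD))).
  case: ifPn => [xI|_]; last by rewrite mul0r.
  have [->|e1] := eqVneq (w (x + sg * s)) 0; last first.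
    by exfalso; apply: xD; apply/mem_set; exact: ws.
  have [->|e2] := eqVneq (w (x + sg * t)) 0; first by rewrite subrr mulr0 mul0r.
  by exfalso; apply: xD; apply/mem_set; exact: wt.
have -> : ip ((phit ^~ t) \_ (It t)) (fun x => w (x + sg * s)) =
   ip ((phit ^~ t) \_ (D s)) (fun x => w (x + sg * s)).
  apply: eq_Rintegral => x _; rewrite !patchE.
  have [xD|/negP xD] := boolP (x \in D s).
    by rewrite (mem_set (DIt _ _ (set_mem xD))).
  have [->|e1] := eqVneq (w (x + sg * s)) 0; first by rewrite !mulr0.
  by exfalso; apply: xD; apply/mem_set; exact: ws.
have -> : ip (G s) (fun x => w (x + sg * s)) = ip (Q s) (fun x => w (x + sg * s)) -
   ip ((phit ^~ t) \_ (D s)) (fun x => w (x + sg * s)).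
  by rewrite ipBl//; exact: SQ.
have -> : ip (Q s) (fun x => w (x + sg * s)) = (s - t)^-1 *
  (ip ((phi ^~ s) \_ (D s)) (fun x => w (x + sg * s)) - ip ((phi ^~ t) \_ (D s)) (fun x => w (x + sg * s))).
  rewrite -ipBl//; [|exact: Sphi|by apply: Sphi => //; exact: ltW].
  rewrite -ipZl//; last by apply: SqB; apply: Sphi => //; exact: ltW.
  by apply: ip_extl => x; rewrite /Q !patchE; case: ifP => _; rewrite ?subrr ?mulr0// mulrC.
rewrite ipBr//; last by apply: Sphi => //; exact: ltW.
ring.
Unshelve. all: by end_near. Qed.

End TimeDerivative.

Section SmoothTests.
Context {R : realType}.
Variables (L v : R).
Hypothesis hL : 0 < L.
Local Notation mu := (@lebesgue_measure R).
Implicit Types (f g w : R -> R) (u : R -> R -> R).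
Local Notation It := (It L v).
Local Notation contL2 := (contL2 L v).
Local Notation pair := (pairing L v).

Lemma ip_cvg0 (f : R -> R -> R) (a b C t : R) : a <= b ->
  (\forall s \near t, [/\ Sq (f s), (forall x, `|f s x| <= C * `|s - t|) &
     (forall x, ~ `[a, b]%classic x -> f s x = 0)]) ->
  ip (f s) (f s) @[s --> t] --> 0.
Proof.
move=> ab H.
apply: (@squeeze_cvgr _ _ _ _ (fun=> 0) (fun s => (C * `|s - t|) ^+ 2 * (b - a))).
- near=> s; rewrite ip_ge0/=.
  have [Sf fC f0] : [/\ Sq (f s), (forall x, `|f s x| <= C * `|s - t|) &
     (forall x, ~ `[a, b]%classic x -> f s x = 0)] by near: s.
  exact: ip_le_bounded.
- exact: cvg_cst.
- exact: sqr_dist_cvg0.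
Unshelve. all: by end_near. Qed.

Lemma lipschitz_shift_cvg0 w sg (c d M t : R) : measurable_fun setT w -> c <= d -> (forall x, `|w x| <= M) ->
  (forall x y, `|w y - w x| <= M * `|y - x|) ->
  (forall x, ~~ (c <= x <= d) -> w x = 0) ->
  ip (fun x => w (x + sg * s) - w (x + sg * t)) (fun x => w (x + sg * s) - w (x + sg * t))
    @[s --> t] --> 0.
Proof.
move=> mw cd wM wl w0; pose e := `|sg| * (`|t| + 1).
have e0 : 0 <= e by rewrite mulr_ge0// addr_ge0.
have supp s x : `|s - t| <= 1 -> ~ `[c - e, d + e]%classic x -> w (x + sg * s) = 0.
  move=> st; rewrite /= in_itv/= => h; apply: w0; apply/negP => /andP[h1 h2]; apply: h.
  have : `|sg * s| <= e.
    rewrite normrM /e ler_wpM2l//.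
    have -> : s = t + (s - t) by ring.
    by rewrite (le_trans (ler_normD _ _))// lerD2l.
  by rewrite ler_norml => /andP[? ?]; apply/andP; split; lra.
apply: (@ip_cvg0 _ (c - e) (d + e) (M * `|sg|)); first by lra.
near=> s.
have st : `|s - t| <= 1 by rewrite distrC; near: s; apply: cvgr_dist_le => //.
have S s' : `|s' - t| <= 1 -> Sq (fun x => w (x + sg * s')).
  move=> h; apply: (@Sq_bounded _ (c - e) (d + e) M) => //; first exact: measurable_shift.
  by move=> x; exact: supp.
have tt : `|t - t| <= 1 by rewrite subrr normr0.
split.
- by apply: SqB; exact: S.
- move=> x; apply: le_trans (wl _ _) _; rewrite -mulrA ler_wpM2l//.
    by have := le_trans (normr_ge0 _) (wM 0).
  by rewrite (_ : _ - _ = sg * (s - t)) ?normrM//; ring.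
- by move=> x h; rewrite !supp// subrr.
Unshelve. all: by end_near. Qed.

Lemma pairing_integrable u w sg M t : L2 (It t) (u ^~ t) -> continuous w -> (forall x, `|w x| <= M) ->
  mu.-integrable (It t) (EFin \o (fun x => u x t * w (x + sg * t))).
Proof.
move=> Lu cw wM; apply/Int_restrE; first exact: measurable_It.
have Sw : Sq ((fun x => w (x + sg * t)) \_ (It t)).
  apply: (@Sq_continuous_restr _ _ M) => //.
  move=> x; apply: continuous_comp; last exact: cw.
  by apply: cvgD; [exact: cvg_id|exact: cvg_cst].
apply: Int_ext (ip_int Lu Sw) => x; rewrite !patchE; case: ifP => _ //.
by rewrite mulr0.
Qed.

(** The quotients of x1 converge to sg x2 with an error that is linear in s - t,
because x2 is Lipschitz. *)
Lemma pairing_derive_smooth phi phit sg (c d M t : R) (x0 x1 x2 : R -> R) :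
  contC1L2 L v phi phit -> 0 < t -> c <= d -> C2_bump c d x0 x1 x2 M ->
  v * t < c - sg * t -> d - sg * t < L + v * t ->
  (s - t)^-1 * (pair phi x1 sg s - pair phi x1 sg t) @[s --> t^'] -->
    pair phit x1 sg t + sg * pair phi x2 sg t.
Proof.
move=> C1 t0 cd T ct dt; have [c0 c1 c2] := C2_bump_continuous T.
case: T => d0 d1 bnd lp supp.
have m1 := derivable_measurable d1.
have lip1 x y : `|x1 y - x1 x| <= M * `|y - x|.
  by apply: lipschitz_derive_bound d1 _ _ _ => z; case: (bnd z).
have quad1 := taylor_lipschitz_derive d1 lp.
have Lphi : L2 (It t) (phi ^~ t) by case: C1 => -[h _] _ _; apply: h; exact: ltW.
apply: (@pairing_derive _ L v phi phit x1 sg c d M _ t C1) => //.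
- by move=> x; case: (bnd x).
- by move=> x /supp[].
- apply: cvg_within_filter; apply: (@lipschitz_shift_cvg0 x1 sg c d M) => //.
    by move=> x; case: (bnd x).
  by move=> x /supp[].
have M0 : 0 <= M by case: (bnd 0) => /(le_trans (normr_ge0 _)).
pose g s := (fun x => (s - t)^-1 * (x1 (x + sg * s) - x1 (x + sg * t))) \_ (It t).
pose g0 := (fun x => sg * x2 (x + sg * t)) \_ (It t).
have cshift w b : continuous w -> continuous (fun x => w (x + b) : R).
  move=> cw x; apply: continuous_comp; last exact: cw.
  by apply: cvgD; [exact: cvg_id|exact: cvg_cst].
have Sres w b : continuous w -> (forall x, `|w x| <= M) -> Sq ((fun x => w (x + b)) \_ (It t)).
  by move=> cw wM; apply: (@Sq_continuous_restr _ _ M) => //; exact: cshift.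
have Sg s : Sq (g s).
  have B1 x : `|x1 x| <= M by case: (bnd x).
  have := SqZ (s - t)^-1 (SqB (Sres x1 (sg * s) c1 B1) (Sres x1 (sg * t) c1 B1)).
  apply: Sq_ext => x; rewrite /g !patchE; case: ifP => _ //.
  by rewrite subrr mulr0.
have Sg0 : Sq g0.
  have B2 x : `|x2 x| <= M by case: (bnd x).
  have := SqZ sg (Sres x2 (sg * t) c2 B2).
  by apply: Sq_ext => x; rewrite /g0 !patchE; case: ifP => _ //; rewrite mulr0.
have E s : (s - t)^-1 * (\int[mu]_(x in It t) (phi x t * (x1 (x + sg * s) - x1 (x + sg * t)))) =
   ip ((phi ^~ t) \_ (It t)) (g s).
  have Hs : \int[mu]_(x in It t) (phi x t * (x1 (x + sg * s) - x1 (x + sg * t))) =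
    ip ((phi ^~ t) \_ (It t)) ((fun x => x1 (x + sg * s) - x1 (x + sg * t)) \_ (It t)).
    rewrite Rintegral_restr; apply: eq_Rintegral => x _; rewrite !patchE.
    by case: ifP => _ //; rewrite mulr0.
  have B1 x : `|x1 x| <= M by case: (bnd x).
  have Sd : Sq ((fun x => x1 (x + sg * s) - x1 (x + sg * t)) \_ (It t)).
    have := SqB (Sres x1 (sg * s) c1 B1) (Sres x1 (sg * t) c1 B1).
    by apply: Sq_ext => x; rewrite !patchE; case: ifP => _ //; rewrite subrr.
  rewrite Hs -ipZr//; rewrite ipC [RHS]ipC; apply: ip_extl => x; rewrite /g !patchE.
  by case: ifP => _ //; rewrite mulr0.
apply: (@cvg_eqfun _ _ _ (fun s => ip ((phi ^~ t) \_ (It t)) (g s))) => //.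
have -> : sg * pair phi x2 sg t = ip ((phi ^~ t) \_ (It t)) g0.
  rewrite (@pairing_ip _ L v phi x2 sg t (It t))// -ipZr//.
    rewrite ipC [RHS]ipC /ip; apply: eq_Rintegral => x _; rewrite /g0 !patchE.
    by case: ifP => _ //; rewrite !mulr0.
  apply: (@Sq_bounded _ (c - sg * t) (d - sg * t) M).
  - exact: continuous_measurable_fun (cshift _ _ c2).
  - by move=> x; case: (bnd (x + sg * t)).
  - move=> x; rewrite /= in_itv/= => h; have [|_ _ //] := supp (x + sg * t).
    by apply/negP => /andP[? ?]; apply: h; apply/andP; split; lra.
apply: ip_cvg => //.
- exact: nearW.
- exact: nearW.
- apply: (@cvg_eqfun _ _ _ (fun=> 0)); last exact: cvg_cst.
  move=> s; rewrite -[LHS](@ip0 R (fun=> 0)) /ip; apply: eq_Rintegral => x _.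
  by rewrite subrr.
pose h s x : R := if s == t then 0 else g s x - g0 x.
have C : ip (h s) (h s) @[s --> t] --> 0.
  apply: (@ip_cvg0 h (v * t) (L + v * t) (M * sg ^+ 2) t); first lra.
  near=> s; split.
  - by rewrite /h; case: (s == t); [exact: Sq0|exact: SqB].
  - move=> x; rewrite /h; case: eqVneq => [->|st]; first by rewrite subrr normr0 mulr0.
    rewrite /g /g0 !patchE; case: ifP => _; last first.
      by rewrite subrr normr0; apply: mulr_ge0 => //; apply: mulr_ge0 => //; exact: sqr_ge0.
    have st0 : s - t != 0 by rewrite subr_eq0.
    have := quad1 (x + sg * t) (x + sg * s).
    have -> : x + sg * s - (x + sg * t) = sg * (s - t) by ring.
    move=> Q; rewrite -(ler_pM2l (_ : 0 < `|s - t|)) ?normr_gt0// -normrM.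
    have -> : (s - t) * ((s - t)^-1 * (x1 (x + sg * s) - x1 (x + sg * t)) - sg * x2 (x + sg * t)) =
       x1 (x + sg * s) - x1 (x + sg * t) - x2 (x + sg * t) * (sg * (s - t)) by field.
    apply: le_trans Q _; rewrite exprMn -(real_normK (num_real (s - t))).
    by rewrite le_eqVlt; apply/orP; left; apply/eqP; ring.
  - move=> x xn; rewrite /h; case: (s == t) => //; rewrite /g /g0 !patchE memNset ?subrr//.
    by rewrite in_It => /andP[? ?]; apply: xn; rewrite /= in_itv/=; apply/andP; split; lra.
have C' : ip (h s) (h s) @[s --> t^'] --> 0 by apply: cvg_within_filter C.
apply: cvg_trans C'; apply: near_eq_cvg; near=> s.
have st : s != t by near: s; exact: nbhs_dnbhs_neq.
by rewrite /h (negbTE st).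
Unshelve. all: by end_near. Qed.

End SmoothTests.

(** * Transport along x + t = const *)

Section TestFunctions.
Context {R : realType}.
Variables (L v : R).
Hypothesis hL : 0 < L.
Hypothesis hv : 0 <= v < 1.
Local Notation mu := (@lebesgue_measure R).
Implicit Types (f g w : R -> R) (u : R -> R -> R).
Local Notation It := (It L v).
Local Notation pair := (pairing L v).

Lemma ramp_le (c d : R) n : c < d -> c + 8 * ramp c d n <= d.
Proof.
move=> cd; rewrite -lerBrDl /ramp mulrCA -[leRHS]mulr1 ler_pM2l ?subr_gt0//.
by rewrite ler_pdivrMr ?mul1r ?ler_nat ?leq_addl// ltr0n addnS.
Qed.

(** The image of a rectangle under a shear. *)
Lemma compact_shear (a b c d : R) :
  compact [set p : R * R | a <= p.1 + p.2 <= b /\ c <= p.2 <= d].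
Proof.
have -> : [set p : R * R | a <= p.1 + p.2 <= b /\ c <= p.2 <= d] =
  (fun p : R * R => (p.1 - p.2, p.2)) @` (`[a, b] `*` `[c, d]).
  apply/seteqP; split => [[x t] /= [h1 h2]|[x t] /= [[y s] /= [h1 h2] [<- <-]]].
    exists (x + t, t) => /=; last by rewrite addrK.
    by rewrite !in_itv.
  by rewrite subrK; rewrite !in_itv in h1 h2.
apply: continuous_compact; last first.
  by apply: compact_setX; exact: segment_compact.
apply: continuous_subspaceT => -[x t].
have H1 : p.1 - p.2 @[p --> (x, t)] --> x - t.
  by apply: cvgB; [exact: cvg_fst|exact: cvg_snd].
have H2 : p.2 @[p --> (x, t)] --> t by exact: cvg_snd.
exact: (cvg_pair H1 H2).
Qed.

Lemma is_derive_mul (f g : R -> R) (f' g' x : R) : is_derive x 1 f f' ->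
  is_derive x 1 g g' -> is_derive x 1 (fun y => f y * g y) (f' * g x + f x * g').
Proof.
move=> Hf Hg; apply: is_derive_eq; rewrite /GRing.scale/=; ring.
Qed.

Lemma is_derive_test_x (t0 t1 c d : R) (n k : nat) (x t : R) : is_derive x 1 (fun x => plateau t0 t1 n t * plateau c d k (x + t))
    (plateau t0 t1 n t * plateau1 c d k (x + t)).
Proof.
have H := @is_derive_shift R (plateau c d k) (plateau1 c d k) 1 t x (is_derive_plateau c d k _).
have H' : is_derive x 1 (fun y => plateau c d k (y + t)) (plateau1 c d k (x + t)).
  rewrite !mul1r in H.
  have -> : (fun y => plateau c d k (y + t)) = (fun y => plateau c d k (1 * y + t)) by apply/funext => y; rewrite mul1r.
  by [].
have := is_derive_mul (is_derive_cst (plateau t0 t1 n t) x 1) H'.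
by rewrite mul0r add0r.
Qed.

Lemma is_derive_test_t (t0 t1 c d : R) (n k : nat) (x t : R) : is_derive t 1 (fun t => plateau t0 t1 n t * plateau c d k (x + t))
    (plateau1 t0 t1 n t * plateau c d k (x + t) + plateau t0 t1 n t * plateau1 c d k (x + t)).
Proof.
have H := @is_derive_shift R (plateau c d k) (plateau1 c d k) 1 x t (is_derive_plateau c d k _).
have H' : is_derive t 1 (fun y => plateau c d k (x + y)) (plateau1 c d k (x + t)).
  rewrite !mul1r (addrC t x) in H.
  have -> : (fun y => plateau c d k (x + y)) = (fun y => plateau c d k (1 * y + x)) by apply/funext => y; rewrite mul1r addrC.
  by [].
exact: is_derive_mul (is_derive_plateau t0 t1 n t) H'.
Qed.

(** Apart from the cutoff in time, this test function is constant along x + t =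
const. The conditions on c and d keep the strip c < x + t < d inside the domain
for t0 < t < t1. *)
Lemma test_C1c2 (t0 t1 c d : R) (n k : nat) : 0 <= t0 -> t0 < t1 -> c < d ->
  (v + 1) * t1 <= c -> d <= L + (v + 1) * t0 ->
  C1c2 (Qdom L v) (fun x t => plateau t0 t1 n t * plateau c d k (x + t)).
Proof.
move=> t00 t01 cd ct dt.
have [M T] := plateau_C2_bump k cd; have [M' T'] := plateau_C2_bump n t01.
have [c0 c1 c2] := C2_bump_continuous T; have [e0 e1 e2] := C2_bump_continuous T'.
have dx := is_derive_test_x t0 t1 c d n k; have dt' := is_derive_test_t t0 t1 c d n k.
have cadd (x t : R) : p.1 + p.2 @[p --> (x, t)] --> x + t.
  by apply: cvgD; [exact: cvg_fst|exact: cvg_snd].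
have cs (f : R -> R) (x t : R) : continuous f -> f (p.1 + p.2) @[p --> (x, t)] --> f (x + t).
  by move=> cf; apply: (@cvg_comp _ _ _ (fun p : R * R => p.1 + p.2) f _ _ _ (cadd x t)); exact: cf.
have c2nd (f : R -> R) (x t : R) : continuous f -> f p.2 @[p --> (x, t)] --> f t.
  by move=> cf; apply: (@cvg_comp _ _ _ (@snd R R) f _ _ _ cvg_snd); exact: cf.
have E1 : (fun p : R * R => derive1 (fun x => plateau t0 t1 n p.2 * plateau c d k (x + p.2)) p.1) =
    (fun p => plateau t0 t1 n p.2 * plateau1 c d k (p.1 + p.2)).
  by apply/funext => -[x t] /=; rewrite derive1E; case: (dx x t).
have E2 : (fun p : R * R => derive1 (fun t => plateau t0 t1 n t * plateau c d k (p.1 + t)) p.2) =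
    (fun p => plateau1 t0 t1 n p.2 * plateau c d k (p.1 + p.2) + plateau t0 t1 n p.2 * plateau1 c d k (p.1 + p.2)).
  by apply/funext => -[x t] /=; rewrite derive1E; case: (dt' x t).
split.
- by move=> x t; split; [case: (dx x t)|case: (dt' x t)].
- by rewrite E1 => -[x t]; apply: cvgM; [exact: c2nd|exact: cs].
- rewrite E2 => -[x t]; apply: cvgD; apply: cvgM; try exact: c2nd; exact: cs.
- exists [set p | c + ramp c d k <= p.1 + p.2 <= d - ramp c d k /\
     t0 + ramp t0 t1 n <= p.2 <= t1 - ramp t0 t1 n]; split.
  + exact: compact_shear.
  + move=> [x t] /= [/andP[h1 h2] /andP[h3 h4]].
    have w1 := ramp_gt0 n t01; have w2 := ramp_gt0 k cd.
    rewrite /Qdom/= in_It; split; first lra.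
    have : (v + 1) * t <= (v + 1) * t1 by rewrite ler_wpM2l//; case/andP: hv; lra.
    have : (v + 1) * t0 <= (v + 1) * t by rewrite ler_wpM2l//; case/andP: hv; lra.
    by move=> ? ?; apply/andP; split; lra.
  + move=> x t /= h.
    have [h1|h1] := boolP (c + ramp c d k <= x + t <= d - ramp c d k); last first.
      by have [-> _ _] := plateau_out cd h1; rewrite mulr0.
    have [h2|h2] := boolP (t0 + ramp t0 t1 n <= t <= t1 - ramp t0 t1 n); last first.
      by have [-> _ _] := plateau_out t01 h2; rewrite mul0r.
    by exfalso; apply: h.
Qed.

End TestFunctions.

Section Transport.
Context {R : realType}.
Variables (L v : R).
Hypothesis hL : 0 < L.
Hypothesis hv : 0 <= v < 1.
Local Notation mu := (@lebesgue_measure R).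
Implicit Types (f g w : R -> R) (u : R -> R -> R).
Local Notation It := (It L v).
Local Notation pair := (pairing L v).

Lemma is_derive_quotient (f : R -> R) (t l : R) :
  (s - t)^-1 * (f s - f t) @[s --> t^'] --> l -> is_derive t 1 f l.
Proof.
move=> H.
have cv : h^-1 *: (f (h *: 1 + t) - f t) @[h --> 0^'] --> l.
  apply/cvgrPdist_le => e e0; move/cvgrPdist_le : H => /(_ e e0).
  rewrite !near_withinE; case=> d /= d0 Hd; exists d => //= h hd h0.
  have := Hd (h + t); rewrite /ball_/= opprD addrCA subrr addr0 normrN.
  rewrite /ball_/= sub0r normrN in hd; move=> /(_ hd).
  rewrite -subr_eq0 addrK => /(_ h0).
  by rewrite /GRing.scale/= mulr1.
apply: DeriveDef; last by apply/cvg_lim.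
by apply/cvg_ex; exists l.
Qed.

Lemma Rintegral_itv_cc_oo (f : R -> R) (a b : R) : measurable_fun `]a, b[ f ->
  \int[mu]_(x in `[a, b]) f x = \int[mu]_(x in `]a, b[) f x.
Proof.
move=> mf; rewrite /Rintegral (@integral_itv_bndoo _ a b _ true false)//.
exact/measurable_EFinP.
Qed.

Lemma within_itv_ge0 (f : R -> R) (t0 t1 : R) : 0 <= t0 ->
  (forall t : R, 0 <= t -> f s @[s --> within [set s | 0 <= s] (nbhs t)] --> f t) ->
  {within `[t0, t1], continuous f}.
Proof.
move=> t00 H.
have cS : {within [set s : R | 0 <= s], continuous f}.
  by apply/subspace_continuousP => x /= x0; exact: H.
apply: continuous_subspaceW cS => x /=; rewrite in_itv/= => /andP[? _].
exact: le_trans t00 _.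
Qed.

Lemma integrable_add (D : set R) f g : measurable D -> mu.-integrable D (EFin \o f) ->
  mu.-integrable D (EFin \o g) -> mu.-integrable D (EFin \o (fun x => f x + g x)).
Proof.
move=> mD /(Int_restrE _ mD) If /(Int_restrE _ mD) Ig; apply/(Int_restrE _ mD).
by apply: Int_ext (IntD If Ig) => x; rewrite !patchE; case: ifP => _ //; rewrite addr0.
Qed.

Lemma integrable_scale (D : set R) (k : R) f : measurable D -> mu.-integrable D (EFin \o f) ->
  mu.-integrable D (EFin \o (fun x => k * f x)).
Proof.
move=> mD /(Int_restrE _ mD) If; apply/(Int_restrE _ mD).
by apply: Int_ext (IntZ k If) => x; rewrite !patchE; case: ifP => _ //; rewrite mulr0.
Qed.

Lemma withinM (f g : R -> R) (A : set R) : {within A, continuous f} ->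
  {within A, continuous g} -> {within A, continuous (fun x => f x * g x)}.
Proof. by move=> cf cg x; apply: cvgM; [exact: cf|exact: cg]. Qed.

Lemma withinD (f g : R -> R) (A : set R) : {within A, continuous f} ->
  {within A, continuous g} -> {within A, continuous (fun x => f x + g x)}.
Proof. by move=> cf cg x; apply: cvgD; [exact: cf|exact: cg]. Qed.

Lemma withinB (f g : R -> R) (A : set R) : {within A, continuous f} ->
  {within A, continuous g} -> {within A, continuous (fun x => f x - g x)}.
Proof. by move=> cf cg x; apply: cvgB; [exact: cf|exact: cg]. Qed.

Lemma FTC_inside (F f : R -> R) (a b : R) : a < b ->
  {within `[a, b], continuous F} -> {within `[a, b], continuous f} ->
  (forall t : R, a < t < b -> is_derive t 1 F (f t)) ->
  \int[mu]_(x in `]a, b[) f x = F b - F a.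
Proof.
move=> ab cF cf dF; rewrite -Rintegral_itv_cc_oo; last first.
  apply: measurable_funS (subspace_continuous_measurable_fun _ cf) => //.
  exact: subset_itv_oo_cc.
have [_ ca cb] : [/\ {in `]a, b[, continuous F}, F x @[x --> a^'+] --> F a &
    F x @[x --> b^'-] --> F b] by apply/(continuous_within_itvP _ ab).
rewrite /Rintegral (@continuous_FTC2 _ f F)//.
- split => //; move=> x; rewrite in_itv/= => xab; by case: (dF x xab).
- by move=> x; rewrite in_itv/= => xab; rewrite derive1E; case: (dF x xab).
Qed.

Variables (phi phix phit : R -> R -> R).
Hypothesis hH1 : contH1 L v phi phix.
Hypothesis hC1 : contC1L2 L v phi phit.
Hypothesis hW : weak_wave L v phix phit.

(** Integration by parts in space, which is the definition of the weak derivative phix. *)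
Lemma pairing_phix (w w1 : R -> R) (t c d M : R) : 0 <= t ->
  (forall x : R, is_derive x 1 w (w1 x)) -> continuous w1 ->
  (forall x, ~~ (c <= x <= d) -> w x = 0) ->
  v * t < c - t -> d - t < L + v * t ->
  pair phix w 1 t = - pair phi w1 1 t.
Proof.
move=> t0 dw cw1 w0 ct dt.
have [[_ _ H] _ _] : H1_right0 (v * t) (L + v * t) (phi ^~ t) (phix ^~ t) by case: hH1 => /(_ t t0).
have Ht : forall x : R, is_derive x 1 (fun x => w (x + t)) (w1 (x + t)).
  move=> x; have := @is_derive_shift R w w1 1 t x (dw _); rewrite !mul1r.
  by under [X in is_derive _ _ X]eq_fun do rewrite mul1r.
have := H (fun x => w (x + t)); rewrite (derive1_eq Ht) /pair => H'.
have {}H' : C1c (v * t) (L + v * t) (fun x => w (x + t)).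
  split.
  - by move=> x; case: (Ht x).
  - rewrite (derive1_eq Ht) => x; apply: continuous_comp; last exact: cw1.
    by apply: cvgD; [exact: cvg_id|exact: cvg_cst].
  - exists `[c - t, d - t]%classic; split; first exact: segment_compact.
    + by move=> x /=; rewrite !in_itv/= => /andP[? ?]; apply/andP; split; lra.
    + move=> x /= xn; apply: w0; apply/negP => /andP[? ?]; apply: xn.
      by rewrite in_itv/=; apply/andP; split; lra.
have := H _ H'; rewrite (derive1_eq Ht) => E.
rewrite -[LHS]opprK; congr (- _).
transitivity (- \int[mu]_(x in `]v * t, L + v * t[) (phix x t * w (x + t))).
  by congr (- _); apply: eq_Rintegral => x _; rewrite mul1r.
by rewrite -E; apply: eq_Rintegral => x _; rewrite mul1r.
Qed.

(** Let chi be the plateau in x + t and theta one in t, and write A and N for the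
pairings of phit with chi and of phi with chi'. Integrating by parts in x, the
claim is that A - N takes the same value at t0 and t1. The wave equation tested
with theta(t) chi(x + t) says that theta' A + theta N' has integral 0, and the
product rule says that theta' N + theta N' has integral 0. So theta' (A - N) has
integral 0, and theta' concentrates at t0 and t1. *)
Lemma transport_plateau (t0 t1 c d : R) (k : nat) : 0 <= t0 -> t0 < t1 -> c < d ->
  (v + 1) * t1 <= c -> d <= L + (v + 1) * t0 ->
  pair phit (plateau c d k) 1 t0 + pair phix (plateau c d k) 1 t0 =
  pair phit (plateau c d k) 1 t1 + pair phix (plateau c d k) 1 t1.
Proof.
move=> t00 t01 cd ct dt.
have [M T] := plateau_C2_bump k cd; have w0 := ramp_gt0 k cd.
have T' := T; case: T' => d0 d1 bnd lp supp.
have [c0 c1 c2] := C2_bump_continuous T.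
pose x0 := plateau c d k; pose x1 := plateau1 c d k; pose x2 := plateau2 c d k.
have inside t : t0 <= t <= t1 -> v * t < c + ramp c d k - t /\ d - ramp c d k - t < L + v * t.
  move=> /andP[h0 h1]; case/andP: hv => v0 v1.
  have : (v + 1) * t <= (v + 1) * t1 by rewrite ler_wpM2l//; lra.
  have : (v + 1) * t0 <= (v + 1) * t by rewrite ler_wpM2l//; lra.
  by move=> ? ?; split; lra.
have B0 x : `|x0 x| <= M by case: (bnd x).
have B1 x : `|x1 x| <= M by case: (bnd x).
have B2 x : `|x2 x| <= M by case: (bnd x).
have L0 x y : `|x0 y - x0 x| <= M * `|y - x| by exact: lipschitz_derive_bound d0 B1 _ _.
have L1 x y : `|x1 y - x1 x| <= M * `|y - x| by exact: lipschitz_derive_bound d1 B2 _ _.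
have [cphi cphit _] := hC1; have [_ _ cphix] := hH1.
(* B is the time derivative of N *)
pose A := pair phit x0 1; pose N := pair phi x1 1.
pose B t := pair phit x1 1 t + pair phi x2 1 t.
have cA : {within `[t0, t1], continuous A}.
  by apply: within_itv_ge0 => // t tt0; exact: (pairing_continuous hL cphit B0 L0 tt0).
have cN : {within `[t0, t1], continuous N}.
  by apply: within_itv_ge0 => // t tt0; exact: (pairing_continuous hL cphi B1 L1 tt0).
have cB : {within `[t0, t1], continuous B}.
  apply: withinD; apply: within_itv_ge0 => // t tt0.
    exact: (pairing_continuous hL cphit B1 L1 tt0).
  exact: (pairing_continuous hL cphi B2 lp tt0).
have X0 t : t0 <= t <= t1 -> pair phix x0 1 t = - N t.
  move=> tt; have [i1 i2] := inside t tt.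
  apply: (@pairing_phix x0 x1 t (c + ramp c d k) (d - ramp c d k) M) => //.
    by case/andP: tt => h _; exact: le_trans t00 h.
  by move=> x /supp[].
have X1 t : t0 <= t <= t1 -> pair phix x1 1 t = - pair phi x2 1 t.
  move=> tt; have [i1 i2] := inside t tt.
  apply: (@pairing_phix x1 x2 t (c + ramp c d k) (d - ramp c d k) M) => //.
    by case/andP: tt => h _; exact: le_trans t00 h.
  by move=> x /supp[].
pose th := plateau t0 t1; pose th1 := plateau1 t0 t1.
have dN (t : R) : t0 < t < t1 -> is_derive t 1 N (B t).
  move=> tt; have tt' : t0 <= t <= t1 by case/andP: tt => h1 h2; rewrite !ltW.
  have [i1 i2] := inside t tt'.
  have tpos : 0 < t by case/andP: tt => h _; exact: le_lt_trans t00 h.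
  apply: is_derive_quotient; rewrite /B -[X in _ + X]mul1r.
  apply: (@pairing_derive_smooth R L v phi phit 1 (c + ramp c d k) (d - ramp c d k) M t x0 x1 x2) => //.
  - by have := ramp_le k cd; lra.
  - by rewrite mul1r.
  - by rewrite mul1r.
have cth n : {within `[t0, t1], continuous (th n)}.
  by have [M' /C2_bump_continuous[e0 _ _]] := plateau_C2_bump n t01; exact: continuous_subspaceT.
have cth1 n : {within `[t0, t1], continuous (th1 n)}.
  by have [M' /C2_bump_continuous[_ e1 _]] := plateau_C2_bump n t01; exact: continuous_subspaceT.
have w0' n := ramp_gt0 n t01.
(* the product rule for theta N *)
have F3 n : \int[mu]_(t in `]t0, t1[) (th1 n t * N t + th n t * B t) = 0.
  have c1' : {within `[t0, t1], continuous (fun t => th n t * N t)} by exact: withinM.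
  have c2' : {within `[t0, t1], continuous (fun t => th1 n t * N t + th n t * B t)}.
    by apply: withinD; exact: withinM.
  have dd (t : R) : t0 < t < t1 -> is_derive t 1 (fun t => th n t * N t) (th1 n t * N t + th n t * B t).
    by move=> tt; apply: is_derive_mul; [exact: is_derive_plateau|exact: dN].
  rewrite (FTC_inside t01 c1' c2' dd) /th.
  have [|-> _ _] := @plateau_out R t0 t1 n t0 t01.
    by apply/negP => /andP[]; have := w0' n; lra.
  have [|-> _ _] := @plateau_out R t0 t1 n t1 t01.
    by apply/negP => /andP[]; have := w0' n; lra.
  by rewrite !mul0r subrr.
(* the wave equation tested with theta(t) chi(x + t) *)
have F2 n : \int[mu]_(t in `]t0, t1[) (th1 n t * A t + th n t * B t) = 0.
  rewrite -(hW (test_C1c2 hv n k t00 t01 cd ct dt)) Rintegral_restr [RHS]Rintegral_restr.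
  apply: eq_Rintegral => t _; rewrite !patchE.
  have dx (x : R) : derive1 (fun x => plateau t0 t1 n t * plateau c d k (x + t)) x = th n t * x1 (x + t).
    by rewrite derive1E; case: (is_derive_test_x t0 t1 c d n k x t).
  have dt' (x : R) : derive1 (fun t => plateau t0 t1 n t * plateau c d k (x + t)) t =
    th1 n t * x0 (x + t) + th n t * x1 (x + t).
    by rewrite derive1E; case: (is_derive_test_t t0 t1 c d n k x t).
  have [tin|/negP tout] := boolP (t \in `]t0, t1[%classic); last first.
    case: ifP => // tpos.
    have [|z0 z1 _] := @plateau_out R t0 t1 n t t01.
      apply/negP => /andP[h1 h2]; apply: tout; rewrite inE/= in_itv/=.
      by have w := w0' n; apply/andP; split; lra.
    transitivity (\int[mu]_(x in It t) (0 : R)).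
      by rewrite Rintegral_cst ?mul0r//; exact: measurable_It.
    by apply: eq_Rintegral => x _; rewrite dx dt' /th /th1 z0 z1 !mul0r addr0 !mulr0 subrr.
  have tt : t0 < t < t1 by rewrite inE/= in_itv/= in tin.
  have tt' : t0 <= t <= t1 by case/andP: tt => h1 h2; rewrite !ltW.
  have tpos : 0 < t by case/andP: tt => h _; exact: le_lt_trans t00 h.
  rewrite mem_set/=; last by rewrite in_itv/= andbT.
  have t0' := ltW tpos.
  have I0 : mu.-integrable (It t) (EFin \o (fun x => phit x t * x0 (x + 1 * t))).
    by apply: (@pairing_integrable R L v phit x0 1 M) => //; case: cphit => h _; exact: h.
  have I1 : mu.-integrable (It t) (EFin \o (fun x => phit x t * x1 (x + 1 * t))).
    by apply: (@pairing_integrable R L v phit x1 1 M) => //; case: cphit => h _; exact: h.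
  have I2 : mu.-integrable (It t) (EFin \o (fun x => phix x t * x1 (x + 1 * t))).
    by apply: (@pairing_integrable R L v phix x1 1 M) => //; case: cphix => h _; exact: h.
  have mI := measurable_It L v t.
  transitivity (\int[mu]_(x in It t) (th1 n t * (phit x t * x0 (x + 1 * t)) +
     th n t * (phit x t * x1 (x + 1 * t)) - th n t * (phix x t * x1 (x + 1 * t)))).
    have J0 := integrable_scale (th1 n t) mI I0; have J1 := integrable_scale (th n t) mI I1.
    have J2 := integrable_scale (th n t) mI I2.
    have J01 := integrable_add mI J0 J1.
    rewrite RintegralB; [|exact: mI|exact: J01|exact: J2].
    rewrite RintegralD; [|exact: mI|exact: J0|exact: J1].
    rewrite !RintegralZl// -/(pair phit x0 1 t) -/(pair phit x1 1 t) -/(pair phix x1 1 t).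
    by rewrite X1// /A /B; ring.
  apply: eq_Rintegral => x _; rewrite dx dt' mul1r; ring.
have F n : \int[mu]_(t in `]t0, t1[) ((A t - N t) * plateau1 t0 t1 n t) = 0.
  have IA : mu.-integrable `]t0, t1[ (EFin \o (fun t => th1 n t * A t + th n t * B t)).
    by apply: continuous_integrable_oo; apply: withinD; exact: withinM.
  have IN : mu.-integrable `]t0, t1[ (EFin \o (fun t => th1 n t * N t + th n t * B t)).
    by apply: continuous_integrable_oo; apply: withinD; exact: withinM.
  transitivity (\int[mu]_(t in `]t0, t1[) (th1 n t * A t + th n t * B t - (th1 n t * N t + th n t * B t))).
    by apply: eq_Rintegral => t _; rewrite /th1; ring.
  by rewrite RintegralB// F2 F3 subrr.
have C := plateau1_concentrates t01 (withinB cA cN).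
have E0 : A t0 - N t0 - (A t1 - N t1) = 0.
  apply: (cvg_unique (@Rhausdorff R) C).
  by apply: (@cvg_eqfun _ _ _ (fun=> 0)) => //; exact: cvg_cst.
have h0 : t0 <= t0 <= t1 by rewrite lexx ltW.
have h1 : t0 <= t1 <= t1 by rewrite lexx ltW.
rewrite -/x0 X0// X0// -/(A t0) -/(A t1); lra.
Qed.

(** The limit of [transport_plateau] as the plateaus converge to the indicator of ]c, d[. *)
Lemma transport (t0 t1 c d : R) : 0 <= t0 -> t0 < t1 -> c < d ->
  (v + 1) * t1 <= c -> d <= L + (v + 1) * t0 ->
  \int[mu]_(x in `]c - t0, d - t0[) (phit x t0 + phix x t0) =
  \int[mu]_(x in `]c - t1, d - t1[) (phit x t1 + phix x t1).
Proof.
move=> t00 t01 cd ct dt.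
have [cphi cphit _] := hC1; have [_ _ cphix] := hH1.
have t10 : 0 <= t1 by exact: le_trans t00 (ltW t01).
have H t : 0 <= t -> (v + 1) * t <= c -> d <= L + (v + 1) * t ->
   pair phit (plateau c d k) 1 t + pair phix (plateau c d k) 1 t @[k --> \oo] -->
   \int[mu]_(x in `]c - t, d - t[) (phit x t + phix x t).
  move=> tt0 tc td.
  have Lphit : L2 (It t) (phit ^~ t) by case: cphit => h _; exact: h.
  have Lphix : L2 (It t) (phix ^~ t) by case: cphix => h _; exact: h.
  pose r := (fun x => (phit x t + phix x t)) \_ (It t).
  have Sr : Sq r.
    have := SqD Lphit Lphix; apply: Sq_ext => x; rewrite /r !patchE; case: ifP => _ //.
    by rewrite addr0.
  have Sr' : Sq (fun z => r (1 * z + (- t))) by exact: Sq_affine.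
  have Ir : Int (fun z => r (1 * z + (- t))).
    apply: (@Sq_Int _ (v * t + t) (L + v * t + t)) => // z zn.
    rewrite /r patchE memNset// mul1r in_It => /andP[? ?]; apply: zn.
    by rewrite /= in_itv/=; apply/andP; split; lra.
  have C := integral_plateau_cvg cd Ir.
  have -> : \int[mu]_(x in `]c - t, d - t[) (phit x t + phix x t) =
      \int[mu]_(x in `]c, d[) r (1 * x - t).
    rewrite Rintegral_restr [RHS]Rintegral_restr (@integral_affine _ 1 (- t)) ?normr1 ?mul1r//; last first.
      apply/Int_restrE => //.
      have : Int (r \_ `]c - t, d - t[).
        apply: Int_restr => //; apply: (@Sq_Int _ (v * t) (L + v * t)) => // z zn.
        rewrite /r patchE memNset// in_It => /andP[? ?]; apply: zn.
        by rewrite /= in_itv/=; apply/andP; split; lra.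
      move/Int_restrE => /(_ (measurable_itv _)); apply: eq_integrable => // x.
      rewrite inE/= in_itv/= => /andP[? ?]; rewrite /r patchE mem_set// in_It.
      by apply/andP; split; lra.
    apply: eq_Rintegral => x _; rewrite !patchE.
    have -> : (1 * x - t \in `]c - t, d - t[%classic) = (x \in `]c, d[%classic).
      by apply/idP/idP; rewrite !inE/= !in_itv/= => /andP[? ?]; apply/andP; split; lra.
    case: ifPn => //; rewrite inE/= in_itv/= => /andP[? ?].
    rewrite /r patchE mem_set// in_It; apply/andP; split; lra.
  apply: cvg_trans C; apply: near_eq_cvg; apply: nearW => k.
  have Sw : Sq (fun x => plateau c d k (x + 1 * t)).
    apply: (@Sq_bounded _ (c - t) (d - t) 432).
    - exact: measurable_shift (plateau_measurable c d k).
    - by move=> x; exact: plateau_bound.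
    - move=> x; rewrite /= in_itv/= => h; have w0 := ramp_gt0 k cd.
      have [|-> //] := @plateau_out R c d k (x + 1 * t) cd.
      by apply/negP => /andP[? ?]; apply: h; apply/andP; split; lra.
  rewrite (@pairing_ip _ L v phit _ 1 t (It t))// (@pairing_ip _ L v phix _ 1 t (It t))//.
  rewrite -ipDl//.
  have -> : ip (fun x => ((phit ^~ t) \_ (It t)) x + ((phix ^~ t) \_ (It t)) x)
      (fun x => plateau c d k (x + 1 * t)) = ip r (fun x => plateau c d k (x + 1 * t)).
    apply: ip_extl => x; rewrite /r !patchE; case: ifP => _ //.
    by rewrite addr0.
  rewrite (ip_affine (- t) (oner_neq0 _) Sr Sw) normr1 mul1r.
  by apply: eq_Rintegral => x _; rewrite !mul1r subrK.
have d0 : d <= L + (v + 1) * t0 by [].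
have v1 : 0 <= v + 1 by case/andP: hv; lra.
have vt : (v + 1) * t0 <= (v + 1) * t1 by rewrite ler_wpM2l// ltW.
have C0 := H t0 t00 (le_trans vt ct) dt.
have C1 : pair phit (plateau c d k) 1 t1 + pair phix (plateau c d k) 1 t1 @[k --> \oo] -->
   \int[mu]_(x in `]c - t1, d - t1[) (phit x t1 + phix x t1) by apply: H => //; lra.
apply: (cvg_unique (@Rhausdorff R) C0).
apply: (@cvg_eqfun _ _ _ (fun k => pair phit (plateau c d k) 1 t1 + pair phix (plateau c d k) 1 t1)) => //.
by move=> k; apply/esym; exact: transport_plateau.
Qed.

End Transport.

(** * The profile of the right derivative *)

Section Profile.
Context {R : realType}.
Variables (L v : R).
Hypothesis hL : 0 < L.
Hypothesis hv : 0 <= v < 1.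
Local Notation mu := (@lebesgue_measure R).
Implicit Types (f g w : R -> R) (u : R -> R -> R).
Local Notation It := (It L v).
Variables (phi phix phit : R -> R -> R).
Hypothesis hH1 : contH1 L v phi phix.
Hypothesis hC1 : contC1L2 L v phi phit.
Hypothesis hW : weak_wave L v phix phit.

Definition rightder t x := phit x t + phix x t.
Definition slice_itv t : set R := `](v + 1) * t, L + (v + 1) * t[.
(** The right derivative at time t as a function of the characteristic variable
z = x + t. *)
Definition slice t (z : R) : R := (rightder t \_ (It t)) (1 * z + (- t)).

Lemma speed_gt0 : 0 < v + 1. Proof. by case/andP: hv => ? _; lra. Qed.

Lemma in_slice_itv t z : slice_itv t z = ((v + 1) * t < z < L + (v + 1) * t).
Proof. by rewrite /slice_itv/= in_itv. Qed.

Lemma Sq_rightder t : 0 <= t -> Sq (rightder t \_ (It t)).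
Proof.
move=> t0; have [_ [Lphit _] _] := hC1; have [_ _ [Lphix _]] := hH1.
have := SqD (Lphit t t0) (Lphix t t0); apply: Sq_ext => x; rewrite !patchE.
by case: ifP => _ //; rewrite addr0.
Qed.

Lemma Sq_slice t : 0 <= t -> Sq (slice t).
Proof. by move=> t0; apply: Sq_affine => //; exact: Sq_rightder. Qed.

Lemma sliceE t z : slice_itv t z -> slice t z = rightder t (z - t).
Proof.
rewrite in_slice_itv => /andP[h1 h2]; rewrite /slice patchE mul1r mem_set// in_It.
by apply/andP; split; lra.
Qed.

Lemma slice_out t z : ~ slice_itv t z -> slice t z = 0.
Proof.
move=> h; rewrite /slice patchE mul1r memNset// in_It => /andP[h1 h2]; apply: h.
by rewrite in_slice_itv; apply/andP; split; lra.
Qed.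

Lemma Int_slice t : 0 <= t -> Int (slice t).
Proof.
move=> t0; apply: (@Sq_Int _ ((v + 1) * t) (L + (v + 1) * t)); first exact: Sq_slice.
by move=> z zn; apply: slice_out => h; apply: zn; exact: subset_itv_oo_cc h.
Qed.

Lemma Rintegral_shift f (b c d : R) : Int (f \_ `]c + b, d + b[) ->
  \int[mu]_(x in `]c + b, d + b[) f x = \int[mu]_(z in `]c, d[) f (z + b).
Proof.
move=> If; rewrite Rintegral_restr [RHS]Rintegral_restr (@integral_affine _ 1 b)// ?normr1 ?mul1r//.
apply: eq_Rintegral => x _; rewrite !patchE mul1r.
have -> : (x + b \in `]c + b, d + b[%classic) = (x \in `]c, d[%classic); last by [].
by apply/idP/idP; rewrite !inE/= !in_itv/= !ltrD2r.
Qed.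

Lemma slice_integral t c d : 0 <= t -> (v + 1) * t <= c -> d <= L + (v + 1) * t ->
  \int[mu]_(z in `]c, d[) slice t z = \int[mu]_(x in `]c - t, d - t[) (phit x t + phix x t).
Proof.
move=> t0 h1 h2; rewrite Rintegral_shift; last first.
  by apply: Int_restrS (L2_integrable (Sq_rightder t0)) => //; apply: subset_itvW; lra.
rewrite Rintegral_restr [RHS]Rintegral_restr; apply: eq_Rintegral => x _; rewrite !patchE.
case: ifPn => //; rewrite inE/= in_itv/= => /andP[? ?].
by rewrite sliceE// in_slice_itv; apply/andP; split; lra.
Qed.

(** By [transport], both slices have the same integral over every interval in the overlap. *)
Lemma slice_ae t0 t1 : 0 <= t0 -> 0 <= t1 ->
  {ae mu, forall z, slice_itv t0 z -> slice_itv t1 z -> slice t0 z = slice t1 z}.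
Proof.
wlog t01 : t0 t1 / t0 < t1.
  move=> H h0 h1; have [h|h|->] := ltgtP t0 t1; first exact: H.
  - by apply: ae_imp (H _ _ h h1 h0) => z E z0 z1; rewrite E.
  - by apply: aeW.
move=> t00 t10.
have := @ae_eq0_integral R (fun z => slice t0 z - slice t1 z) ((v + 1) * t1) (L + (v + 1) * t0)
  (IntB (Int_slice t00) (Int_slice t10)).
have vt : (v + 1) * t0 <= (v + 1) * t1 by rewrite ler_wpM2l// ltW// speed_gt0.
move=> H; have {}H := H _.
have {}H : {ae mu, forall x, (v + 1) * t1 < x < L + (v + 1) * t0 -> slice t0 x - slice t1 x = 0}.
  apply: H => a b ha ab hb.
  rewrite RintegralB//; try (apply: Int_subset => //; exact: Int_slice).
  rewrite !slice_integral//; [|lra..].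
  by apply/eqP; rewrite subr_eq0; apply/eqP; apply: (transport hL hv hH1 hC1 hW) => //; lra.
apply: ae_imp H => z H; rewrite !in_slice_itv => /andP[h1 h2] /andP[h3 h4].
by apply/eqP; rewrite -subr_eq0 H// h3 h2.
Qed.

(** The slices agree almost everywhere where they overlap, with an exceptional set
that depends on the two times; gluing therefore uses countably many times only.
The slice at [sample_time k] covers the k-th cell of length L / 2, and there the
profile is defined to be this slice. *)
Definition sample_time (k : nat) : R := if k == 0%N then 0 else (k%:R - 2^-1) * (L / 2) / (v + 1).
Definition profile (z : R) : R := if 0 < z then slice (sample_time (Num.truncn (z / (L / 2)))) z else 0.

Lemma sample_time_ge0 k : 0 <= sample_time k.
Proof.
rewrite /sample_time; case: k => [//|k] /=; rewrite !mulr_ge0 ?invr_ge0 ?(ltW hL) ?(ltW speed_gt0)//.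
by rewrite -natr1; have := ler0n R k; lra.
Qed.

Lemma sample_timeE k : (v + 1) * sample_time k = if k == 0%N then 0 else (k%:R - 2^-1) * (L / 2).
Proof.
rewrite /sample_time; case: ifP => _; first by rewrite mulr0.
by field; rewrite gt_eqF// speed_gt0.
Qed.

Lemma cell_slice_itv k (z : R) : 0 < z -> k%:R * (L / 2) <= z < (k%:R + 1) * (L / 2) -> slice_itv (sample_time k) z.
Proof.
move=> z0 /andP[h1 h2]; rewrite in_slice_itv sample_timeE; case: k h1 h2 => [|k] /= h1 h2.
  by apply/andP; split; lra.
by apply/andP; split; have := hL; nra.
Qed.

Lemma truncn_cell (z : R) : 0 < z ->
  (Num.truncn (z / (L / 2)))%:R * (L / 2) <= z < ((Num.truncn (z / (L / 2)))%:R + 1) * (L / 2).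
Proof.
move=> z0; have l0 : 0 < L / 2 by rewrite divr_gt0.
have := truncn_itv (ltW (divr_gt0 z0 l0)) => /andP[h1 h2].
by rewrite -ler_pdivlMr// h1/= -ltr_pdivrMr// natr1.
Qed.

Lemma cell_truncn k (z : R) : 0 < z -> k%:R * (L / 2) <= z < (k%:R + 1) * (L / 2) ->
  Num.truncn (z / (L / 2)) = k.
Proof.
move=> z0 /andP[h1 h2]; have l0 : 0 < L / 2 by rewrite divr_gt0.
by apply: truncn_def; rewrite ler_pdivlMr// h1/= ltr_pdivrMr// -natr1.
Qed.

Lemma slice_profile_ae t : 0 <= t -> {ae mu, forall z, slice_itv t z -> slice t z = profile z}.
Proof.
move=> t0.
have H : {ae mu, forall z, forall k, slice_itv t z -> slice_itv (sample_time k) z -> slice t z = slice (sample_time k) z}.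
  by apply: ae_foralln => k; apply: slice_ae => //; exact: sample_time_ge0.
apply: ae_imp H => z H Jz.
have z0 : 0 < z.
  move: Jz; rewrite in_slice_itv => /andP[h _]; apply: le_lt_trans h.
  by rewrite mulr_ge0// ltW// speed_gt0.
rewrite /profile z0; apply: H => //; apply: cell_slice_itv => //; exact: truncn_cell.
Qed.

Lemma in_itvE (i : interval R) (z : R) : (z \in [set` i]) = (z \in i).
Proof. by apply/idP/idP => [/set_mem|h]; last exact: mem_set. Qed.

Lemma Sq_profile_cells n : Sq (profile \_ `]0, n%:R * (L / 2)[).
Proof.
elim: n => [|n IH].
  apply: Sq_ext Sq0 => x; rewrite patchE memNset//= in_itv/= mul0r => /andP[]; lra.
have := SqD IH (Sq_restr (measurable_itv `[n%:R * (L / 2), n.+1%:R * (L / 2)[)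
   (Sq_restr (measurable_itv `]0, +oo[) (Sq_slice (sample_time_ge0 n)))).
apply: Sq_ext => z; rewrite !patchE.
have n0 := ler0n R n.
have nL : 0 <= n%:R * (L / 2) by rewrite mulr_ge0// divr_ge0// ltW.
have nn : n.+1%:R * (L / 2) = n%:R * (L / 2) + L / 2 by rewrite -natr1; ring.
rewrite !in_itvE !in_itv/= andbT.
have [z0|z0] := ltP 0 z => /=; last by case: ifP => _ /=; rewrite addr0.
have [z1|z1] := ltP z (n%:R * (L / 2)) => /=.
  by rewrite (lt_trans z1) ?addr0// nn ltrDl divr_gt0.
case: ifP => z2; rewrite add0r//.
by rewrite /profile z0 (@cell_truncn n)// z1 natr1.
Qed.

Lemma Sq_profile M : Sq (profile \_ `]0, M[).
Proof.
have l0 : 0 < L / 2 by rewrite divr_gt0.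
pose n := (Num.truncn (`|M| / (L / 2))).+1.
have Mn : M <= n%:R * (L / 2).
  rewrite -ler_pdivrMr//; apply: le_trans (ltW (truncnS_gt _)).
  by rewrite ler_pM2r ?invr_gt0// ler_norm.
rewrite -(@restr_sub _ `]0, n%:R * (L / 2)[%classic); first exact: Sq_restr (Sq_profile_cells n).
by move=> x /=; rewrite !in_itv/= => /andP[-> h]; exact: lt_le_trans h Mn.
Qed.

Lemma Int_profile M : Int (profile \_ `]0, M[).
Proof. exact: L2_integrable (Sq_profile M). Qed.

Lemma rightder_ae t : 0 <= t -> {ae mu, forall x, It t x -> rightder t x = profile (x + t)}.
Proof.
move=> t0; apply: ae_imp (ae_affine t (oner_neq0 _) (slice_profile_ae t0)) => x; rewrite mul1r => H Ix.
have J : slice_itv t (x + t).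
  by move: Ix; rewrite in_It in_slice_itv => /andP[? ?]; apply/andP; split; lra.
by rewrite -H// sliceE// addrK.
Qed.

End Profile.

(** * Potentials of locally integrable functions *)

Section Potential.
Context {R : realType}.
Local Notation mu := (@lebesgue_measure R).
Implicit Types (f g P : R -> R).

Definition potential P (s : R) : R := \int[mu]_(x in `]0, s[) P x.

Definition loc_Int P := forall M, Int (P \_ `]0, M[).

Lemma potential_primitive P M s : loc_Int P -> s < M -> potential P s = primitive (P \_ `]0, M[) s.
Proof.
move=> HP sM; rewrite /potential /primitive Rintegral_restr.
have I := HP M.
rewrite -Rintegral_itv_bndo_bndc; last exact: Int_subset.
rewrite [RHS]Rintegral_restr; apply: eq_Rintegral => x _; rewrite !patchE !in_itvE !in_itv/=.
have [xs|xs] := ltP x s; last by rewrite andbF.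
by rewrite andbT (lt_trans xs sM) andbT.
Qed.

Lemma potential_continuous P : loc_Int P -> continuous (potential P).
Proof.
move=> HP x; have C := @primitive_continuous R (P \_ `]0, x + 1[) (HP (x + 1)) x.
apply: (@cvg_trans _ (primitive (P \_ `]0, x + 1[) s @[s --> x])); last first.
  by rewrite (@potential_primitive P (x + 1)) ?ltrDl.
apply: near_eq_cvg; near=> s; rewrite (@potential_primitive P (x + 1))//.
by near: s; apply: lt_nbhsl; rewrite ltrDl.
Unshelve. all: by end_near. Qed.

Lemma potentialB P a b : loc_Int P -> 0 <= a -> a <= b ->
  potential P b - potential P a = \int[mu]_(x in `]a, b[) P x.
Proof.
move=> HP a0 ab.
rewrite !(@potential_primitive P (b + 1))//; [|lra..].
rewrite primitiveB//; rewrite Rintegral_restr [RHS]Rintegral_restr; apply: eq_Rintegral => x _.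
rewrite !patchE !in_itvE !in_itv/=; case: ifP => // /andP[h1 h2].
by rewrite ifT//; apply/andP; split; lra.
Qed.

Lemma loc_IntS P a b : loc_Int P -> 0 <= a -> Int (P \_ `]a, b[).
Proof. by move=> /(_ b) IP a0; apply: Int_restrS IP => //; exact: subset_itvW. Qed.

Lemma loc_Int_integrable P a b : loc_Int P -> 0 <= a -> mu.-integrable `]a, b[ (EFin \o P).
Proof. by move=> lP a0; apply/Int_restrE => //; exact: loc_IntS. Qed.

Lemma loc_Int_shift P b : loc_Int P -> 0 <= b -> loc_Int (fun z => P (z + b)).
Proof.
move=> lP b0 M.
have := Int_restr (measurable_itv `]0, M[) (Int_affine b (oner_neq0 _) (lP (M + b))).
apply: Int_ext => x; rewrite !patchE mul1r !in_itvE !in_itv/= ltrD2r.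
by case: ifP => // /andP[x0 ->]; rewrite andbT ltr_wpDr.
Qed.

Lemma continuous_loc_Int f : continuous f -> loc_Int f.
Proof. by move=> cf M; apply/Int_restrE => //; exact: continuous_integrable_itv. Qed.

Lemma potential_derive f (x : R) : continuous f -> 0 < x -> is_derive x 1 (potential f) (f x).
Proof.
move=> cf x0.
have I : mu.-integrable `[0, x + 1] (EFin \o f).
  apply: continuous_compact_integrable; first exact: segment_compact.
  exact: continuous_subspaceT.
have xx : x < x + 1 by rewrite ltrDl.
have [d1 d2] := @continuous_FTC1_closed R f 0 x (x + 1) xx I x0 (cf x).
have E : {near x, potential f =1 (fun y => \int[mu]_(t in `[0, y]) f t)}.
  near=> y; rewrite /potential Rintegral_itv_cc_oo//.
  by apply: measurable_funTS; exact: continuous_measurable_fun.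
apply: DeriveDef.
  by apply: near_eq_derivable d1 => //; near do apply/esym; exact: E.
rewrite -d2 derive1E; apply: near_eq_derive; exact: E.
Unshelve. all: by end_near. Qed.

(** Recovers pointwise values from integrals over intervals, up to the right end
point of the interval of continuity. *)
Lemma left_average f (a e : R) : a < e -> {within `[a, e], continuous f} ->
  h^-1 * (\int[mu]_(x in `]e - h, e[) f x) @[h --> 0^'+] --> f e.
Proof.
move=> ae cf.
have [_ _ ce] : [/\ {in `]a, e[, continuous f}, f x @[x --> a^'+] --> f a &
    f x @[x --> e^'-] --> f e] by apply/(continuous_within_itvP _ ae).
apply/cvgrPdist_le => eps eps0.
move/cvgrPdist_le : ce => /(_ eps eps0) [d /= d0 Hd].
near=> h.
have h0 : 0 < h by near: h; exact: nbhs_right_gt.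
have hd : h < d by near: h; exact: nbhs_right_lt.
have ha : h < e - a by near: h; apply: nbhs_right_lt; lra.
have If : mu.-integrable `]e - h, e[ (EFin \o f).
  apply: (@integrableS _ _ _ mu `[a, e]) => //; first by apply: subset_itvW; lra.
  by apply: continuous_compact_integrable => //; exact: segment_compact.
have mue : fine (mu `]e - h, e[) = h.
  rewrite /= lebesgue_measure_itv/= lte_fin ifT; last by lra.
  by rewrite /=; ring.
have Ic k : mu.-integrable `]e - h, e[ (EFin \o cst k).
  by apply: continuous_integrable_itv => z; exact: cvg_cst.
have Icf := Ic (f e).
have -> : f e - h^-1 * (\int[mu]_(x in `]e - h, e[) f x) =
   h^-1 * (\int[mu]_(x in `]e - h, e[) (f e - f x)).
  rewrite RintegralB// Rintegral_cst// mue; field; rewrite gt_eqF//.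
rewrite normrM gtr0_norm ?invr_gt0// ler_pdivrMl//.
have Id : mu.-integrable `]e - h, e[ (EFin \o (fun x => f e - f x)).
  apply/Int_restrE => //; move/Int_restrE : If => /(_ (measurable_itv _)) If.
  move/Int_restrE : Icf => /(_ (measurable_itv _)) Icf.
  by apply: Int_ext (IntB Icf If) => x; rewrite !patchE; case: ifP => _ //; rewrite subrr.
apply: le_trans (le_normr_Rintegral _ Id) _ => //.
apply: (@le_trans _ _ (\int[mu]_(x in `]e - h, e[) eps)).
  apply: le_Rintegral => //.
  - exact: integrable_norm.
  - exact: Ic.
  - move=> x /=; rewrite in_itv/= => /andP[h1 h2]; apply: Hd => //.
    by rewrite /ball_/= ger0_norm; lra.
by rewrite Rintegral_cst// mue mulrC.
Unshelve. all: by end_near. Qed.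

End Potential.

(** * D'Alembert's formula *)

Section IndicShift.
Context {R : realType}.
Local Notation mu := (@lebesgue_measure R).

(** Two translates of an indicator differ only at distance at most |a - b| from
the end points, where they differ by at most 1. *)
Lemma ip_indic_shift_le (f : R -> R) (c d a b : R) : Sq f ->
  (forall x, `|f x| <= `|\1_(`]c, d[%classic) (x - a) - \1_(`]c, d[%classic) (x - b)|) ->
  ip f f <= 4 * `|a - b|.
Proof.
move=> Sf H; pose h := `|a - b|.
have h0 : 0 <= h by exact: normr_ge0.
pose w x : R := \1_(`[c + b - h, c + b + h]%classic) x + \1_(`[d + b - h, d + b + h]%classic) x.
have Iw : Int w by apply: IntD; exact: integrable_indic_itv.
have E e : \int[mu]_x (\1_(`[e - h, e + h]%classic) x : R) = 2 * h.
  rewrite /Rintegral integral_indic// setIT /= lebesgue_measure_itv/= lte_fin.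
  case: ltP => H0 /=; [ring|lra].
have -> : 4 * h = \int[mu]_x w x.
  rewrite RintegralD//; try exact: integrable_indic_itv.
  rewrite !E; ring.
apply: le_Rintegral => //; first exact: ip_int.
move=> x _; rewrite -expr2 -real_normK ?num_real//.
apply: (@le_trans _ _ (`|\1_(`]c, d[%classic) (x - a) - \1_(`]c, d[%classic) (x - b)| ^+ 2)).
  by rewrite lerXn2r// nnegrE.
have : - h <= a - b <= h by rewrite -ler_norml.
rewrite /w !indicE !in_itvE !in_itv/= => /andP[h1 h2].
have B e : ((e < x - a) != (e < x - b)) || ((x - a < e) != (x - b < e)) ->
    (e + b - h <= x <= e + b + h) = true.
  case/orP; (do 2 case: ltP => ?) => // _; apply/andP; split; lra.
have ge (b1 b2 : bool) : 0 <= b1%:R + b2%:R :> R by rewrite addr_ge0.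
have le1 (b1 b2 : bool) : `|b1%:R - b2%:R : R| ^+ 2 <= 1.
  by case: b1; case: b2; rewrite ?subrr ?subr0 ?sub0r ?normrN ?normr0 ?normr1 ?expr1n ?expr0n.
have [e1|e1] := eqVneq (c < x - a) (c < x - b); last first.
  by rewrite B ?e1//; apply: le_trans (le1 _ _) _; rewrite lerDl.
have [e2|e2] := eqVneq (x - a < d) (x - b < d); last first.
  by rewrite (B d) ?e2 ?orbT//; apply: le_trans (le1 _ _) _; rewrite lerDr.
by rewrite e1 e2 subrr normr0 expr0n/= ge.
Qed.

Lemma dist_cvg0 (C t : R) : C * `|s - t| @[s --> t] --> 0.
Proof.
have H : C * `|s - t| @[s --> t] --> C * `|t - t|.
  apply: cvgM; first exact: cvg_cst.
  by apply: cvg_norm; apply: cvgB; [exact: cvg_id|exact: cvg_cst].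
by rewrite subrr normr0 mulr0 in H.
Qed.

Lemma primitive_derive (f : R -> R) (x : R) : Int f -> {for x, continuous f} ->
  is_derive x 1 (primitive f) (f x).
Proof.
move=> If cf; have xx : x < x + 1 by rewrite ltrDl.
have [d1 d2] : derivable (primitive f) x 1 /\ derive1 (primitive f) x = f x.
  exact: (@continuous_FTC1 R f -oo%O x (x + 1) xx (Int_subset (measurable_itv _) If) (ltNyr _) cf).
by rewrite -d2 derive1E; exact/derivableP.
Qed.

Lemma quotient_is_derive (f : R -> R) (t l : R) : is_derive t 1 f l ->
  (s - t)^-1 * (f s - f t) @[s --> t^'] --> l.
Proof.
case=> d e.
have H : h^-1 *: (f (h *: 1 + t) - f t) @[h --> 0^'] --> l by rewrite -e; exact: d.
apply/cvgrPdist_le => ep ep0; move/cvgrPdist_le : H => /(_ ep ep0).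
rewrite !near_withinE; case=> r /= r0 Hr; exists r => //= s hs st.
have := Hr (s - t); rewrite /ball_/= sub0r opprB => /(_ hs).
by rewrite subr_eq0 => /(_ st); rewrite /GRing.scale/= mulr1 subrK.
Qed.

End IndicShift.

Section AlongMinus.
Context {R : realType}.
Variables (L v : R).
Hypothesis hL : 0 < L.
Hypothesis hv : 0 <= v < 1.
Local Notation mu := (@lebesgue_measure R).
Local Notation It := (It L v).
Local Notation pair := (pairing L v).
Variables (phi phix phit : R -> R -> R).
Hypothesis hH1 : contH1 L v phi phix.
Hypothesis hC1 : contC1L2 L v phi phit.

Lemma indic_measurable (A : set R) : measurable A -> measurable_fun setT (\1_A : R -> R).
Proof. by move=> mA; exact: measurable_indic. Qed.

Lemma indic_bounded (A : set R) x : `|\1_A x : R| <= 1.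
Proof. by rewrite indicE; case: (x \in A); rewrite ?normr1 ?normr0. Qed.

Lemma pairing_indic (u : R -> R -> R) c d (sg t : R) : v * t <= c - sg * t -> d - sg * t <= L + v * t ->
  pair u \1_(`]c, d[%classic) sg t = \int[mu]_(x in `]c - sg * t, d - sg * t[) u x t.
Proof.
move=> h1 h2; rewrite /pairing Rintegral_restr [RHS]Rintegral_restr; apply: eq_Rintegral => x _; rewrite !patchE.
rewrite indicE !in_itvE !in_itv/= ltrBlDr ltrBrDr.
have [h|h] := boolP (c < x + sg * t < d); last by rewrite mulr0; case: ifP.
rewrite ifT ?mulr1//; move/andP: h => [? ?]; apply/andP; split; lra.
Qed.

Lemma phi_continuous t : 0 <= t -> {within `[v * t, L + v * t], continuous (phi ^~ t)}.
Proof. by move=> t0; case: hH1 => /(_ t t0)[]. Qed.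

Lemma phi_continuous_at t x : 0 <= t -> It t x -> {for x, continuous (phi ^~ t)}.
Proof.
move=> t0; rewrite in_It => h; have ll : v * t < L + v * t by rewrite ltrDr.
have [H _ _] : [/\ {in `]v * t, L + v * t[, continuous (phi ^~ t)}, phi ^~ t @ (v * t)^'+ --> phi (v * t) t &
    phi ^~ t @ (L + v * t)^'- --> phi (L + v * t) t].
  by apply/(continuous_within_itvP _ ll); exact: phi_continuous.
by apply: H; rewrite in_itv.
Qed.

Lemma Int_phi t : 0 <= t -> Int ((phi ^~ t) \_ (It t)).
Proof. by move=> t0; case: hC1 => -[h _] _ _; exact: L2_integrable (h _ t0). Qed.

(** The test function is an indicator carried along x - t = const; its motion
contributes the flux of phi through the two end points, as phi is continuous
in x. *)
Lemma pairing_indic_derive (c d t : R) : 0 < t -> c < d -> v * t < c + t -> d + t < L + v * t ->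
  is_derive t 1 (pair phi \1_(`]c, d[%classic) (-1))
    (pair phit \1_(`]c, d[%classic) (-1) t + (phi (d + t) t - phi (c + t) t)).
Proof.
move=> t0 cd h1 h2; have t0' := ltW t0; apply: is_derive_quotient.
set w : R -> R := \1_(`]c, d[%classic).
have mw : measurable_fun setT w by exact: indic_measurable.
have Sws (s : R) : Sq (fun x => w (x + -1 * s)).
  apply: (@Sq_bounded _ (c + s) (d + s) 1); first exact: measurable_shift.
  - by move=> x; exact: indic_bounded.
  - move=> x xn; rewrite /w indicE memNset//= in_itv/= => /andP[? ?]; apply: xn.
    by rewrite /= in_itv/=; apply/andP; split; lra.
apply: (@pairing_derive R L v phi phit w (-1) c d 1 _ t hC1) => //.
- by move=> x; exact: indic_bounded.
- move=> x xn; rewrite /w indicE memNset//= in_itv/= => /andP[? ?].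
  by move/negP: xn; apply; apply/andP; split; lra.
- by rewrite mulN1r opprK.
- by rewrite mulN1r opprK.
- apply: (@squeeze_cvgr _ _ _ _ (fun=> 0) (fun s => 4 * `|s - t|)).
  + apply: nearW => s; rewrite ip_ge0/=; apply: (@ip_indic_shift_le _ _ c d s t); first exact: SqB.
    by move=> x; rewrite /w !mulN1r.
  + exact: cvg_cst.
  + by apply: cvg_within_filter; exact: dist_cvg0.
- pose Ph := primitive ((phi ^~ t) \_ (It t)).
  have cI x : It t x -> is_derive x 1 Ph (phi x t).
    move=> Ix; have := @primitive_derive R ((phi ^~ t) \_ (It t)) x (Int_phi t0').
    rewrite patchE mem_set//; apply.
    have C := phi_continuous_at t0' Ix; rewrite /prop_for /continuous_at patchE mem_set//.
    apply: cvg_trans C; apply: near_eq_cvg.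
    have [k1 k2] : v * t < x /\ x < L + v * t by move: Ix; rewrite in_It => /andP.
    near=> z; rewrite patchE mem_set// in_It; apply/andP; split; near: z; [exact: lt_nbhsr|exact: lt_nbhsl].
  have D : is_derive t 1 (fun s => Ph (d + s) - Ph (c + s)) (phi (d + t) t - phi (c + t) t).
    have sh e : It t (e + t) -> is_derive t 1 (fun s => Ph (e + s)) (phi (e + t) t).
      move=> Ie; rewrite -[X in is_derive _ _ _ X]mul1r.
      have -> : (fun s => Ph (e + s)) = (fun s => Ph (1 * s + e)) by apply/funext => s; rewrite mul1r addrC.
      have := @is_derive_shift R Ph (fun x => phi x t) 1 e t; rewrite mul1r (addrC t e); apply.
      exact: cI.
    apply: is_deriveB; apply: sh; rewrite in_It; apply/andP; split; lra.
  apply: cvg_trans (quotient_is_derive D); apply: near_eq_cvg.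
  have [j1 [j2 j3]] : [/\ 0 < 1 * t + (c - v * t) , 0 < -1 * t + (L + v * t - d) & True] by split => //; lra.
  have n1 := nbhs_dnbhs (affine_gt0_near j1).
  have n2 := nbhs_dnbhs (affine_gt0_near j2).
  near=> s; congr (_ * _).
  have m1 : 0 < 1 * s + (c - v * t) by near: s.
  have m2 : 0 < -1 * s + (L + v * t - d) by near: s.
  have K (r : R) : 0 < 1 * r + (c - v * t) -> 0 < -1 * r + (L + v * t - d) ->
      \int[mu]_(x in It t) (phi x t * w (x + -1 * r)) = Ph (d + r) - Ph (c + r).
    move=> q1 q2; rewrite primitiveB; [|exact: Int_phi|by rewrite lerD2r ltW].
    rewrite Rintegral_restr [RHS]Rintegral_restr; apply: eq_Rintegral => x _; rewrite !patchE.
    rewrite /w indicE !in_itvE !in_itv/= mulN1r ltrBrDr ltrBlDr.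
    case: (c + r < x < d + r); last by rewrite mulr0; case: ifP.
    by rewrite mulr1.
  have IK (r : R) : Int ((fun x => phi x t * w (x + -1 * r)) \_ (It t)).
    apply: Int_ext (IntM_bounded (Int_phi t0') (measurable_shift (-1 * r) mw) (fun x => indic_bounded _ _)) => x.
    by rewrite !patchE; case: ifP => _ //; rewrite mul0r.
  rewrite -K// -K//.
  rewrite -RintegralB; [|exact: measurable_It|by apply/Int_restrE => //; exact: measurable_It..].
  by apply: eq_Rintegral => x _; rewrite mulrBr.
Unshelve. all: by end_near. Qed.

Lemma pairing_indic_continuous u (c d sg t : R) : contL2 L v u -> 0 <= t ->
  pair u \1_(`]c, d[%classic) sg s @[s --> within [set s | 0 <= s] (nbhs t)] -->
  pair u \1_(`]c, d[%classic) sg t.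
Proof.
move=> cu; have mw : measurable_fun setT (\1_(`]c, d[%classic) : R -> R) by exact: indic_measurable.
apply: (pairing_cvg cu mw (fun x => indic_bounded _ x)).
apply: (@squeeze_cvgr _ _ _ _ (fun=> 0) (fun s => 4 * `|v + sg| * `|s - t|)).
- apply: nearW => s; rewrite ip_ge0/= -mulrA -normrM.
  have -> : (v + sg) * (s - t) = - ((v + sg) * t) - (- ((v + sg) * s)) by ring.
  rewrite distrC; apply: (@ip_indic_shift_le _ _ c d).
    by apply: SqB; apply: (Sq_bounded_restr (M := 1)); [exact: measurable_shift|move=> x; exact: indic_bounded
     |exact: measurable_shift|move=> x; exact: indic_bounded].
  move=> x; rewrite !patchE !opprK; case: ifP => _ //.
  by rewrite subrr normr0.
- exact: cvg_cst.
- exact: dist_cvg0.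
Qed.

End AlongMinus.

Section Dalembert.
Context {R : realType}.
Variables (L v : R).
Hypothesis hL : 0 < L.
Hypothesis hv : 0 <= v < 1.
Local Notation mu := (@lebesgue_measure R).
Local Notation It := (It L v).
Local Notation pair := (pairing L v).
Variables (phi phix phit : R -> R -> R).
Hypothesis hH1 : contH1 L v phi phix.
Hypothesis hC1 : contC1L2 L v phi phit.
Hypothesis hW : weak_wave L v phix phit.
Local Notation P := (profile L v phix phit).
Local Notation Fp := (potential P).

Lemma profile_loc_Int : loc_Int P.
Proof. by move=> M; exact: (Int_profile hL hv hH1 hC1). Qed.

Lemma profile_potential_continuous : continuous Fp. Proof. exact: potential_continuous profile_loc_Int. Qed.

Lemma rightder_integral (t c d : R) : 0 <= t -> v * t <= c -> c < d -> d <= L + v * t ->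
  \int[mu]_(x in `]c, d[) (phit x t + phix x t) = Fp (d + t) - Fp (c + t).
Proof.
move=> t0 h1 cd h2.
have vt : 0 <= v * t by rewrite mulr_ge0//; case/andP: hv.
rewrite potentialB; [|exact: profile_loc_Int|lra|lra].
rewrite Rintegral_shift; last first.
  by apply: loc_IntS profile_loc_Int _; lra.
have A := rightder_ae hL hv hH1 hC1 hW t0.
have IP : Int ((fun z => P (z + t)) \_ `]c, d[).
  by apply: loc_IntS (loc_Int_shift profile_loc_Int t0) _; exact: le_trans h1.
have Iq : Int ((fun z => phit z t + phix z t) \_ `]c, d[).
  by apply: Int_restrS (L2_integrable (Sq_rightder hH1 hC1 t0)) => //; exact: subset_itvW.
rewrite /Rintegral; congr fine; apply: ae_eq_integral => //.
- by move/Int_restrE : Iq => /(_ (measurable_itv _))/measurable_int.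
- by move/Int_restrE : IP => /(_ (measurable_itv _))/measurable_int.
- apply: ae_imp A => x H; rewrite /= in_itv/= => /andP[? ?]; congr EFin; apply: H.
  by rewrite in_It; apply/andP; split; lra.
Qed.

Lemma phi_FTC (t c d : R) : 0 <= t -> v * t <= c -> c < d -> d <= L + v * t ->
  phi d t - phi c t = \int[mu]_(x in `]c, d[) phix x t.
Proof.
move=> t0 h1 cd h2; case: (hH1) => /(_ t t0)[h cw _] _ _.
by rewrite (@H1_FTC _ _ _ _ _ h cw c d).
Qed.

Lemma It_sub_integrable u (t c d : R) : v * t <= c -> d <= L + v * t -> L2 (It t) (u ^~ t) ->
  mu.-integrable `]c, d[ (EFin \o (u ^~ t)).
Proof.
move=> h1 h2 Lu; apply/Int_restrE => //.
by apply: Int_restrS (L2_integrable Lu) => //; exact: subset_itvW.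
Qed.

Lemma phit_L2 t : 0 <= t -> L2 (It t) (phit ^~ t).
Proof. by move=> t0; case: hC1 => _ [h _] _; exact: h. Qed.
Lemma phix_L2 t : 0 <= t -> L2 (It t) (phix ^~ t).
Proof. by move=> t0; case: hH1 => _ _ [h _]; exact: h. Qed.

(** Along x - t = const the derivative of phi is phi_t + phi_x = P(x + t).
Averaged over c < x - t < d, it becomes a difference of values of the potential
Fp of P at d + 2 t and c + 2 t, hence the derivative of half a difference of
values of the potential of Fp. *)
Lemma minus_balance (c d t T : R) : 0 <= t -> c < d -> t < T -> v * t <= c + t -> d + T <= L + v * T ->
  2 * (\int[mu]_(x in `]c + t, d + t[) phi x t) - (potential Fp (d + 2 * t) - potential Fp (c + 2 * t)) =
  2 * (\int[mu]_(x in `]c + T, d + T[) phi x T) - (potential Fp (d + 2 * T) - potential Fp (c + 2 * T)).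
Proof.
move=> t0 cd tT h1 h2.
have [v0 v1] : 0 <= v /\ v < 1 by apply/andP.
have mvt : (1 - v) * t < (1 - v) * T by rewrite ltr_pM2l// subr_gt0.
set w : R -> R := \1_(`]c, d[%classic).
have inside (s : R) : t <= s <= T -> v * s <= c + s /\ d + s <= L + v * s.
  move=> /andP[s1 s2].
  have : (1 - v) * t <= (1 - v) * s by rewrite ler_wpM2l// subr_ge0 ltW.
  have : (1 - v) * s <= (1 - v) * T by rewrite ler_wpM2l// subr_ge0 ltW.
  by move=> ? ?; split; lra.
have E (s : R) : t <= s <= T -> pair phi w (-1) s = \int[mu]_(x in `]c + s, d + s[) phi x s.
  move=> ts; have [i1 i2] := inside _ ts.
  by rewrite pairing_indic// !mulN1r !opprK.
rewrite -!E ?lexx ?ltW//.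
pose g s := 2 * pair phi w (-1) s - (potential Fp (d + 2 * s) - potential Fp (c + 2 * s)).
have cGp : continuous (potential Fp) by apply: potential_continuous; exact: continuous_loc_Int profile_potential_continuous.
have clin (e : R) : {within `[t, T], continuous (fun s => potential Fp (e + 2 * s))}.
  apply: continuous_subspaceT => s.
  apply: (@continuous_comp R R R (fun s => e + 2 * s) (potential Fp)); last exact: cGp.
  by apply: cvgD; [exact: cvg_cst|apply: cvgM; [exact: cvg_cst|exact: cvg_id]].
have [cphi _ _] := hC1.
have cg : {within `[t, T], continuous g}.
  apply: withinB; last by apply: withinB; exact: clin.
  apply: withinM; first by move=> ?; exact: cvg_cst.
  apply: within_itv_ge0 => // s s0; exact: pairing_indic_continuous.
have dg (s : R) : t < s < T -> is_derive s 1 g 0.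
  move=> ts; have /andP[s1 s2] := ts.
  have ms1 : (1 - v) * t < (1 - v) * s by rewrite ltr_pM2l// subr_gt0.
  have ms2 : (1 - v) * s < (1 - v) * T by rewrite ltr_pM2l// subr_gt0.
  have s0 : 0 < s by exact: le_lt_trans s1.
  have vs : 0 <= v * s by rewrite mulr_ge0// ltW.
  have i1 : v * s < c + s by lra.
  have i2 : d + s < L + v * s by lra.
  have D1 := pairing_indic_derive hL hH1 hC1 s0 cd i1 i2.
  have DG e : 0 < e + 2 * s -> is_derive s 1 (fun s => potential Fp (e + 2 * s)) (2 * Fp (e + 2 * s)).
    move=> e0; have := @is_derive_shift R (potential Fp) Fp 2 e s.
    rewrite (addrC (2 * s)); move=> /(_ (potential_derive profile_potential_continuous e0)).
    by under eq_fun do rewrite addrC.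
  have D2 := DG d (ltac:(lra)); have D3 := DG c (ltac:(lra)).
  have Z : pair phit w (-1) s + (phi (d + s) s - phi (c + s) s) = Fp (d + 2 * s) - Fp (c + 2 * s).
    rewrite pairing_indic; [|lra|lra]; rewrite !mulN1r !opprK phi_FTC; [|lra..].
    rewrite -RintegralD; [|exact: measurable_itv|apply: It_sub_integrable; [lra|lra|exact: phit_L2 (ltW s0)]|apply: It_sub_integrable; [lra|lra|exact: phix_L2 (ltW s0)]].
    rewrite rightder_integral; [|lra..].
    by congr (Fp _ - Fp _); lra.
  rewrite Z in D1.
  have D4 := is_derive_mul (is_derive_cst (2 : R) s 1) D1.
  have D5 := is_deriveB D4 (is_deriveB D2 D3).
  apply: is_derive_eq D5 _; ring.
have c0 : {within `[t, T], continuous (fun=> 0 : R)} by move=> ?; exact: cvg_cst.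
have := FTC_inside tT cg c0 dg; rewrite Rintegral_cst// mul0r => /esym/eqP.
by rewrite subr_eq0 => /eqP; rewrite /g => <-.
Qed.

(** The line x - t = k through the given point meets the right end at the time
T = (L - k) / (1 - v), where phi vanishes. Apply [minus_balance] between t and T
to the interval ]k - h, k[, divide by h and let h tend to 0. *)
Lemma dalembert (t x : R) : 0 <= t -> It t x ->
  2 * phi x t = Fp (x + t) - Fp (L + (1 + v) / (1 - v) * (L + t - x)).
Proof.
move=> t0; rewrite in_It => /andP[x1 x2].
have [v0 v1] : 0 <= v /\ v < 1 by apply/andP.
have v1' : 0 < 1 - v by rewrite subr_gt0.
pose k := x - t; pose T := (L - k) / (1 - v).
have TE : (1 - v) * T = L - k by rewrite /T mulrC divfK// gt_eqF.
have tT : t < T by rewrite -(ltr_pM2l v1') TE /k; lra.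
have T0 : 0 <= T by exact: le_trans t0 (ltW tT).
have vt : 0 <= v * t by rewrite mulr_ge0.
have vT : 0 <= v * T by rewrite mulr_ge0.
have A1 : h^-1 * (\int[mu]_(y in `]x - h, x[) phi y t) @[h --> 0^'+] --> phi x t.
  apply: (@left_average R (phi ^~ t) (v * t)) => //.
  by apply: continuous_subspaceW (phi_continuous hH1 t0) => y /=; rewrite !in_itv/= => /andP[? ?]; apply/andP; split; lra.
have A2 : h^-1 * (\int[mu]_(y in `](L + v * T) - h, L + v * T[) phi y T) @[h --> 0^'+] --> phi (L + v * T) T.
  apply: (@left_average R (phi ^~ T) (v * T)) => //; first by rewrite ltrDr.
  exact: (phi_continuous hH1 T0).
have A3 e : 0 < e -> h^-1 * (\int[mu]_(y in `]e - h, e[) Fp y) @[h --> 0^'+] --> Fp e.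
  by move=> e0; apply: (@left_average R Fp 0) => //; apply: continuous_subspaceT; exact: profile_potential_continuous.
have e1 : k + 2 * t = x + t by rewrite /k; ring.
have e2 : k + T = L + v * T by move: TE; lra.
have e3 : k + 2 * T = L + (1 + v) / (1 - v) * (L + t - x).
  by rewrite /T /k; field; rewrite gt_eqF.
have phiT : phi (L + v * T) T = 0 by case: hH1 => /(_ T T0)[].
have P1 : 0 < x + t by lra.
have P2 : 0 < k + 2 * T by have : 0 <= T by []; lra.
have B1 : 2 * (h^-1 * (\int[mu]_(y in `]x - h, x[) phi y t)) - h^-1 * (\int[mu]_(y in `]x + t - h, x + t[) Fp y)
    @[h --> 0^'+] --> 2 * phi x t - Fp (x + t).
  by apply: cvgB (A3 _ P1); apply: cvgM A1; exact: cvg_cst.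
have B2 : 2 * (h^-1 * (\int[mu]_(y in `](L + v * T) - h, L + v * T[) phi y T))
     - h^-1 * (\int[mu]_(y in `](k + 2 * T) - h, k + 2 * T[) Fp y)
    @[h --> 0^'+] --> 2 * phi (L + v * T) T - Fp (k + 2 * T).
  by apply: cvgB (A3 _ P2); apply: cvgM A2; exact: cvg_cst.
rewrite phiT mulr0 sub0r [in X in _ --> X]e3 in B2.
suff : 2 * phi x t - Fp (x + t) = - Fp (L + (1 + v) / (1 - v) * (L + t - x)) by lra.
apply: (cvg_unique (@Rhausdorff R) B1).
apply: cvg_trans B2; apply: near_eq_cvg; near=> h.
have h0 : 0 < h by near: h; exact: nbhs_right_gt.
have hx : h < x - v * t by near: h; apply: nbhs_right_lt; lra.
have kh : k - h < k by rewrite gtrBl.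
have := @minus_balance (k - h) k t T t0 kh tT.
have -> : k - h + t = x - h by rewrite /k; ring.
have -> : k + t = x by rewrite /k; ring.
have xh : v * t <= x - h by rewrite lerBrDl -lerBrDr ltW.
rewrite e2 e1 => /(_ xh (lexx _)) H.
have G (b : R) : 0 <= b - h -> potential Fp b - potential Fp (b - h) = \int[mu]_(y in `]b - h, b[) Fp y.
  by move=> b0; rewrite potentialB//; [apply: continuous_loc_Int; exact: profile_potential_continuous|rewrite gerBl ltW].
rewrite -(G (x + t)) -?(G (k + 2 * T)); [|lra|by rewrite subr_ge0 (le_trans (ltW hx))// lerBlDr -addrA lerDl addr_ge0].
have q1 : k - h + T = L + v * T - h by rewrite -e2; ring.
have q2 : k - h + 2 * t = x + t - h by rewrite /k; ring.
have q3 : k - h + 2 * T = k + 2 * T - h by ring.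
rewrite q1 q2 q3 in H.
transitivity (h^-1 * (2 * \int[mu]_(y in `]x - h, x[) phi y t - (potential Fp (x + t) - potential Fp (x + t - h)))); last by ring.
by rewrite H; ring.
Unshelve. all: by end_near. Qed.

Definition leftder t x := phit x t - phix x t.

(** The derivative in x of d'Alembert's formula, in integrated form. *)
Lemma leftder_ae (t : R) : 0 <= t -> {ae mu, forall x, It t x ->
  leftder t x = - (gamma_v v * P (L + gamma_v v * (L + t - x)))}.
Proof.
move=> t0; have [v0 v1] : 0 <= v /\ v < 1 by apply/andP.
have v1' : 0 < 1 - v by rewrite subr_gt0.
have g0 : 0 < gamma_v v by rewrite /gamma_v divr_gt0//; lra.
have vt : 0 <= v * t by rewrite mulr_ge0.
have vtt : v * t <= t by rewrite ler_piMl// ltW.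
pose m : R := - gamma_v v; pose e := L + gamma_v v * (L + t).
have mE x : L + gamma_v v * (L + t - x) = m * x + e by rewrite /m /e; ring.
have m0 : m != 0 by rewrite oppr_eq0 gt_eqF.
(* a bound for the arguments at which P is evaluated *)
pose B := e + 1.
have Im : Int (fun x => (P \_ `]0, B[) (m * x + e)) by apply: Int_affine => //; exact: profile_loc_Int.
have Iq : Int ((fun x => leftder t x) \_ (It t)).
  apply: Int_ext (IntB (L2_integrable (phit_L2 t0)) (L2_integrable (phix_L2 t0))) => x.
  by rewrite !patchE /leftder; case: ifP => _ //; rewrite subrr.
pose f x := ((fun x => leftder t x) \_ (It t)) x + gamma_v v * (P \_ `]0, B[) (m * x + e).
have If : Int f by apply: IntD => //; exact: IntZ.
have in0 x : v * t < x < L + v * t -> 0 < m * x + e < B.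
  move=> /andP[x1 x2]; rewrite -mE.
  have : 0 < gamma_v v * (L + t - x) by rewrite mulr_gt0//; lra.
  have : gamma_v v * (v * t - x) < 0 by rewrite pmulr_rlt0//; lra.
  by rewrite /B /e => ? ?; have : 0 <= gamma_v v * (v * t) := mulr_ge0 (ltW g0) vt; move=> ?; apply/andP; split; lra.
apply: ae_imp (@ae_eq0_integral R f (v * t) (L + v * t) If _).
  move=> x H Ix; move: (H); rewrite -in_It => /(_ Ix); rewrite /f !patchE mem_set//.
  rewrite in_itvE in_itv/= in0 -?in_It// mE => ?; lra.
move=> a b h1 ab h2.
have sb x : x \in (`]a, b[%classic : set R) -> It t x.
  by rewrite inE/= in_itv/= in_It => /andP[? ?]; apply/andP; split; lra.
have -> : \int[mu]_(x in `]a, b[) f x = \int[mu]_(x in `]a, b[) leftder t x +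
    gamma_v v * \int[mu]_(x in `]a, b[) (P \_ `]0, B[) (m * x + e).
  rewrite RintegralD; [|exact: measurable_itv|exact: Int_subset|by apply: Int_subset => //; exact: IntZ].
  rewrite RintegralZl; [|exact: measurable_itv|exact: Int_subset].
  by congr (_ + _); apply: eq_Rintegral => x /sb xI; rewrite patchE mem_set.
have -> : \int[mu]_(x in `]a, b[) leftder t x = Fp (b + t) - Fp (a + t) - 2 * (phi b t - phi a t).
  rewrite -rightder_integral//; [|lra..]; rewrite phi_FTC//; [|lra..].
  have I1 := It_sub_integrable (ltW h1) (ltW h2) (phit_L2 t0); have I2 := It_sub_integrable (ltW h1) (ltW h2) (phix_L2 t0).
  rewrite RintegralD//; rewrite /leftder RintegralB//; ring.
have It' x : a <= x <= b -> It t x by move=> /andP[? ?]; rewrite in_It; apply/andP; split; lra.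
have Ra := dalembert t0 (It' a (ltac:(apply/andP; split; lra))).
have Rb := dalembert t0 (It' b (ltac:(apply/andP; split; lra))).
rewrite mulrBr Ra Rb -/(gamma_v v) !mE.
suff -> : gamma_v v * \int[mu]_(x in `]a, b[) (P \_ `]0, B[) (m * x + e) = Fp (m * a + e) - Fp (m * b + e) by ring.
have /andP[a1 a2] := in0 a (ltac:(apply/andP; split; lra)).
have /andP[b1 b2] := in0 b (ltac:(apply/andP; split; lra)).
have mab : m * b < m * a by rewrite ltr_nM2l// oppr_lt0.
rewrite potentialB; [|exact: profile_loc_Int|exact: ltW|lra].
rewrite [RHS]Rintegral_restr (@integral_affine R m e)//; last first.
  by apply: loc_IntS profile_loc_Int _; exact: ltW.
rewrite /m normrN gtr0_norm// -/m; congr (_ * _); rewrite Rintegral_restr; apply: eq_Rintegral => x _.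
rewrite !patchE !in_itvE !in_itv/= !ltrD2r !ltr_nM2l ?oppr_lt0// [in RHS]andbC.
case: ifPn => // /andP[ax xb].
by rewrite in0//; apply/andP; split; lra.
Qed.

End Dalembert.

(** * The damping condition at the left end *)

Section MeanSquares.
Context {R : realType}.
Local Notation mu := (@lebesgue_measure R).

(** The integral of a nonnegative function is a supremum over the simple functions
below it, which is monotone for arbitrary functions. In [left_bc] the inner
integral has no evident measurability in t. *)
Lemma ge0_le_integral_nonmeas (A B : set R) (f g : R -> \bar R) :
  (forall x, A x -> 0 <= f x)%E -> (forall x, B x -> 0 <= g x)%E ->
  (forall x, A x -> B x /\ f x <= g x)%E ->
  (\int[mu]_(x in A) f x <= \int[mu]_(x in B) g x)%E.
Proof.
move=> f0 g0 fg; rewrite !ge0_integralE//; apply: le_ereal_sup => _ [k kf <-].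
exists k => // x; apply: le_trans (kf x) _; rewrite !patchE.
have [xA|_] := boolP (x \in A).
  by have [xB h] := fg x (set_mem xA); rewrite (mem_set xB).
by case: ifPn => // xB; apply: g0; exact: set_mem xB.
Qed.

(** Cauchy-Schwarz against the indicator of the interval; the right-hand side may
be infinite. *)
Lemma sqr_integral_le (f : R -> R) (a b : R) : a < b -> mu.-integrable `]a, b[ (EFin \o f) ->
  (((\int[mu]_(x in `]a, b[) f x) ^+ 2)%:E <= (b - a)%:E * \int[mu]_(x in `]a, b[) ((f x) ^+ 2)%:E)%E.
Proof.
move=> ab If; have ba : (0 < (b - a)%:E)%E by rewrite lte_fin subr_gt0.
have [->|fin] := eqVneq (\int[mu]_(x in `]a, b[) ((f x) ^+ 2)%:E)%E +oo%E.
  by rewrite gt0_muley// leey.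
have i0 : (0 <= \int[mu]_(x in `]a, b[) ((f x) ^+ 2)%:E)%E.
  by apply: integral_ge0 => x _; rewrite lee_fin sqr_ge0.
have If' : Int (f \_ `]a, b[) by apply/Int_restrE.
have I2 : Int (fun x => (f \_ `]a, b[) x ^+ 2).
  have : mu.-integrable `]a, b[ (EFin \o (fun x => f x ^+ 2)).
    apply/integrableP; split.
      move/measurable_int/measurable_EFinP : If => mf.
      by apply/measurable_EFinP; apply: measurable_funX.
    rewrite (_ : (\int[mu]_(x in _) _)%E = (\int[mu]_(x in `]a, b[) ((f x) ^+ 2)%:E)%E).
      by rewrite ltey.
    by apply: eq_integral => x _ /=; rewrite ger0_norm ?sqr_ge0.
  move/(Int_restrE _ (measurable_itv _)); apply: Int_ext => x; rewrite !patchE.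
  by case: ifP => _ //; rewrite expr0n.
have Sf : Sq (f \_ `]a, b[) by apply/SqP; split => //; exact: Int_meas.
have E : (\int[mu]_(x in `]a, b[) ((f x) ^+ 2)%:E)%E = (ip (f \_ `]a, b[) (f \_ `]a, b[))%:E.
  rewrite /ip /Rintegral fineK; last by apply: integrable_fin_num => //; exact: ip_int.
  rewrite [LHS]integral_mkcond; apply: eq_integral => x _; rewrite !patchE.
  by case: ifP => _; rewrite ?expr2 ?mulr0.
rewrite E -EFinM lee_fin.
have S1 : Sq (\1_(`[a, b]%classic) : R -> R) by exact: Sq_indic.
have := cauchy_schwarz Sf S1.
have -> : ip (f \_ `]a, b[) \1_(`[a, b]%classic) = \int[mu]_(x in `]a, b[) f x.
  rewrite /ip [RHS]Rintegral_restr; apply: eq_Rintegral => x _; rewrite indicE !patchE.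
  case: ifPn => xab; last by rewrite mul0r.
  rewrite mem_set ?mulr1//; apply: subset_itv_oo_cc; exact: set_mem xab.
move/le_trans; apply; rewrite mulrC ler_wpM2r ?ip_ge0//.
have := @ip_le_bounded R \1_(`[a, b]%classic) a b 1 (ltW ab) S1.
rewrite expr1n mul1r; apply.
- by move=> x; exact: indic_bounded.
- by move=> x xn; rewrite indicE memNset.
Qed.

End MeanSquares.

Section Averages.
Context {R : realType}.
Local Notation mu := (@lebesgue_measure R).

Lemma continuous_affine (F : R -> R) (k e : R) : continuous F -> continuous (fun t => F (k * t + e)).
Proof.
move=> cF t; apply: (@continuous_comp R R R (fun t => k * t + e) F); last exact: cF.
by apply: cvgD; [apply: cvgM; [exact: cvg_cst|exact: cvg_id]|exact: cvg_cst].
Qed.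

Lemma cvg_comb (T : Type) (E : set_system T) {FE : Filter E} (f1 f2 f3 f4 : T -> R) (A B C l1 l2 l3 l4 : R) :
  f1 x @[x --> E] --> l1 -> f2 x @[x --> E] --> l2 -> f3 x @[x --> E] --> l3 -> f4 x @[x --> E] --> l4 ->
  C * (A * (f1 x - f2 x) + B * (f3 x - f4 x)) @[x --> E] --> C * (A * (l1 - l2) + B * (l3 - l4)).
Proof.
move=> c1 c2 c3 c4; apply: cvgM; first exact: cvg_cst.
by apply: cvgD; (apply: cvgM; first exact: cvg_cst); exact: cvgB.
Qed.

Lemma integral_comb (D : set R) (f1 f2 f3 f4 : R -> R) (A B C : R) : measurable D ->
  mu.-integrable D (EFin \o f1) -> mu.-integrable D (EFin \o f2) ->
  mu.-integrable D (EFin \o f3) -> mu.-integrable D (EFin \o f4) ->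
  \int[mu]_(x in D) (C * (A * (f1 x - f2 x) + B * (f3 x - f4 x))) =
  C * (A * (\int[mu]_(x in D) f1 x - \int[mu]_(x in D) f2 x) +
       B * (\int[mu]_(x in D) f3 x - \int[mu]_(x in D) f4 x)).
Proof.
move=> mD I1 I2 I3 I4.
have sub f g : mu.-integrable D (EFin \o f) -> mu.-integrable D (EFin \o g) ->
    mu.-integrable D (EFin \o (fun x => f x - g x)).
  move=> If Ig; have := integrable_add mD If (integrable_scale (-1) mD Ig).
  by apply: eq_integrable => // z _ /=; rewrite mulN1r.
have J1 := sub _ _ I1 I2; have J2 := sub _ _ I3 I4.
rewrite RintegralZl//; last by apply: integrable_add => //; exact: integrable_scale.
rewrite RintegralD//; [|exact: integrable_scale|exact: integrable_scale].
by rewrite !RintegralZl// !RintegralB.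
Qed.

Lemma integral_affine_potential (F : R -> R) (a b m k : R) : continuous F -> 0 < m -> 0 < a -> a < b -> 0 <= k ->
  \int[mu]_(t in `]a, b[) F (m * t + k) = m^-1 * (potential F (m * b + k) - potential F (m * a + k)).
Proof.
move=> cF m0 a0 ab k0.
have cs := @continuous_affine F m k cF.
have cG : continuous (potential F) by apply: potential_continuous; exact: continuous_loc_Int cF.
have csG : continuous (fun t => m^-1 * potential F (m * t + k)).
  by move=> t; apply: cvgM; [exact: cvg_cst|exact: continuous_affine].
have D (t : R) : a < t < b -> is_derive t 1 (fun t => m^-1 * potential F (m * t + k)) (F (m * t + k)).
  move=> /andP[ta tb].
  have p0 : 0 < m * t + k by rewrite ltr_wpDr// mulr_gt0// (lt_trans a0).
  have H := @is_derive_shift R (potential F) F m k t (potential_derive cF p0).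
  have := is_derive_mul (is_derive_cst (m^-1 : R) t 1) H.
  by rewrite mul0r add0r mulKf// gt_eqF.
rewrite (FTC_inside ab (continuous_subspaceT csG) (continuous_subspaceT cs) D).
by rewrite mulrBr.
Qed.

Lemma is_derive_right_quotients (f : R -> R) (x l k : R) : 0 < k -> is_derive x 1 f l ->
  h^-1 * (f (x + k * h) - f x) @[h --> 0^'+] --> k * l /\
  h^-1 * (f x - f (x - k * h)) @[h --> 0^'+] --> k * l.
Proof.
move=> k0 D; have Q := quotient_is_derive D.
have aux (m : R) : m != 0 -> h^-1 * (f (x + m * h) - f x) @[h --> 0^'+] --> m * l.
  move=> m0.
  have C : x + m * h @[h --> 0^'+] --> x^'.
    have C1 : x + m * h @[h --> 0^'+] --> x.
      have C0 : x + m * h @[h --> (0 : R)] --> x + m * 0.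
        by apply: cvgD; [exact: cvg_cst|apply: cvgM; [exact: cvg_cst|exact: cvg_id]].
      by rewrite mulr0 addr0 in C0; exact: cvg_within_filter C0.
    move=> A; rewrite /dnbhs /within/= => HA; have := C1 _ HA; rewrite /nbhs/= => HB.
    have h0 : \forall h \near (0 : R)^'+, 0 < h by exact: nbhs_right_gt.
    apply: filterS2 h0 HB => h /= hp; apply.
    by rewrite -subr_eq0 addrAC subrr add0r mulf_neq0// gt_eqF.
  have C2 := cvg_comp _ _ C Q; rewrite /comp in C2.
  have C3 : m * ((x + m * h - x)^-1 * (f (x + m * h) - f x)) @[h --> 0^'+] --> m * l.
    by apply: cvgM C2; exact: cvg_cst.
  apply: cvg_trans C3; apply: near_eq_cvg; near=> h.
  have h0 : 0 < h by near: h; exact: nbhs_right_gt.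
  by rewrite addrAC subrr add0r; field; rewrite m0 gt_eqF.
split; first by apply: aux; rewrite gt_eqF.
have Z : - (h^-1 * (f (x + - k * h) - f x)) @[h --> 0^'+] --> - (- k * l).
  by apply: cvgN; apply: aux; rewrite oppr_eq0 gt_eqF.
rewrite mulNr opprK in Z; apply: cvg_trans Z; apply: near_eq_cvg; apply: nearW => h /=.
by rewrite -mulrN opprB mulNr.
Unshelve. all: by end_near. Qed.

End Averages.

Section LeftEnd.
Context {R : realType}.
Variables (L v eta : R).
Hypothesis hL : 0 < L.
Hypothesis hv : 0 <= v < 1.
Local Notation mu := (@lebesgue_measure R).
Local Notation It := (It L v).
Local Notation L_2 := (L_2 L v).
Variables (phi phix phit : R -> R -> R).
Hypothesis hH1 : contH1 L v phi phix.
Hypothesis hC1 : contC1L2 L v phi phit.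
Hypothesis hW : weak_wave L v phix phit.
Hypothesis hB : left_bc v eta phix phit.
Local Notation P := (profile L v phix phit).
Local Notation Fp := (potential P).

Let v0 : 0 <= v. Proof. by case/andP: hv. Qed.
Let v1 : 0 < 1 - v. Proof. by rewrite subr_gt0; case/andP: hv. Qed.
Let vp : 0 < 1 + v. Proof. by have := v0; lra. Qed.

Let Fp_continuous : continuous Fp.
Proof. exact: (profile_potential_continuous hL hv hH1 hC1). Qed.

(** D'Alembert's formula extended to the left end by continuity: there the
reflected argument is the direct one shifted by L_2. *)
Lemma dalembert_left (t : R) : 0 <= t ->
  2 * phi (v * t) t = Fp ((1 + v) * t) - Fp ((1 + v) * t + L_2).
Proof.
move=> t0; have ll : v * t < L + v * t by rewrite ltrDr.
have [_ C _] : [/\ {in `]v * t, L + v * t[, continuous (phi ^~ t)}, phi ^~ t @ (v * t)^'+ --> phi (v * t) t &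
    phi ^~ t @ (L + v * t)^'- --> phi (L + v * t) t].
  by apply/(continuous_within_itvP _ ll); exact: (phi_continuous hH1 t0).
have C2 : 2 * phi x t @[x --> (v * t)^'+] --> 2 * phi (v * t) t.
  by apply: cvgM C; exact: cvg_cst.
apply: (cvg_unique (@Rhausdorff R) C2).
have D : Fp (x + t) - Fp (L + (1 + v) / (1 - v) * (L + t - x)) @[x --> v * t] -->
    Fp (v * t + t) - Fp (L + (1 + v) / (1 - v) * (L + t - v * t)).
  apply: cvgB.
    apply: (@cvg_comp _ _ _ (fun x : R => x + t) Fp); last exact: Fp_continuous.
    by apply: cvgD; [exact: cvg_id|exact: cvg_cst].
  apply: (@cvg_comp _ _ _ (fun x : R => L + (1 + v) / (1 - v) * (L + t - x)) Fp); last exact: Fp_continuous.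
  apply: cvgD; first exact: cvg_cst.
  apply: cvgM; first exact: cvg_cst.
  by apply: cvgB; [exact: cvg_cst|exact: cvg_id].
have E1 : v * t + t = (1 + v) * t by ring.
have E2 : L + (1 + v) / (1 - v) * (L + t - v * t) = (1 + v) * t + L_2.
  by rewrite /Defs.L_2; field; rewrite gt_eqF.
rewrite E1 E2 in D.
have D' : Fp (x + t) - Fp (L + (1 + v) / (1 - v) * (L + t - x)) @[x --> (v * t)^'+] -->
    Fp ((1 + v) * t) - Fp ((1 + v) * t + L_2) by exact: cvg_within_filter D.
apply: cvg_trans D'; apply: near_eq_cvg; near=> x.
rewrite (dalembert hL hv hH1 hC1 hW)// in_It; apply/andP; split.
  by near: x; exact: nbhs_right_gt.
by near: x; exact: nbhs_right_lt.
Unshelve. all: by end_near. Qed.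

Definition damping t x := (1 - eta * v) * phix x t - (eta - v) * phit x t.

(** The integral of the damping functional over v t < x < v t + h, expressed with
the potential of P. The term + 0 gives all four values of the potential the same
shape. *)
Definition damping_mean (h t : R) : R := 2^-1 *
  ((1 + v) * (1 - eta) * (Fp ((1 + v) * t + h) - Fp ((1 + v) * t + 0)) +
   (1 - v) * (1 + eta) * (Fp ((1 + v) * t + L_2) - Fp ((1 + v) * t + (L_2 - gamma_v v * h)))).

Lemma damping_integral (t h : R) : 0 <= t -> 0 < h -> h < L ->
  mu.-integrable `]v * t, v * t + h[ (EFin \o damping t) /\
  \int[mu]_(x in `]v * t, v * t + h[) damping t x = damping_mean h t.
Proof.
move=> t0 h0 hL'.
have c1 : v * t <= v * t by [].
have c2 : v * t + h <= L + v * t by lra.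
have I1 := It_sub_integrable c1 c2 (phit_L2 hC1 t0); have I2 := It_sub_integrable c1 c2 (phix_L2 hH1 t0).
have mI := measurable_itv (`]v * t, v * t + h[%R : interval R).
have J1 := integrable_scale (eta - v) mI I1; have J2 := integrable_scale (1 - eta * v) mI I2.
split.
  have := integrable_add mI J2 (integrable_scale (-1) mI J1); rewrite /damping.
  by apply: eq_integrable => // x _ /=; rewrite mulN1r.
rewrite RintegralB// !RintegralZl//.
have -> : \int[mu]_(x in `]v * t, v * t + h[) phit x t =
   \int[mu]_(x in `]v * t, v * t + h[) (phit x t + phix x t) - \int[mu]_(x in `]v * t, v * t + h[) phix x t.
  by rewrite RintegralD//; ring.
have cd : v * t < v * t + h by rewrite ltrDl.
rewrite -(phi_FTC hH1)//.
rewrite (rightder_integral hL hv hH1 hC1 hW)//.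
have F1 := dalembert_left t0.
have Ix : It t (v * t + h) by rewrite in_It; apply/andP; split; lra.
have F2 := dalembert hL hv hH1 hC1 hW t0 Ix.
have E1 : v * t + t = (1 + v) * t by ring.
have E2 : v * t + h + t = (1 + v) * t + h by ring.
have E3 : L + (1 + v) / (1 - v) * (L + t - (v * t + h)) = (1 + v) * t + (L_2 - gamma_v v * h).
  by rewrite /Defs.L_2 /gamma_v; field; rewrite gt_eqF.
rewrite E2 E3 in F2; rewrite E1 E2.
have -> : phi (v * t + h) t = 2^-1 * (2 * phi (v * t + h) t) by field.
have -> : phi (v * t) t = 2^-1 * (2 * phi (v * t) t) by field.
by rewrite F1 F2 /damping_mean addr0; field.
Qed.

Lemma damping_mean_continuous h : continuous (damping_mean h).
Proof. by move=> t; apply: cvg_comb; apply: continuous_affine; exact: Fp_continuous. Qed.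

(** By Jensen's inequality in t and in x, the square of this mean is at most
b - a times the mean square over the strip, which tends to 0 by [left_bc]. *)
Lemma damping_mean_average_cvg0 (T a b : R) : 0 < T -> 0 < a -> a < b -> b < T ->
  h^-1 * (\int[mu]_(t in `]a, b[) damping_mean h t) @[h --> 0^'+] --> 0.
Proof.
move=> T0 a0 ab bT.
pose N h := (\int[mu]_(t in `]0%R, T[) \int[mu]_(x in `](v * t)%R, (v * t + h)%R[) ((damping t x) ^+ 2)%:E)%E.
have CN : (h^-1%:E * N h)%E @[h --> 0^'+] --> 0%E by exact: hB.
have [finN CNf] := (fine_cvgP _ _).1 CN.
have ba : 0 < b - a by rewrite subr_gt0.
have bound : \forall h \near 0^'+, (h^-1 * (\int[mu]_(t in `]a, b[) damping_mean h t)) ^+ 2 <= (b - a) * fine (h^-1%:E * N h)%E.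
  near=> h.
  have h0 : 0 < h by near: h; exact: nbhs_right_gt.
  have hh : h < L by near: h; exact: nbhs_right_lt.
  have fN : (h^-1%:E * N h)%E \is a fin_num by near: h.
  have Ib : mu.-integrable `]a, b[ (EFin \o damping_mean h) by apply: continuous_integrable_itv; exact: damping_mean_continuous.
  rewrite -lee_fin [X in (_ <= X)%E]EFinM fineK//.
  rewrite exprMn EFinM.
  have J := sqr_integral_le ab Ib.
  apply: (@le_trans _ _ ((h^-1 ^+ 2)%:E * ((b - a)%:E * \int[mu]_(t in `]a, b[) ((damping_mean h t) ^+ 2)%:E))%E).
    by rewrite lee_pmul2l// ?lte_fin ?exprn_gt0 ?invr_gt0.
  have K : (h^-1%:E * \int[mu]_(t in `]a, b[) ((damping_mean h t) ^+ 2)%:E <= N h)%E.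
    have mb : measurable_fun `]a, b[ (fun t => ((damping_mean h t) ^+ 2)%:E).
      apply/measurable_EFinP; apply: measurable_funX; apply: measurable_funTS.
      by apply: continuous_measurable_fun; exact: damping_mean_continuous.
    have pb x : `]a, b[%classic x -> (0 <= ((damping_mean h x) ^+ 2)%:E)%E.
      by move=> _; rewrite lee_fin sqr_ge0.
    have ph : (0 <= (h^-1)%:E)%E by rewrite lee_fin invr_ge0 ltW.
    rewrite -ge0_integralZl//.
    apply: ge0_le_integral_nonmeas.
    - by move=> t _; rewrite -EFinM lee_fin mulr_ge0 ?sqr_ge0// invr_ge0 ltW.
    - by move=> t _; apply: integral_ge0 => x _; rewrite lee_fin sqr_ge0.
    - move=> t /=; rewrite !in_itv/= => /andP[t1 t2]; split; first by apply/andP; split; lra.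
      have t0 : 0 <= t by lra.
      have [I <-] := damping_integral t0 h0 hh.
      have hv' : v * t < v * t + h by rewrite ltrDl.
      have := sqr_integral_le hv' I; rewrite addrAC subrr add0r => H.
      by rewrite muleC -lee_pdivlMr ?invr_gt0// -?EFinV ?invrK// muleC.
  rewrite muleA -EFinM -[(h^-1 ^+ 2 * (b - a))%R]/(h^-1 * h^-1 * (b - a)).
  rewrite (_ : h^-1 * h^-1 * (b - a) = (b - a) * h^-1 * h^-1); last by ring.
  rewrite EFinM -muleA EFinM -muleA lee_pmul2l ?lte_fin//.
  by rewrite lee_pmul2l ?lte_fin ?invr_gt0.
apply/norm_cvg0P.
have S0 : (b - a) * fine (h^-1%:E * N h)%E @[h --> 0^'+] --> (b - a) * 0.
  by apply: cvgM CNf; exact: cvg_cst.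
have S : Num.sqrt ((b - a) * fine (h^-1%:E * N h)%E) @[h --> 0^'+] --> Num.sqrt ((b - a) * 0).
  by apply: continuous_cvg S0; exact: sqrt_continuous.
rewrite mulr0 sqrtr0 in S.
apply: (@squeeze_cvgr _ _ _ _ (fun=> 0)); [|exact: cvg_cst|exact: S].
near=> h; rewrite normr_ge0/= -sqrtr_sqr ler_wsqrtr//.
by near: h.
Unshelve. all: by end_near. Qed.

(** Divide [damping_mean] by h and integrate it over a < t < b. The integral in t
of Fp((1 + v) t + k) is a difference of values of the potential of Fp, which is
differentiable; so the limit as h tends to 0 can be computed, and it is the left
side of the claim for x = (1 + v) a and y = (1 + v) b, up to a factor. *)
Lemma potential_shift (x y : R) : 0 < x -> x < y ->
  (1 - eta) * (Fp y - Fp x) + (1 + eta) * (Fp (y + L_2) - Fp (x + L_2)) = 0.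
Proof.
move=> x0 xy; pose a := x / (1 + v); pose b := y / (1 + v).
have aE : (1 + v) * a = x by rewrite /a mulrC divfK// gt_eqF.
have bE : (1 + v) * b = y by rewrite /b mulrC divfK// gt_eqF.
have a0 : 0 < a by rewrite divr_gt0.
have ab : a < b by rewrite ltr_pM2r// invr_gt0.
have T0 : 0 < b + 1 by lra.
have bT : b < b + 1 by rewrite ltrDl.
have S := damping_mean_average_cvg0 T0 a0 ab bT.
have L20 : 0 < L_2 by rewrite /Defs.L_2 divr_gt0// mulr_gt0.
have g0 : 0 < gamma_v v by rewrite /gamma_v divr_gt0.
have GD (z : R) : 0 < z -> is_derive z 1 (potential Fp) (Fp z) by exact: potential_derive Fp_continuous.
have y0 : 0 < y by exact: lt_trans xy.
have [X1 _] := is_derive_right_quotients ltr01 (GD x x0).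
have [Y1 _] := is_derive_right_quotients ltr01 (GD y y0).
have [_ X2] := is_derive_right_quotients g0 (GD (x + L_2) (addr_gt0 x0 L20)).
have [_ Y2] := is_derive_right_quotients g0 (GD (y + L_2) (addr_gt0 y0 L20)).
have C := @cvg_comb R R 0^'+ _ _ _ _ _ ((1 + v) * (1 - eta)) ((1 - v) * (1 + eta)) (2 * (1 + v))^-1 _ _ _ _ Y1 X1 Y2 X2.
have {}C := C (ltac:(typeclasses eauto)).
suff E : (2 * (1 + v))^-1 * ((1 + v) * (1 - eta) * (1 * Fp y - 1 * Fp x) + (1 - v) * (1 + eta) * (gamma_v v * Fp (y + L_2) - gamma_v v * Fp (x + L_2))) = 0.
  have : 2 * 0 = 0 :> R by rewrite mulr0.
  rewrite -{1}E /gamma_v => <-; field; rewrite !gt_eqF//.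
apply: (cvg_unique (@Rhausdorff R) C).
apply: cvg_trans S; apply: near_eq_cvg; near=> h.
have h0 : 0 < h by near: h; exact: nbhs_right_gt.
have gh : gamma_v v * h < L_2.
  by rewrite mulrC -ltr_pdivlMr//; near: h; apply: nbhs_right_lt; rewrite divr_gt0.
have I k : mu.-integrable `]a, b[ (EFin \o (fun t => Fp ((1 + v) * t + k))).
  by apply: continuous_integrable_itv; exact: continuous_affine Fp_continuous.
rewrite /damping_mean integral_comb//; try exact: I.
rewrite !(integral_affine_potential Fp_continuous)//; [|lra..].
rewrite !aE !bE !addr0 !mul1r !addrA.
rewrite -!(addrA _ L_2); move: (potential Fp) L_2 => G l2; field.
by rewrite !gt_eqF.
Unshelve. all: by end_near. Qed.

(** The derivative of [potential_shift]. A signal that has run along the string and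
back has advanced by L_2 in the variable x + t, and has been multiplied by
- 1 / gamma_eta. *)
Lemma profile_shift (M : R) : 0 < eta -> eta != 1 -> {ae mu, forall s, 0 < s < M ->
  P (s + L_2) = - (P s / gamma_eta eta)}.
Proof.
move=> e0 e1; have ep : 0 < 1 + eta by lra.
have L20 : 0 < L_2 by rewrite /Defs.L_2 divr_gt0// mulr_gt0.
have lP := profile_loc_Int hL hv hH1 hC1.
have Is : Int (fun s => (P \_ `]0, M + L_2[) (1 * s + L_2)) by apply: Int_affine => //; exact: lP.
pose f s := (1 - eta) * (P \_ `]0, M + L_2[) s + (1 + eta) * (P \_ `]0, M + L_2[) (1 * s + L_2).
have If : Int f by apply: IntD; apply: IntZ => //; exact: lP.
have e1' : 1 - eta != 0 by rewrite subr_eq0 eq_sym.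
apply: ae_imp (@ae_eq0_integral R f 0 M If _).
    move=> s H /andP[s0 sM]; move: H; rewrite s0 sM => /(_ isT).
    rewrite /f !patchE !in_itvE !in_itv/= mul1r ltrD2r sM s0 addr_gt0//.
    rewrite ltr_wpDr ?(ltW L20)//= => H.
    have -> : P (s + L_2) = (1 + eta)^-1 * (- ((1 - eta) * P s)).
      by rewrite -[LHS](mulKf (lt0r_neq0 ep)); congr (_ * _); lra.
    by rewrite /gamma_eta; field; rewrite e1' gt_eqF.
  move=> a b a0 ab bM.
  rewrite RintegralD; [|exact: measurable_itv|apply: Int_subset => //; apply: IntZ; exact: lP|apply: Int_subset => //; exact: IntZ].
  rewrite !RintegralZl; [|exact: measurable_itv|exact: Int_subset|exact: measurable_itv|apply: Int_subset => //; exact: lP].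
  have H := potential_shift a0 ab.
  have -> : \int[mu]_(x in `]a, b[) (P \_ `]0, M + L_2[) x = Fp b - Fp a.
    rewrite potentialB; [|exact: lP|exact: ltW|exact: ltW].
    rewrite Rintegral_restr [RHS]Rintegral_restr; apply: eq_Rintegral => x _; rewrite !patchE !in_itvE !in_itv/=.
    by case: ifP => // /andP[? ?]; rewrite ifT//; apply/andP; split; lra.
  have -> : \int[mu]_(x in `]a, b[) (P \_ `]0, M + L_2[) (1 * x + L_2) = Fp (b + L_2) - Fp (a + L_2).
    rewrite potentialB; [|exact: lP|lra|lra].
    rewrite Rintegral_shift; last first.
      by apply: loc_IntS lP _; lra.
    rewrite Rintegral_restr [RHS]Rintegral_restr; apply: eq_Rintegral => x _; rewrite !patchE !in_itvE !in_itv/= mul1r.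
    by case: ifP => // /andP[? ?]; rewrite ifT//; apply/andP; split; lra.
  by lra.
Qed.

End LeftEnd.

(** * The energy *)

Section Energy.
Context {R : realType}.
Variables (L v eta : R).
Hypothesis hL : 0 < L.
Hypothesis hv : 0 <= v < 1.
Hypothesis heta : 0 < eta.
Hypothesis heta1 : eta != 1.
Local Notation mu := (@lebesgue_measure R).
Local Notation It := (It L v).
Local Notation L_2 := (L_2 L v).
Local Notation gv := (gamma_v v).
Local Notation ge := (gamma_eta eta).
Variables (phi phix phit : R -> R -> R).
Hypothesis hH1 : contH1 L v phi phix.
Hypothesis hC1 : contC1L2 L v phi phit.
Hypothesis hW : weak_wave L v phix phit.
Hypothesis hB : left_bc v eta phix phit.
Local Notation P := (profile L v phix phit).

Let v0 : 0 <= v. Proof. by case/andP: hv. Qed.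
Let v1 : 0 < 1 - v. Proof. by rewrite subr_gt0; case/andP: hv. Qed.
Let vp : 0 < 1 + v. Proof. by have := v0; lra. Qed.

Lemma gamma_v_ge1 : 1 <= gv.
Proof. by rewrite /gamma_v ler_pdivlMr ?mul1r//; have := v0; lra. Qed.

Lemma gamma_eta_gt1 : 1 < `|ge|.
Proof.
rewrite /gamma_eta normrM normfV; have e1' : 1 - eta != 0 by rewrite subr_eq0 eq_sym.
have e2 : `|1 + eta| = 1 + eta by rewrite ger0_norm//; have := heta; lra.
have h := heta; rewrite ltr_pdivlMr ?normr_gt0// mul1r e2.
by rewrite ltr_norml; apply/andP; split; lra.
Qed.

Lemma L_2_gt0 : 0 < L_2.
Proof. by rewrite /Defs.L_2 divr_gt0// mulr_gt0. Qed.

Lemma L_lt_L_2 : L < L_2.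
Proof. by rewrite /Defs.L_2 ltr_pdivlMr// mulrBr mulr1; have := mulr_ge0 (ltW hL) v0; have := hL; lra. Qed.

(** Over a period L_2 the weight exp(decay_rate * x) gains the factor gamma_eta^2
that P^2 loses by [profile_shift]. *)
Definition decay_rate : R := 2 * ln `|ge| / L_2.

Lemma decay_rate_ge0 : 0 <= decay_rate.
Proof. by rewrite divr_ge0 ?(ltW L_2_gt0)// mulr_ge0// ln_ge0// ltW// gamma_eta_gt1. Qed.

Lemma expR_rate : expR (decay_rate * L_2) = ge ^+ 2.
Proof.
rewrite /decay_rate divfK ?gt_eqF ?L_2_gt0// (_ : 2 * ln `|ge| = ln `|ge| + ln `|ge|); last by ring.
rewrite expRD lnK -?expr2.
  by rewrite real_normK ?num_real.
by rewrite posrE; exact: lt_trans gamma_eta_gt1.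
Qed.

Lemma expR_decay t : expR (- (decay_rate * ((1 + v) * t))) = decay L v eta t.
Proof.
rewrite /decay /decay_rate /Defs.L_2; congr (expR (- _)); field.
by rewrite !gt_eqF// mulr_gt0.
Qed.

Definition profile_sqr x := P x ^+ 2.
Definition weighted_sqr x := profile_sqr x * expR (decay_rate * x).

Lemma loc_Int_profile_sqr : loc_Int profile_sqr.
Proof.
move=> M; have /SqP[_] := Sq_profile hL hv hH1 hC1 M; apply: Int_ext => x.
by rewrite !patchE /profile_sqr; case: ifP => _ //; rewrite expr0n.
Qed.

Lemma loc_Int_weighted_sqr : loc_Int weighted_sqr.
Proof.
move=> M; pose g := (fun x => expR (decay_rate * x)) \_ `]0, M[.
have mg : measurable_fun setT g.
  apply: measurable_restr => //; apply: measurable_funTS.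
  apply: measurableT_comp; first exact: measurable_expR.
  exact: measurable_funM.
have gb x : `|g x| <= expR (decay_rate * `|M|).
  rewrite /g patchE in_itvE in_itv/=; case: ifP => [/andP[x0 xM]|_]; last by rewrite normr0 expR_ge0.
  rewrite ger0_norm ?expR_ge0// ler_expR ler_wpM2l ?decay_rate_ge0//.
  by rewrite (le_trans (ltW xM))// ler_norm.
apply: Int_ext (IntM_bounded (loc_Int_profile_sqr M) mg gb) => x.
by rewrite /g !patchE /weighted_sqr; case: ifP => _ //; rewrite mul0r.
Qed.

Lemma weighted_sqr_shift M : {ae mu, forall s, 0 < s < M -> weighted_sqr (s + L_2) = weighted_sqr s}.
Proof.
apply: ae_imp (profile_shift hL hv hH1 hC1 hW hB M heta heta1) => s H sM.
rewrite /weighted_sqr /profile_sqr H// mulrDr expRD expR_rate sqrrN expr_div_n.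
have g0 : ge != 0 by rewrite -normr_gt0; exact: lt_trans gamma_eta_gt1.
by field.
Qed.

Definition period_energy := \int[mu]_(x in `]0, L_2[) weighted_sqr x.

(** The integral of a periodic function over a period does not depend on its start. *)
Lemma period_energy_shift a : 0 <= a -> \int[mu]_(x in `]a, a + L_2[) weighted_sqr x = period_energy.
Proof.
move=> a0; have L20 := L_2_gt0; have lw := loc_Int_weighted_sqr.
rewrite /period_energy -!potentialB//; [|exact: ltW|lra].
have : potential weighted_sqr (a + L_2) - potential weighted_sqr L_2 = potential weighted_sqr a - potential weighted_sqr 0.
  rewrite !potentialB//; [|exact: ltW|lra].
  have -> : `]L_2, a + L_2[%classic = `]0 + L_2, a + L_2[%classic by rewrite add0r.
  rewrite Rintegral_shift; last by apply: loc_IntS => //; rewrite add0r ltW.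
  rewrite /Rintegral; congr fine; apply: ae_eq_integral => //.
  - by have /Int_restrE := loc_Int_shift lw (ltW L20) a => /(_ (measurable_itv _))/measurable_int.
  - by have := loc_Int_integrable a lw (lexx 0) => /measurable_int.
  - apply: ae_imp (weighted_sqr_shift a) => x H; rewrite /= in_itv/= => /H -> //.
have -> : potential weighted_sqr 0 = 0.
  rewrite /potential set_itv_ge ?Rintegral_set0//.
  by rewrite bnd_simp ltxx.
lra.
Qed.

(** On ]a, a + L_2[ the weight lies between its values at the end points, whose
quotient is gamma_eta^2. *)
Lemma profile_sqr_bounds a : 0 <= a ->
  period_energy / ge ^+ 2 * expR (- (decay_rate * a)) <= \int[mu]_(x in `]a, a + L_2[) profile_sqr x <= period_energy * expR (- (decay_rate * a)).
Proof.
move=> a0; have r0 := decay_rate_ge0; have IP := loc_Int_integrable (a + L_2) loc_Int_profile_sqr a0.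
have Iw := loc_Int_integrable (a + L_2) loc_Int_weighted_sqr a0.
have E k : \int[mu]_(x in `]a, a + L_2[) (k * weighted_sqr x) = k * period_energy by rewrite RintegralZl// period_energy_shift.
apply/andP; split.
- have -> : period_energy / ge ^+ 2 * expR (- (decay_rate * a)) = expR (- (decay_rate * (a + L_2))) * period_energy.
    by rewrite mulrDr opprD expRD [expR (- (decay_rate * L_2))]expRN expR_rate; ring.
  rewrite -E; apply: le_Rintegral => //; first exact: integrable_scale.
  move=> x; rewrite /= in_itv/= => /andP[x1 x2]; rewrite /weighted_sqr mulrCA -[leRHS]mulr1 -expRD.
  rewrite ler_wpM2l ?sqr_ge0// -expR0 ler_expR -mulrN -mulrDr mulr_ge0_le0//; lra.
- rewrite mulrC -E; apply: le_Rintegral => //; first exact: integrable_scale.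
  move=> x; rewrite /= in_itv/= => /andP[x1 x2]; rewrite /weighted_sqr mulrCA -[leLHS]mulr1 -expRD.
  rewrite ler_wpM2l ?sqr_ge0// -expR0 ler_expR -mulrN -mulrDr mulr_ge0//; lra.
Qed.

Definition profile_energy t : R := 4^-1 * (\int[mu]_(x in `](1 + v) * t, (1 + v) * t + L[) profile_sqr x +
   gv * \int[mu]_(x in `](1 + v) * t + L, (1 + v) * t + L_2[) profile_sqr x).

(** 2 (phi_t^2 + phi_x^2) is the sum of the squares of the right and the left
derivative. The first is P(x + t)^2. The second is gamma_v^2 P(z)^2 with
z = L + gamma_v (L + t - x), and z runs over the rest of the period while the
change of variables absorbs one factor gamma_v. *)
Lemma energy_profile t : 0 <= t -> energy L v phix phit t = (profile_energy t)%:E.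
Proof.
move=> t0; have a0 : 0 <= (1 + v) * t by rewrite mulr_ge0// ltW.
have g0 : 0 < gv by apply: lt_le_trans gamma_v_ge1.
pose a := (1 + v) * t.
have A1 := rightder_ae hL hv hH1 hC1 hW t0.
have A2 := leftder_ae hL hv hH1 hC1 hW t0.
have mI := measurable_It L v t.
pose f1 x := profile_sqr (x + t); pose f2 x := gv ^+ 2 * profile_sqr (L + gv * (L + t - x)).
have I1 : Int (f1 \_ (It t)).
  by apply: loc_IntS (loc_Int_shift loc_Int_profile_sqr t0) _; exact: mulr_ge0.
have m0 : - gv != 0 by rewrite oppr_eq0 gt_eqF.
have mE x : L + gv * (L + t - x) = - gv * x + (L + gv * (L + t)) by ring.
have e1 : L + gv * (L + t - (L + v * t)) = a + L by rewrite /gamma_v /a; field; rewrite gt_eqF.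
have e2 : L + gv * (L + t - v * t) = a + L_2 by rewrite /gamma_v /a /Defs.L_2; field; rewrite gt_eqF.
have in2 x : (v * t < x < L + v * t) = (a + L < L + gv * (L + t - x) < a + L_2).
  by rewrite -e1 -e2 !ltrD2l !ltr_pM2l// !ltrD2l !ltrN2 andbC.
have I2 : Int (f2 \_ (It t)).
  have J1 : Int (profile_sqr \_ `]a + L, a + L_2[).
    by apply: loc_IntS; [exact: loc_Int_profile_sqr|rewrite /a; have := hL; lra].
  have := IntZ (gv ^+ 2) (Int_affine (L + gv * (L + t)) m0 J1).
  by apply: Int_ext => x; rewrite !patchE -mE !in_itvE !in_itv/= -in2; case: ifP => // _; rewrite mulr0.
have J1 := (Int_restrE _ mI).1 I1; have J2 := (Int_restrE _ mI).1 I2.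
rewrite /energy.
have -> : (\int[mu]_(x in It t) (phit x t ^+ 2 + phix x t ^+ 2)%:E =
   \int[mu]_(x in It t) (2^-1 * (f1 x + f2 x))%:E)%E.
  apply: ae_eq_integral => //.
  - apply/measurable_EFinP; apply: measurable_funD; apply: measurable_funX.
    + by have := (Int_restrE _ mI).1 (L2_integrable (phit_L2 hC1 t0)) => /measurable_int/measurable_EFinP.
    + by have := (Int_restrE _ mI).1 (L2_integrable (phix_L2 hH1 t0)) => /measurable_int/measurable_EFinP.
  - by have := integrable_scale 2^-1 mI (integrable_add mI J1 J2) => /measurable_int.
  - apply: ae_imp (ae_and A1 A2) => x [H1 H2] Ix; congr EFin.
    have p := H1 Ix; have q := H2 Ix.
    have -> : phit x t = 2^-1 * (rightder phix phit t x + leftder phix phit t x) by rewrite /rightder /leftder; field.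
    have -> : phix x t = 2^-1 * (rightder phix phit t x - leftder phix phit t x) by rewrite /rightder /leftder; field.
    by rewrite p q /f1 /f2 /profile_sqr; field.
rewrite -[(\int[mu]_(x in It t) _)%E]fineK; last first.
  by apply: integrable_fin_num => //; exact: (integrable_scale (2^-1) mI (integrable_add mI J1 J2)).
rewrite -[fine _]/(\int[mu]_(x in It t) (2^-1 * (f1 x + f2 x))) -EFinM; congr EFin.
rewrite RintegralZl//; last exact: integrable_add.
rewrite RintegralD// /profile_energy -/a.
have -> : \int[mu]_(x in It t) f1 x = \int[mu]_(x in `]a, a + L[) profile_sqr x.
  have -> : a = v * t + t by rewrite /a; ring.
  rewrite -addrA (addrC t) addrA (addrC (v * t) L) Rintegral_shift//.
  by apply: loc_IntS; [exact: loc_Int_profile_sqr|rewrite addr_ge0// mulr_ge0].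
have -> : \int[mu]_(x in It t) f2 x = gv * \int[mu]_(x in `]a + L, a + L_2[) profile_sqr x.
  rewrite Rintegral_restr [X in gv * X]Rintegral_restr (@integral_affine _ (- gv) (L + gv * (L + t)) (profile_sqr \_ `]a + L, a + L_2[))//; last first.
    by apply: loc_IntS; [exact: loc_Int_profile_sqr|rewrite /a; have := hL; lra].
  rewrite normrN gtr0_norm// mulrA -expr2 -RintegralZl//.
    by apply: eq_Rintegral => x _; rewrite !patchE -mE !in_itvE !in_itv/= -in2; case: ifP => // _; rewrite mulr0.
  apply: Int_affine => //; apply: loc_IntS; [exact: loc_Int_profile_sqr|rewrite /a; have := hL; lra].
by field.
Qed.

(** As gamma_v >= 1, the profile energy lies between 1 / 4 and gamma_v / 4 times
the integral of P^2 over a full period. *)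
Lemma profile_energy_bounds t : 0 <= t ->
  4^-1 * (period_energy / ge ^+ 2) * decay L v eta t <= profile_energy t <= 4^-1 * (gv * period_energy) * decay L v eta t.
Proof.
move=> t0; have a0 : 0 <= (1 + v) * t by rewrite mulr_ge0// ltW.
have := profile_sqr_bounds a0; rewrite expR_decay => /andP[h1 h2].
pose a := (1 + v) * t; rewrite /profile_energy -/a.
have L1 := L_lt_L_2; have L0 := hL.
have lP := loc_Int_profile_sqr.
have S : \int[mu]_(x in `]a, a + L_2[) profile_sqr x = \int[mu]_(x in `]a, a + L[) profile_sqr x + \int[mu]_(x in `]a + L, a + L_2[) profile_sqr x.
  by rewrite -!potentialB//; try (rewrite /a; lra); ring.
have i1 : 0 <= \int[mu]_(x in `]a, a + L[) profile_sqr x by apply: Rintegral_ge0 => x _; exact: sqr_ge0.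
have i2 : 0 <= \int[mu]_(x in `]a + L, a + L_2[) profile_sqr x by apply: Rintegral_ge0 => x _; exact: sqr_ge0.
rewrite -/a S in h1 h2.
have g1 := gamma_v_ge1; have g0 : 0 < gv by apply: lt_le_trans gamma_v_ge1.
set x1 := \int[mu]_(x in `]a, a + L[) profile_sqr x in i1 h1 h2 *.
set x2 := \int[mu]_(x in `]a + L, a + L_2[) profile_sqr x in i2 h1 h2 *.
have k1 : x2 <= gv * x2 by rewrite ler_peMl.
have k2 : x1 <= gv * x1 by rewrite ler_peMl.
apply/andP; split; rewrite -mulrA ler_pM2l ?invr_gt0//.
  lra.
apply: (@le_trans _ _ (gv * x1 + gv * x2)); first by rewrite lerD2r.
by rewrite -mulrDr -[gv * period_energy * _]mulrA ler_pM2l.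
Qed.

(** On ]0, L[ the profile is the right derivative at time 0. On ]L, L_2[ it is
given by the left derivative at time 0, reflected at the right end. *)
Lemma profile_initial (phi0 dphi0 phi1 : R -> R) : H1_right0 0 L phi0 dphi0 ->
  (forall x, It 0 x -> phi x 0 = phi0 x) -> {ae mu, forall x, It 0 x -> phit x 0 = phi1 x} ->
  {ae mu, forall s, 0 < s < L_2 -> P s = dphi0_ext L v dphi0 s + phi1_ext L v phi1 s}.
Proof.
move=> [h0 c0 _] e0 e1.
have I0 x : It 0 x = (0 < x < L) by rewrite in_It mulr0 addr0.
have A : {ae mu, forall x, 0 < x < L -> phix x 0 = dphi0 x}.
  have ID : Int (dphi0 \_ `]0, L[) by case: h0 => _ h _; exact: L2_integrable.
  have IX : Int ((phix ^~ 0) \_ `]0, L[).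
    have := L2_integrable (phix_L2 hH1 (lexx 0)); apply: Int_ext => x; rewrite !patchE.
    by rewrite /Defs.It mulr0 addr0.
  apply: ae_imp (@ae_eq0_integral R (fun x => ((phix ^~ 0) \_ `]0, L[) x - (dphi0 \_ `]0, L[) x) 0 L (IntB IX ID) _).
    by move=> x H xI; move: H; rewrite xI !patchE !in_itvE !in_itv/= xI => /(_ isT)/eqP; rewrite subr_eq0 => /eqP.
  move=> a b a0 ab bL; rewrite RintegralB; [|exact: measurable_itv|exact: Int_subset|exact: Int_subset].
  have E (f : R -> R) : \int[mu]_(x in `]a, b[) (f \_ `]0, L[) x = \int[mu]_(x in `]a, b[) f x.
    apply: eq_Rintegral => x; rewrite inE/= in_itv/= => /andP[? ?]; rewrite patchE mem_set//= in_itv/=.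
    by apply/andP; split; lra.
  rewrite !E -(@H1_FTC _ _ _ _ _ h0 c0 a b)//; [|exact: ltW|exact: ltW].
  rewrite -(phi_FTC hH1)//; [|lra|lra].
  by rewrite !e0 ?subrr// I0; apply/andP; split; lra.
have A1 := rightder_ae hL hv hH1 hC1 hW (lexx 0).
have A2 := leftder_ae hL hv hH1 hC1 hW (lexx 0).
have g0 : 0 < gv by apply: lt_le_trans gamma_v_ge1.
have B1 : {ae mu, forall s, 0 < s < L -> P s = dphi0 s + phi1 s}.
  apply: ae_imp (ae_and A (ae_and e1 A1)) => x [H [H1 H2]] xI.
  have xI' : It 0 x by rewrite I0.
  by have := H2 xI'; rewrite addr0 => <-; rewrite /rightder H// H1// addrC.
have B2 : {ae mu, forall x, 0 < x < L -> P (L + gv * (L - x)) = gv^-1 * dphi0 x - gv^-1 * phi1 x}.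
  apply: ae_imp (ae_and A (ae_and e1 A2)) => x [H [H1 H2]] xI.
  have xI' : It 0 x by rewrite I0.
  have := H2 xI'; rewrite addr0 /leftder H// H1// => E.
  have -> : P (L + gv * (L - x)) = - gv^-1 * (phi1 x - dphi0 x) by rewrite E; field; rewrite gt_eqF.
  ring.
have k0 : - gv^-1 != 0 by rewrite oppr_eq0 invr_eq0 gt_eqF.
have B3 := ae_affine (2 * L / (1 + v)) k0 B2.
have BL : {ae mu, forall s, s != L}.
  exists [set L]; split => //; first exact: lebesgue_measure_set1.
  by move=> s /= /negP; rewrite negbK => /eqP.
apply: ae_imp (ae_and B1 (ae_and B3 BL)) => s [H1 [H2 H3]] /andP[s0 sL].
rewrite /dphi0_ext /phi1_ext; case: ltP => [h|h]; first by apply: H1; rewrite s0.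
have Ls : L < s by rewrite lt_neqAle eq_sym H3.
have E : - gv^-1 * s + 2 * L / (1 + v) = reflect_pt L v s.
  by rewrite /reflect_pt; ring.
have F : s = L + gv * (L - reflect_pt L v s).
  rewrite /reflect_pt /gamma_v; field; rewrite !gt_eqF//.
move: H2; rewrite E -F; apply.
have L2E : L_2 = L + gv * L by rewrite /Defs.L_2 /gamma_v; field; rewrite gt_eqF.
apply/andP; split.
  have : gv * (L - reflect_pt L v s) < gv * L by move: F L2E sL; lra.
  by rewrite ltr_pM2l//; lra.
have : 0 < gv * (L - reflect_pt L v s) by move: F Ls; lra.
by rewrite pmulr_rgt0// subr_gt0.
Qed.

End Energy.

(** * Parseval's identity for shifted Fourier modes *)

Import HBSimple HBNNSimple.

Section Fourier.
Context {R : realType}.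
Variables (l freq_shift : R).
Hypothesis l0 : 0 < l.
Local Notation mu := (@lebesgue_measure R).
Local Notation D := (`]0, l[%classic : set R).
Local Notation fpair := ((R -> R) * (R -> R))%type.
Implicit Types (f g h : R -> R) (F G : fpair).

Definition omega1 : R := 2 * pi / l.
(** The modes are exp(i k x) on ]0, l[ with these wave numbers k. The shift is 1/2
for eta < 1, where P changes its sign over a period, and 0 for eta > 1. *)
Definition wavenum (n : int) : R := omega1 * (n%:~R + freq_shift).

Lemma eq_ler (a b : R) : a = b -> a <= b. Proof. by move=> ->. Qed.

Lemma omega1_gt0 : 0 < omega1.
Proof. by rewrite divr_gt0// mulr_gt0// pi_gt0. Qed.

Lemma cos_sin_period (j : int) : cos (omega1 * j%:~R * l) = 1 /\ sin (omega1 * j%:~R * l) = 0.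
Proof.
have nat_case (n : nat) : cos (omega1 * n%:R * l) = 1 /\ sin (omega1 * n%:R * l) = 0.
  have -> : omega1 * n%:R * l = 0 + pi *+ 2 *+ n.
    by rewrite /omega1 add0r -[pi *+ 2]mulr_natr -[_ *+ n]mulr_natr; field; rewrite gt_eqF.
  by rewrite (periodicn (@cosD2pi R)) (periodicn (@sinD2pi R)) cos0 sin0.
case: j => n; first exact: nat_case.
rewrite NegzE mulrNz mulrN mulNr cosN sinN.
by have [-> ->] := nat_case n.+1; rewrite oppr0.
Qed.

Lemma is_derive_cosM (k x : R) : is_derive x 1 (fun x => cos (k * x)) (- (k * sin (k * x))).
Proof.
have := @is_derive_shift R cos (fun x => - sin x) k 0 x; rewrite addr0 mulrN.
have -> : (fun y => cos (k * y + 0)) = (fun y => cos (k * y)) by apply/funext => y; rewrite addr0.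
apply; exact: is_derive_cos.
Qed.

Lemma is_derive_sinM (k x : R) : is_derive x 1 (fun x => sin (k * x)) (k * cos (k * x)).
Proof.
have := @is_derive_shift R sin cos k 0 x; rewrite addr0.
have -> : (fun y => sin (k * y + 0)) = (fun y => sin (k * y)) by apply/funext => y; rewrite addr0.
apply; exact: is_derive_sin.
Qed.

Lemma continuous_cosM (k : R) : continuous (fun x => cos (k * x)).
Proof. by move=> x; have := @continuous_affine R cos k 0 (@continuous_cos R) x; under eq_fun do rewrite addr0. Qed.
Lemma continuous_sinM (k : R) : continuous (fun x => sin (k * x)).
Proof. by move=> x; have := @continuous_affine R sin k 0 (@continuous_sin R) x; under eq_fun do rewrite addr0. Qed.

Lemma integral_cos (j : int) : \int[mu]_(x in D) cos (omega1 * j%:~R * x) = if j == 0 then l else 0.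
Proof.
have [->|j0] := eqVneq j 0.
  under eq_Rintegral do rewrite mulr0 mul0r cos0.
  by rewrite Rintegral_cst// /= lebesgue_measure_itv/= lte_fin l0 mul1r/= subr0.
pose k := omega1 * j%:~R; have k0 : k != 0 by rewrite mulf_neq0 ?intr_eq0// gt_eqF// omega1_gt0.
have cF : continuous (fun x => k^-1 * sin (k * x)).
  by move=> x; apply: cvgM; [exact: cvg_cst|exact: continuous_sinM].
have dF (t : R) : 0 < t < l -> is_derive t 1 (fun x => k^-1 * sin (k * x)) (cos (k * t)).
  move=> _; have := is_derive_mul (is_derive_cst (k^-1 : R) t 1) (is_derive_sinM k t).
  by rewrite mul0r add0r mulKf.
rewrite (FTC_inside l0 (continuous_subspaceT cF) (continuous_subspaceT (@continuous_cosM k)) dF).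
by have [_ E] := cos_sin_period j; rewrite -/k in E; rewrite E (mulr0 k) sin0 !mulr0 subrr.
Qed.

Lemma integral_sin (j : int) : \int[mu]_(x in D) sin (omega1 * j%:~R * x) = 0.
Proof.
have [->|j0] := eqVneq j 0.
  under eq_Rintegral do rewrite mulr0 mul0r sin0.
  by rewrite Rintegral_cst// mul0r.
pose k := omega1 * j%:~R; have k0 : k != 0 by rewrite mulf_neq0 ?intr_eq0// gt_eqF// omega1_gt0.
have cF : continuous (fun x => - k^-1 * cos (k * x)).
  by move=> x; apply: cvgM; [exact: cvg_cst|exact: continuous_cosM].
have dF (t : R) : 0 < t < l -> is_derive t 1 (fun x => - k^-1 * cos (k * x)) (sin (k * t)).
  move=> _; have := is_derive_mul (is_derive_cst (- k^-1 : R) t 1) (is_derive_cosM k t).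
  by rewrite mul0r add0r mulrNN mulKf.
rewrite (FTC_inside l0 (continuous_subspaceT cF) (continuous_subspaceT (@continuous_sinM k)) dF).
by have [E _] := cos_sin_period j; rewrite -/k in E; rewrite E (mulr0 k) cos0 subrr.
Qed.

(** A complex-valued function in L^2(D), as the pair of its real and imaginary parts. *)
Definition L2pair F := [/\ Sq F.1, Sq F.2, forall x, ~ D x -> F.1 x = 0 & forall x, ~ D x -> F.2 x = 0].

(** Multiplication by exp(i k x). *)
Definition phase_mul (k : R) F : fpair :=
  (fun x => cos (k * x) * F.1 x - sin (k * x) * F.2 x,
   fun x => sin (k * x) * F.1 x + cos (k * x) * F.2 x).
(** Multiplication by the imaginary unit. *)
Definition imul F : fpair := (fun x => - F.2 x, F.1).
Definition lincomb (a : R) F (b : R) G : fpair :=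
  (fun x => a * F.1 x + b * G.1 x, fun x => a * F.2 x + b * G.2 x).
Definition real_mul h F : fpair := (fun x => h x * F.1 x, fun x => h x * F.2 x).

(** Real and imaginary part of the n-th Fourier coefficient, without a factor 1 / l. *)
Definition coef_re n F : R := \int[mu]_x (phase_mul (- wavenum n) F).1 x.
Definition coef_im n F : R := \int[mu]_x (phase_mul (- wavenum n) F).2 x.
Definition norm2 F : R := \int[mu]_x (F.1 x ^+ 2 + F.2 x ^+ 2).

Lemma SqM_bounded f g M : Sq f -> measurable_fun setT g -> (forall x, `|g x| <= M) ->
  Sq (fun x => g x * f x).
Proof.
move=> Sf mg gM; have M0 : 0 <= M by apply: le_trans (gM 0).
apply: Sq_le (SqZ M Sf); first by apply: measurable_funM => //; exact: Sq_meas.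
by move=> x; rewrite !normrM (ger0_norm M0) ler_wpM2r.
Qed.

Lemma measurable_cosM (k : R) : measurable_fun setT (fun x => cos (k * x)).
Proof. exact: continuous_measurable_fun (@continuous_cosM k). Qed.
Lemma measurable_sinM (k : R) : measurable_fun setT (fun x => sin (k * x)).
Proof. exact: continuous_measurable_fun (@continuous_sinM k). Qed.

Lemma L2pair_phase k F : L2pair F -> L2pair (phase_mul k F).
Proof.
case=> S1 S2 Z1 Z2; split => /=.
- by apply: SqB; apply: (SqM_bounded (M := 1)) => //; [exact: measurable_cosM|move=> x; exact: cos_max|exact: measurable_sinM|move=> x; exact: sin_max].
- by apply: SqD; apply: (SqM_bounded (M := 1)) => //; [exact: measurable_sinM|move=> x; exact: sin_max|exact: measurable_cosM|move=> x; exact: cos_max].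
- by move=> x xD; rewrite Z1// Z2// !mulr0 subrr.
- by move=> x xD; rewrite Z1// Z2// !mulr0 addr0.
Qed.

Lemma L2pair_imul F : L2pair F -> L2pair (imul F).
Proof.
by case=> S1 S2 Z1 Z2; split => //=; [exact: SqN|move=> x xD; rewrite Z2// oppr0].
Qed.

Lemma L2pair_lincomb a F b G : L2pair F -> L2pair G -> L2pair (lincomb a F b G).
Proof.
case=> S1 S2 Z1 Z2 [T1 T2 Y1 Y2]; split => /=.
- by apply: SqD; exact: SqZ.
- by apply: SqD; exact: SqZ.
- by move=> x xD; rewrite Z1// Y1// !mulr0 addr0.
- by move=> x xD; rewrite Z2// Y2// !mulr0 addr0.
Qed.

Lemma L2pair_Int F : L2pair F -> Int F.1 /\ Int F.2.
Proof.
case=> S1 S2 Z1 Z2; split; apply: (@Sq_Int _ 0 l) => // x xn; [apply: Z1|apply: Z2] => h;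
by apply: xn; exact: subset_itv_oo_cc h.
Qed.

Lemma Rintegral_lincomb f g a b : Int f -> Int g -> \int[mu]_x (a * f x + b * g x) = a * \int[mu]_x f x + b * \int[mu]_x g x.
Proof.
move=> If Ig; rewrite RintegralD//; [|exact: IntZ|exact: IntZ].
by rewrite !RintegralZl.
Qed.

Lemma coef_re_lincomb n a F b G : L2pair F -> L2pair G -> coef_re n (lincomb a F b G) = a * coef_re n F + b * coef_re n G.
Proof.
move=> /(L2pair_phase (- wavenum n))/L2pair_Int[I1 _] /(L2pair_phase (- wavenum n))/L2pair_Int[J1 _].
by rewrite -Rintegral_lincomb//; apply: eq_Rintegral => x _ /=; ring.
Qed.

Lemma coef_im_lincomb n a F b G : L2pair F -> L2pair G -> coef_im n (lincomb a F b G) = a * coef_im n F + b * coef_im n G.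
Proof.
move=> /(L2pair_phase (- wavenum n))/L2pair_Int[_ I1] /(L2pair_phase (- wavenum n))/L2pair_Int[_ J1].
by rewrite -Rintegral_lincomb//; apply: eq_Rintegral => x _ /=; ring.
Qed.

Lemma coef_re_imul n F : L2pair F -> coef_re n (imul F) = - coef_im n F.
Proof.
move=> /(L2pair_phase (- wavenum n))/L2pair_Int[_ I1]; rewrite -mulN1r -RintegralZl//.
by apply: eq_Rintegral => x _ /=; ring.
Qed.

Lemma coef_im_imul n F : coef_im n (imul F) = coef_re n F.
Proof. by apply: eq_Rintegral => x _ /=; ring. Qed.

Lemma norm2_imul F : norm2 (imul F) = norm2 F.
Proof. by apply: eq_Rintegral => x _ /=; ring. Qed.

Lemma phase_mulD k k' F : phase_mul k (phase_mul k' F) = phase_mul (k + k') F.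
Proof.
by congr (_, _); apply/funext => x /=; rewrite mulrDl cosD sinD; ring.
Qed.

Lemma norm2_phase k F : norm2 (phase_mul k F) = norm2 F.
Proof.
apply: eq_Rintegral => x _ /=; have := cos2Dsin2 (k * x) => E.
transitivity ((cos (k * x) ^+ 2 + sin (k * x) ^+ 2) * (F.1 x ^+ 2 + F.2 x ^+ 2)); first by ring.
by rewrite E mul1r.
Qed.

Lemma wavenumB n b : - wavenum n + omega1 * b%:~R = - wavenum (n - b).
Proof. by rewrite /wavenum intrB; ring. Qed.

Lemma coef_re_phase n b F : coef_re n (phase_mul (omega1 * b%:~R) F) = coef_re (n - b) F.
Proof. by rewrite /coef_re phase_mulD wavenumB. Qed.
Lemma coef_im_phase n b F : coef_im n (phase_mul (omega1 * b%:~R) F) = coef_im (n - b) F.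
Proof. by rewrite /coef_im phase_mulD wavenumB. Qed.

(** The gap in Bessel's inequality for the modes in A. *)
Definition defect (A : seq int) F : R := norm2 F - l^-1 * \sum_(n <- A) (coef_re n F ^+ 2 + coef_im n F ^+ 2).

Lemma norm2_parallelogram a F b G : L2pair F -> L2pair G ->
  norm2 (lincomb a F b G) + norm2 (lincomb a F (- b) G) = 2 * a ^+ 2 * norm2 F + 2 * b ^+ 2 * norm2 G.
Proof.
have IN H : L2pair H -> Int (fun x => H.1 x ^+ 2 + H.2 x ^+ 2).
  by case=> /SqP[_ S1] /SqP[_ S2] _ _; exact: IntD.
move=> oF oG; have I1 := IN _ oF; have I2 := IN _ oG.
rewrite -Rintegral_lincomb// /norm2 -RintegralD//; try by apply: IN; exact: L2pair_lincomb.
by apply: eq_Rintegral => x _ /=; ring.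
Qed.

Lemma defect_parallelogram A a F b G : L2pair F -> L2pair G ->
  defect A (lincomb a F b G) + defect A (lincomb a F (- b) G) = 2 * a ^+ 2 * defect A F + 2 * b ^+ 2 * defect A G.
Proof.
move=> oF oG; rewrite /defect.
have -> : \sum_(n <- A) (coef_re n (lincomb a F b G) ^+ 2 + coef_im n (lincomb a F b G) ^+ 2) =
   2 * a ^+ 2 * \sum_(n <- A) (coef_re n F ^+ 2 + coef_im n F ^+ 2) +
   2 * b ^+ 2 * \sum_(n <- A) (coef_re n G ^+ 2 + coef_im n G ^+ 2) -
   \sum_(n <- A) (coef_re n (lincomb a F (- b) G) ^+ 2 + coef_im n (lincomb a F (- b) G) ^+ 2).
  rewrite !mulr_sumr -big_split/= -sumrB; apply: eq_bigr => n _.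
  rewrite !coef_re_lincomb// !coef_im_lincomb//; ring.
have := norm2_parallelogram a b oF oG; lra.
Qed.

Definition mode n : fpair := phase_mul (wavenum n) (\1_D, fun=> 0).

Lemma L2pair_indic : L2pair (\1_D, fun=> 0).
Proof.
split => //=.
- apply: (@Sq_bounded _ 0 l 1) => //; first by move=> x; exact: indic_bounded.
  by move=> x xn; rewrite indicE memNset// => h; apply: xn; exact: subset_itv_oo_cc h.
- exact: Sq0.
- by move=> x xD; rewrite indicE memNset.
Qed.

Lemma L2pair_mode n : L2pair (mode n). Proof. exact: L2pair_phase L2pair_indic. Qed.

Lemma coef_re_mode m n : coef_re m (mode n) = if m == n then l else 0.
Proof.
rewrite /coef_re /mode phase_mulD.
have -> : - wavenum m + wavenum n = omega1 * (n - m)%:~R by rewrite /wavenum intrB; ring.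
have -> : (m == n) = (n - m == 0) by rewrite subr_eq0 eq_sym.
rewrite -integral_cos [RHS]Rintegral_restr; apply: eq_Rintegral => x _ /=; rewrite patchE indicE mulr0 subr0.
by case: ifP => _; rewrite ?mulr1 ?mulr0.
Qed.

Lemma coef_im_mode m n : coef_im m (mode n) = 0.
Proof.
rewrite /coef_im /mode phase_mulD.
have -> : - wavenum m + wavenum n = omega1 * (n - m)%:~R by rewrite /wavenum intrB; ring.
rewrite -[RHS](integral_sin (n - m)) [RHS]Rintegral_restr; apply: eq_Rintegral => x _ /=; rewrite patchE indicE mulr0 addr0.
by case: ifP => _; rewrite ?mulr1 ?mulr0.
Qed.

Definition mode_proj n F := lincomb (coef_re n F) (mode n) (coef_im n F) (imul (mode n)).
Definition residual n F := lincomb 1 F (- l^-1) (mode_proj n F).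

Lemma L2pair_proj n F : L2pair (mode_proj n F).
Proof. by apply: L2pair_lincomb; [|apply: L2pair_imul]; exact: L2pair_mode. Qed.
Lemma L2pair_residual n F : L2pair F -> L2pair (residual n F).
Proof. by move=> oF; apply: L2pair_lincomb => //; exact: L2pair_proj. Qed.

Lemma coef_re_residual m n F : L2pair F -> m != n -> coef_re m (residual n F) = coef_re m F.
Proof.
move=> oF mn; have ou := L2pair_mode n; have oj := L2pair_imul ou.
rewrite /residual /mode_proj coef_re_lincomb//; last exact: L2pair_proj.
by rewrite coef_re_lincomb// coef_re_imul// coef_re_mode (negbTE mn) coef_im_mode !(mulr0, oppr0, addr0) mul1r.
Qed.

Lemma coef_im_residual m n F : L2pair F -> m != n -> coef_im m (residual n F) = coef_im m F.
Proof.
move=> oF mn; have ou := L2pair_mode n; have oj := L2pair_imul ou.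
rewrite /residual /mode_proj coef_im_lincomb//; last exact: L2pair_proj.
by rewrite coef_im_lincomb// coef_im_imul coef_re_mode (negbTE mn) coef_im_mode !(mulr0, oppr0, addr0) mul1r.
Qed.

(** Pythagoras, as the modes have squared norm l. *)
Lemma norm2_residual n F : L2pair F -> norm2 (residual n F) = norm2 F - l^-1 * (coef_re n F ^+ 2 + coef_im n F ^+ 2).
Proof.
move=> oF; set C := coef_re n F; set S := coef_im n F.
have /L2pair_Int[I1 I2] := L2pair_phase (- wavenum n) oF.
have I0 : Int (fun x => F.1 x ^+ 2 + F.2 x ^+ 2) by case: oF => /SqP[_ ?] /SqP[_ ?] _ _; exact: IntD.
have ID : Int (\1_D : R -> R) by have [] := L2pair_Int L2pair_indic.
have D1 : \int[mu]_x (\1_D x : R) = l.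
  by rewrite /Rintegral integral_indic// setIT /= lebesgue_measure_itv/= lte_fin l0/= subr0.
have E1 := Rintegral_lincomb C S I1 I2; rewrite -/(coef_re n F) -/(coef_im n F) -/C -/S in E1.
have -> : norm2 F - l^-1 * (C ^+ 2 + S ^+ 2) = (1 * norm2 F + (- 2 * l^-1) *
  \int[mu]_x (C * (phase_mul (- wavenum n) F).1 x + S * (phase_mul (- wavenum n) F).2 x)) + l^-1 ^+ 2 * (C ^+ 2 + S ^+ 2) * \int[mu]_x (\1_D x : R).
  by rewrite E1 D1; field; rewrite gt_eqF.
rewrite -Rintegral_lincomb//; last by apply: IntD; exact: IntZ.
rewrite -RintegralZl// -RintegralD//; last first.
- exact: IntZ.
- by apply: IntD; [exact: IntZ|apply: IntZ; apply: IntD; exact: IntZ].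
apply: eq_Rintegral => x _ /=; rewrite [- wavenum n * x]mulNr cosN sinN indicE -/C -/S.
have E := cos2Dsin2 (wavenum n * x).
have [xD|/negP xD] := boolP (x \in D); last first.
  have xD' : ~ D x by move=> h; apply: xD; rewrite inE.
  by case: oF => _ _ -> // -> //; rewrite !mulr0 /=; ring.
rewrite /=.
have E2 : cos (wavenum n * x) * cos (wavenum n * x) = 1 - sin (wavenum n * x) * sin (wavenum n * x).
  by rewrite -!expr2 -E; ring.
set c := cos _ in E2 *; set s := sin _ in E2 *.
transitivity (F.1 x ^+ 2 + F.2 x ^+ 2 - 2 * l^-1 * (C * (c * F.1 x - (- s) * F.2 x) + S * ((- s) * F.1 x + c * F.2 x)) +
  l^-1 ^+ 2 * (C ^+ 2 + S ^+ 2) * (c * c + s * s)); first by ring.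
by rewrite E2; ring.
Qed.

(** Remove the modes of A one after the other; by orthogonality the residual keeps
its other coefficients. *)
Lemma bessel A F : uniq A -> L2pair F -> 0 <= defect A F.
Proof.
elim: A F => [|n A IH] F /=.
  move=> _ _; rewrite /defect big_nil mulr0 subr0; apply: Rintegral_ge0 => x _.
  by rewrite addr_ge0// sqr_ge0.
move=> /andP[nA uA] oF; have := IH _ uA (L2pair_residual n oF).
rewrite /defect norm2_residual//.
have -> : \sum_(m <- A) (coef_re m (residual n F) ^+ 2 + coef_im m (residual n F) ^+ 2) =
          \sum_(m <- A) (coef_re m F ^+ 2 + coef_im m F ^+ 2).
  rewrite big_seq [RHS]big_seq; apply: eq_bigr => m mA.
  have mn : m != n by apply: contraNneq nA => <-.
  by rewrite coef_re_residual// coef_im_residual.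
by rewrite big_cons [in X in _ -> X]mulrDr opprD addrA.
Qed.

(** The parallelogram law, with one of its terms dropped by Bessel's inequality. *)
Lemma defect_lincomb_le A a F b G : uniq A -> L2pair F -> L2pair G ->
  defect A (lincomb a F b G) <= 2 * a ^+ 2 * defect A F + 2 * b ^+ 2 * defect A G.
Proof.
by move=> uA oF oG; rewrite -defect_parallelogram// lerDl bessel//; exact: L2pair_lincomb.
Qed.

Lemma defect_le_norm2 A F : defect A F <= norm2 F.
Proof.
rewrite /defect lerBlDr lerDl mulr_ge0 ?invr_ge0 ?(ltW l0)//.
by apply: sumr_ge0 => n _; rewrite addr_ge0// sqr_ge0.
Qed.

Lemma defect_mono A B F : uniq A -> uniq B -> {subset A <= B} -> defect B F <= defect A F.
Proof.
move=> uA uB AB; rewrite /defect lerD2l lerN2 ler_pM2l ?invr_gt0//.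
have pos n : 0 <= coef_re n F ^+ 2 + coef_im n F ^+ 2 by rewrite addr_ge0// sqr_ge0.
have H : perm_eq B (A ++ [seq n <- B | n \notin A]).
  apply: uniq_perm => //.
    rewrite cat_uniq uA filter_uniq// andbT /=; apply/hasPn => n.
    by rewrite mem_filter => /andP[].
  move=> n; rewrite mem_cat mem_filter; case: (boolP (n \in A)) => //= nA.
  by rewrite AB.
by rewrite (perm_big _ H) big_cat/= lerDl; apply: sumr_ge0.
Qed.

(** Parseval's identity for F, in the form that its defect can be made arbitrarily
small. Complete functions form a closed subspace that is stable under
multiplication by exp(i omega1 b x) for integers b. *)
Definition complete F := L2pair F /\ forall e, 0 < e -> exists2 A, uniq A & defect A F <= e.

Lemma complete_lincomb a F b G : complete F -> complete G -> complete (lincomb a F b G).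
Proof.
move=> [oF hF] [oG hG]; split; first exact: L2pair_lincomb.
move=> e e0; pose k := 4 * (a ^+ 2 + b ^+ 2 + 1).
have k0 : 0 < k by rewrite mulr_gt0// ltr_wpDl// addr_ge0// sqr_ge0.
have [A uA dA] := hF _ (divr_gt0 e0 k0); have [B uB dB] := hG _ (divr_gt0 e0 k0).
exists (undup (A ++ B)); first exact: undup_uniq.
have uU := undup_uniq (A ++ B).
apply: le_trans (defect_lincomb_le _ _ uU oF oG) _.
have d1 : defect (undup (A ++ B)) F <= e / k.
  by apply: le_trans dA; apply: defect_mono => // n nA; rewrite mem_undup mem_cat nA.
have d2 : defect (undup (A ++ B)) G <= e / k.
  by apply: le_trans dB; apply: defect_mono => // n nA; rewrite mem_undup mem_cat nA orbT.
apply: (@le_trans _ _ (2 * a ^+ 2 * (e / k) + 2 * b ^+ 2 * (e / k))).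
  by apply: lerD; rewrite ler_wpM2l// mulr_ge0// sqr_ge0.
rewrite -mulrDl mulrA ler_pdivrMr// mulrC ler_pM2l// /k.
by have := sqr_ge0 a; have := sqr_ge0 b; lra.
Qed.

Lemma complete_imul F : complete F -> complete (imul F).
Proof.
move=> [oF hF]; split; first exact: L2pair_imul.
move=> e /hF[A uA dA]; exists A => //; apply: le_trans dA.
rewrite /defect norm2_imul; apply: eq_ler; congr (_ - _ * _); apply: eq_bigr => n _.
by rewrite coef_re_imul// coef_im_imul sqrrN addrC.
Qed.

(** Multiplication by exp(i omega1 b x) shifts the indices of the coefficients by b. *)
Lemma complete_phase (b : int) F : complete F -> complete (phase_mul (omega1 * b%:~R) F).
Proof.
move=> [oF hF]; split; first exact: L2pair_phase.
move=> e /hF[A uA dA]; exists [seq n + b | n <- A].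
  by rewrite map_inj_uniq//; exact: addIr.
apply: le_trans dA; rewrite /defect norm2_phase; apply: eq_ler; congr (_ - _ * _).
by rewrite big_map; apply: eq_bigr => n _; rewrite coef_re_phase coef_im_phase addrK.
Qed.

Lemma complete_closed F : L2pair F -> (forall e, 0 < e -> exists2 G, complete G & norm2 (lincomb 1 F (-1) G) <= e) -> complete F.
Proof.
move=> oF H; split => // e e0.
have e4 : 0 < e / 4 by rewrite divr_gt0.
have [G [oG hG] NG] := H _ e4; have [A uA dA] := hG _ e4; exists A => //.
have oD : L2pair (lincomb 1 F (-1) G) by exact: L2pair_lincomb.
have -> : F = lincomb 1 G 1 (lincomb 1 F (-1) G).
  by case: (F) => f1 f2; congr (_, _); apply/funext => x /=; ring.
apply: le_trans (defect_lincomb_le _ _ uA oG oD) _.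
have := le_trans (defect_le_norm2 A _) NG; rewrite expr1n mulr1; lra.
Qed.

Lemma complete_mode n : complete (mode n).
Proof.
split; first exact: L2pair_mode.
move=> e e0; exists [:: n] => //; apply: le_trans (ltW e0).
rewrite /defect big_seq1 coef_re_mode eqxx coef_im_mode expr0n addr0.
have -> : norm2 (mode n) = l.
  rewrite norm2_phase /norm2 -[RHS](_ : \int[mu]_x (\1_D x : R) = l); last first.
    by rewrite /Rintegral integral_indic// setIT /= lebesgue_measure_itv/= lte_fin l0/= subr0.
  apply: eq_Rintegral => x _ /=; by rewrite indicE; case: (x \in D); rewrite /= ?expr1n ?expr0n/= addr0.
by rewrite expr2 mulKf ?subrr// gt_eqF.
Qed.

(** This class contains 1 and, by [complete_phase], is stable under multiplication
by cos(omega1 x) and sin(omega1 x). Dominated limits then lead to indicators of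
intervals, of measurable sets, and to all of L^2. *)
Definition attained h := complete (real_mul h (mode 0)).

Lemma mode_out n x : ~ D x -> (mode n).1 x = 0 /\ (mode n).2 x = 0.
Proof. by case: (L2pair_mode n) => _ _ Z1 Z2 xD; rewrite Z1// Z2. Qed.

Lemma attained_ext h h' : (forall x, D x -> h x = h' x) -> attained h -> attained h'.
Proof.
move=> E; rewrite /attained; have -> // : real_mul h (mode 0) = real_mul h' (mode 0).
congr (_, _); apply/funext => x; have [xD|xD] := pselect (D x); rewrite ?(E x xD)//;
  have [u1 u2] := mode_out 0 xD.
  by rewrite u1 !mulr0.
by rewrite u2 !mulr0.
Qed.

Lemma attained_lincomb a h b h' : attained h -> attained h' -> attained (fun x => a * h x + b * h' x).
Proof.
move=> Hh Hh'; have := complete_lincomb a b Hh Hh'; rewrite /attained.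
by congr complete; congr (_, _); apply/funext => x /=; ring.
Qed.

Lemma attainedZ a h : attained h -> attained (fun x => a * h x).
Proof. by move=> Hh; apply: attained_ext (attained_lincomb a 0 Hh Hh) => x _; rewrite mul0r addr0. Qed.

Lemma attainedD h h' : attained h -> attained h' -> attained (fun x => h x + h' x).
Proof. by move=> Hh Hh'; apply: attained_ext (attained_lincomb 1 1 Hh Hh') => x _; rewrite !mul1r. Qed.

Lemma attained1 : attained (fun=> 1).
Proof.
have := complete_mode 0; rewrite /attained; congr complete; rewrite [LHS]surjective_pairing.
by congr (_, _); apply/funext => x; rewrite mul1r.
Qed.

Lemma attained_cos h : attained h -> attained (fun x => cos (omega1 * x) * h x).
Proof.
move=> Hh; have := complete_lincomb 2^-1 2^-1 (complete_phase 1 Hh) (complete_phase (-1) Hh); rewrite /attained.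
congr complete; congr (_, _); apply/funext => x /=; by rewrite mulr1 mulrN1 [- omega1 * x]mulNr cosN sinN; field.
Qed.

Lemma attained_sin h : attained h -> attained (fun x => sin (omega1 * x) * h x).
Proof.
move=> Hh; have := complete_lincomb (- 2^-1) 2^-1 (complete_imul (complete_phase 1 Hh)) (complete_imul (complete_phase (-1) Hh)); rewrite /attained.
congr complete; congr (_, _); apply/funext => x /=; by rewrite mulr1 mulrN1 [- omega1 * x]mulNr cosN sinN; field.
Qed.

(** Dominated convergence turns pointwise limits into limits in norm. *)
Lemma attained_lim (hn : nat -> R -> R) h (B : R -> R) : Sq (B \_ D) -> (forall n, attained (hn n)) ->
  (forall n x, D x -> `|hn n x| <= B x) -> (forall x, D x -> hn n x @[n --> \oo] --> h x) -> attained h.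
Proof.
move=> SB Hn hB hc; set F := real_mul h (mode 0).
have o1 n := let: conj o _ := Hn n in o.
have out x : ~ D x -> F.1 x = 0 /\ F.2 x = 0.
  by move=> xD; have [u1 u2] := mode_out 0 xD; rewrite /F /real_mul [(_, _).1]/fst [(_, _).2]/snd u1 u2 !mulr0.
have c1 x : (real_mul (hn n) (mode 0)).1 x @[n --> \oo] --> F.1 x.
  have [xD|xD] := pselect (D x); first by apply: cvgM; [exact: hc|exact: cvg_cst].
  rewrite (out x xD).1; have [u1 _] := mode_out 0 xD.
  by apply: (@cvg_eqfun _ _ _ (fun=> 0)); [move=> n; rewrite /real_mul [(_, _).1]/fst u1 mulr0|exact: cvg_cst].
have c2 x : (real_mul (hn n) (mode 0)).2 x @[n --> \oo] --> F.2 x.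
  have [xD|xD] := pselect (D x); first by apply: cvgM; [exact: hc|exact: cvg_cst].
  rewrite (out x xD).2; have [_ u2] := mode_out 0 xD.
  by apply: (@cvg_eqfun _ _ _ (fun=> 0)); [move=> n; rewrite /real_mul [(_, _).2]/snd u2 mulr0|exact: cvg_cst].
have ub x : `|(mode 0).1 x| <= 1 /\ `|(mode 0).2 x| <= 1.
  rewrite /= !mulr0 subr0 addr0 !normrM; split; apply: mulr_ile1 => //; try exact: indic_bounded.
    exact: cos_max.
  exact: sin_max.
have hb x : D x -> `|h x| <= B x.
  move=> xD; have C : `|hn n x| @[n --> \oo] --> `|h x| by apply: cvg_norm; exact: hc.
  by apply: (ler_cvg_to C (cvg_cst (B x))); apply: nearW => n; exact: hB.
have BD x : D x -> (B \_ D) x = B x by move=> xD; rewrite patchE mem_set.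
have bb (k u : R) x : D x -> `|k| <= B x -> `|u| <= 1 -> `|k * u| <= `|(B \_ D) x|.
  move=> xD kB u1; rewrite BD// normrM; apply: le_trans (_ : `|k| * 1 <= _); first by rewrite ler_wpM2l.
  by rewrite mulr1 (le_trans kB)// ler_norm.
have oF : L2pair F.
  split; [| |by move=> x /out[]|by move=> x /out[]].
  - apply: (Sq_le _ _ SB).
      apply: (@measurable_fun_cvg _ _ _ setT (fun n => (real_mul (hn n) (mode 0)).1)) => //.
      by move=> n; case: (o1 n) => /Sq_meas.
    move=> x; have [xD|xD] := pselect (D x); last by rewrite (out x xD).1 normr0.
    by apply: bb => //; [exact: hb|exact: (ub x).1].
  - apply: (Sq_le _ _ SB).
      apply: (@measurable_fun_cvg _ _ _ setT (fun n => (real_mul (hn n) (mode 0)).2)) => //.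
      by move=> n; case: (o1 n) => _ /Sq_meas.
    move=> x; have [xD|xD] := pselect (D x); last by rewrite (out x xD).2 normr0.
    by apply: bb => //; [exact: hb|exact: (ub x).2].
apply: complete_closed => // e e0.
pose L n := lincomb 1 F (-1) (real_mul (hn n) (mode 0)).
have oL n : L2pair (L n) by apply: L2pair_lincomb.
have C : norm2 (L n) @[n --> \oo] --> \int[mu]_x (cst (0 : R) x).
  have [|x|n x||_ //] := @dominated_cvg R (fun n x => (L n).1 x ^+ 2 + (L n).2 x ^+ 2) (cst 0)
     (fun x => 8 * (B \_ D) x ^+ 2).
  - by move=> n; case: (oL n) => /Sq_meas m1 /Sq_meas m2 _ _; apply: measurable_funD; exact: measurable_funX.
  - have d1 : (L n).1 x @[n --> \oo] --> 1 * F.1 x + -1 * F.1 x.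
      by apply: cvgD; [exact: cvg_cst|apply: cvgM; [exact: cvg_cst|exact: c1]].
    have d2 : (L n).2 x @[n --> \oo] --> 1 * F.2 x + -1 * F.2 x.
      by apply: cvgD; [exact: cvg_cst|apply: cvgM; [exact: cvg_cst|exact: c2]].
    have : (L n).1 x * (L n).1 x + (L n).2 x * (L n).2 x @[n --> \oo] -->
        (1 * F.1 x + -1 * F.1 x) * (1 * F.1 x + -1 * F.1 x) + (1 * F.2 x + -1 * F.2 x) * (1 * F.2 x + -1 * F.2 x).
      by apply: cvgD; exact: cvgM.
    rewrite mul1r mulN1r subrr mul0r mul1r mulN1r subrr mul0r addr0.
    by apply: cvg_eqfun => n; rewrite !expr2.
  - have [xD|xD] := pselect (D x); last first.
      by case: (oL n) => _ _ -> // -> //; rewrite expr0n addr0 normr0 mulr_ge0// sqr_ge0.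
    have k1 : `|h x| <= B x by exact: hb.
    have k2 : `|hn n x| <= B x by exact: hB.
    have B0 : 0 <= B x by exact: le_trans k1.
    have [u1 u2] := ub x.
    have q : (h x - hn n x) ^+ 2 <= 4 * B x ^+ 2.
      have : `|h x - hn n x| <= 2 * B x by rewrite (le_trans (ler_normB _ _))//; lra.
      rewrite -real_normK ?num_real// => H; have -> : 4 * B x ^+ 2 = (2 * B x) ^+ 2 by ring.
      by rewrite lerXn2r// nnegrE mulr_ge0.
    have sq (u : R) : `|u| <= 1 -> u ^+ 2 <= 1.
      by move=> H; rewrite -real_normK ?num_real// expr_le1.
    have -> : (L n).1 x ^+ 2 + (L n).2 x ^+ 2 = (h x - hn n x) ^+ 2 * ((mode 0).1 x ^+ 2 + (mode 0).2 x ^+ 2).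
      rewrite /L /F /lincomb /real_mul /=; ring.
    have sg (z : R) : 0 <= z ^+ 2 by exact: sqr_ge0.
    have us : 0 <= (mode 0).1 x ^+ 2 + (mode 0).2 x ^+ 2 by apply: addr_ge0; exact: sg.
    rewrite BD// [leLHS]ger0_norm; last by apply: mulr_ge0.
    have -> : 8 * B x ^+ 2 = (4 * B x ^+ 2) * 2 by ring.
    by apply: ler_pM => //; have := sq _ u1; have := sq _ u2; lra.
  - by apply: IntZ; case/SqP: SB.
rewrite Rintegral_cst// mul0r in C.
have [n _ Hc] : \forall n \near \oo, norm2 (L n) <= e by apply: cvgr_le C _ e0.
by exists (real_mul (hn n) (mode 0)); [exact: Hn|apply: Hc => /=].
Qed.

Lemma Sq_cst_itv (M : R) : Sq ((fun=> M) \_ D).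
Proof. exact: (Sq_bounded_restr (M := `|M|)). Qed.

(** In contrast to [attained], evidently stable under products. *)
Definition multiplier h := forall h', attained h' -> attained (fun x => h x * h' x).

Lemma multiplier_ext h k : h =1 k -> multiplier h -> multiplier k.
Proof. by move=> /funext ->. Qed.
Lemma multiplier_cst a : multiplier (fun=> a). Proof. by move=> h'; exact: attainedZ. Qed.
Lemma multiplierD h k : multiplier h -> multiplier k -> multiplier (fun x => h x + k x).
Proof. by move=> Mh Mk h' Hh'; apply: attained_ext (attainedD (Mh _ Hh') (Mk _ Hh')) => x _; ring. Qed.
Lemma multiplierM h k : multiplier h -> multiplier k -> multiplier (fun x => h x * k x).
Proof. by move=> Mh Mk h' Hh'; apply: attained_ext (Mh _ (Mk _ Hh')) => x _; ring. Qed.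
Lemma multiplierZ a h : multiplier h -> multiplier (fun x => a * h x).
Proof. by move=> Mh; apply: multiplierM => //; exact: multiplier_cst. Qed.
Lemma multiplier_attained h : multiplier h -> attained h.
Proof. by move=> Mh; apply: attained_ext (Mh _ attained1) => x _; rewrite mulr1. Qed.

(** The sum of the arguments of the two sines is constant in x and their difference
is omega1 (x - (a + b) / 2); so this is a trigonometric polynomial in omega1 x. It
exceeds 1/2 exactly on ]a, b[. *)
Definition bump (a b x : R) : R := 2^-1 + 2^-1 * (sin (pi * (x - a) / l) * sin (pi * (b - x) / l)).

Lemma multiplier_bump a b : multiplier (bump a b).
Proof.
pose c := omega1 * (a + b) / 2.
have H0 : multiplier (fun x => (2^-1 - 4^-1 * cos (omega1 * (b - a) / 2)) + 4^-1 * (cos c * cos (omega1 * x) + sin c * sin (omega1 * x))).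
  apply: multiplierD; first exact: multiplier_cst.
  apply: multiplierZ; apply: multiplierD; apply: multiplierZ; [exact: attained_cos|exact: attained_sin].
apply: multiplier_ext H0 => x; rewrite /bump.
set A := pi * (x - a) / l; set B := pi * (b - x) / l.
have -> : omega1 * (b - a) / 2 = A + B by rewrite /A /B /omega1; field; rewrite gt_eqF.
have -> : cos c * cos (omega1 * x) + sin c * sin (omega1 * x) = cos (A - B).
  rewrite (_ : A - B = omega1 * x - c); last by rewrite /A /B /c /omega1; field; rewrite gt_eqF.
  by rewrite cosB; ring.
by rewrite cosD cosB; field.
Qed.

Lemma bump01 a b x : 0 <= bump a b x <= 1.
Proof.
have : `|sin (pi * (x - a) / l) * sin (pi * (b - x) / l)| <= 1.
  by rewrite normrM; apply: mulr_ile1 => //; exact: sin_max.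
rewrite ler_norml /bump => /andP[? ?]; apply/andP; split; lra.
Qed.

Lemma bump_gt a b x : 0 <= a -> b <= l -> D x -> a < x < b -> 2^-1 < bump a b x.
Proof.
move=> a0 bl; rewrite /= in_itv/= => /andP[x0 xl] /andP[ax xb].
have P := @pi_gt0 R.
have s1 : 0 < sin (pi * (x - a) / l).
  apply: sin_gt0_pi; rewrite divr_gt0 ?mulr_gt0 ?subr_gt0//= ltr_pdivrMr// ltr_pM2l//; lra.
have s2 : 0 < sin (pi * (b - x) / l).
  apply: sin_gt0_pi; rewrite divr_gt0 ?mulr_gt0 ?subr_gt0//= ltr_pdivrMr// ltr_pM2l//; lra.
by rewrite /bump ltrDl mulr_gt0// mulr_gt0.
Qed.

Lemma bump_le a b x : 0 <= a -> b <= l -> a < b -> D x -> ~~ (a < x < b) -> bump a b x <= 2^-1.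
Proof.
move=> a0 bl ab; rewrite /= in_itv/= => /andP[x0 xl] xab.
have P := @pi_gt0 R.
have sp (u : R) : 0 <= u <= l -> 0 <= sin (pi * u / l).
  move=> /andP[u0 ul]; apply: sin_ge0_pi; rewrite divr_ge0 ?mulr_ge0 ?(ltW P) ?(ltW l0)//=.
  by rewrite ler_pdivrMr// ler_pM2l.
have sn (u : R) : 0 <= u <= l -> sin (pi * (- u) / l) <= 0.
  by move=> /sp; rewrite mulrN mulNr sinN oppr_le0.
rewrite /bump gerDl pmulr_rle0 ?invr_gt0//.
have [xa|xa] := leP x a.
  apply: mulr_le0_ge0; last by apply: sp; apply/andP; split; lra.
  by rewrite (_ : x - a = - (a - x)); [apply: sn; apply/andP; split; lra|ring].
have bx : b <= x by move: xab; rewrite xa/= -leNgt.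
apply: mulr_ge0_le0; first by apply: sp; apply/andP; split; lra.
by rewrite (_ : b - x = - (x - b)); [apply: sn; apply/andP; split; lra|ring].
Qed.

(** The polynomial 3 t^2 - 2 t^3 has the attracting fixed points 0 and 1 and the
repelling fixed point 1/2. Its iterates, applied to a bump, converge to 1 on
]a, b[ and to 0 off [a, b]. *)
Definition smoothstep (t : R) : R := t * t * (3 + -2 * t).

Lemma smoothstep01 (t : R) : 0 <= t <= 1 -> 0 <= smoothstep t <= 1.
Proof. move=> /andP[h1 h2]; rewrite /smoothstep; apply/andP; split.
  by rewrite !mulr_ge0//; lra.
rewrite -subr_ge0 (_ : 1 - _ = (1 - t) * (1 - t) * (1 + 2 * t)); last by ring.
by rewrite !mulr_ge0//; lra. Qed.

Lemma iter_smoothstep01 n (t : R) : 0 <= t <= 1 -> 0 <= iter n smoothstep t <= 1.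
Proof. by move=> h; elim: n => //= n; exact: smoothstep01. Qed.

Lemma iter_smoothstep_lt (t : R) : 0 <= t -> t < 2^-1 -> iter n smoothstep t @[n --> \oo] --> 0.
Proof.
move=> t0 t1; pose r := t * (3 - 2 * t).
have r0 : 0 <= r by rewrite mulr_ge0//; lra.
have r1 : r < 1 by rewrite /r; nra.
have B n : 0 <= iter n smoothstep t <= t * r ^+ n.
  elim: n => [|n /andP[h1 h2]] /=; first by rewrite t0 mulr1 lexx.
  have rn : r ^+ n <= 1 by rewrite exprn_ile1// ltW.
  set y := iter n smoothstep t in h1 h2 *.
  have yt : y <= t by apply: le_trans h2 _; rewrite ler_piMr.
  have yr : y * (3 - 2 * y) <= r by rewrite /r; nra.
  have E : smoothstep y = y * (y * (3 - 2 * y)) by rewrite /smoothstep; ring.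
  have y3 : 0 <= y * (3 - 2 * y) by rewrite mulr_ge0//; lra.
  by rewrite E mulr_ge0//= exprSr [t * (_ * _)]mulrA ler_pM.
apply: (@squeeze_cvgr _ _ _ _ (fun=> 0) (fun n => t * r ^+ n)).
- by apply: nearW => n; exact: B.
- exact: cvg_cst.
- rewrite -[X in _ --> X](mulr0 t); apply: cvgM; first exact: cvg_cst.
  by apply: cvg_expr; rewrite ger0_norm.
Qed.

Lemma iter_smoothstepC n (t : R) : iter n smoothstep (1 - t) = 1 - iter n smoothstep t.
Proof. by elim: n => //= n ->; rewrite /smoothstep; ring. Qed.

Lemma iter_smoothstep_gt (t : R) : t <= 1 -> 2^-1 < t -> iter n smoothstep t @[n --> \oo] --> (1 : R).
Proof.
move=> t0 t1; have C : iter n smoothstep (1 - t) @[n --> \oo] --> 0 by apply: iter_smoothstep_lt; lra.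
have C2 : 1 - iter n smoothstep (1 - t) @[n --> \oo] --> (1 - 0 : R) by apply: cvgB C; exact: cvg_cst.
rewrite subr0 in C2; apply: cvg_eqfun C2 => n.
by rewrite iter_smoothstepC; ring.
Qed.

Lemma iter_smoothstep_half n : iter n smoothstep 2^-1 = 2^-1.
Proof. by elim: n => //= n ->; rewrite /smoothstep; field. Qed.

Lemma multiplier_smoothstep n h : multiplier h -> multiplier (fun x => iter n smoothstep (h x)).
Proof.
move=> Mh; elim: n => //= n IH; rewrite /smoothstep.
apply: multiplierM; first exact: multiplierM.
by apply: multiplierD; [exact: multiplier_cst|exact: multiplierZ].
Qed.

Lemma attained0 : attained (fun=> 0).
Proof. by apply: attained_ext (attainedZ 0 attained1) => x _; rewrite mul0r. Qed.

(** At a and b the iterates converge to 1/2. The polynomial 2 z^2 - z fixes 0 and 1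
and sends 1/2 to 0, so that composing with it gives the indicator everywhere. *)
Lemma attained_itv_oo a b : 0 <= a -> b <= l -> attained \1_(`]a, b[%classic).
Proof.
move=> a0 bl; have [ba|ab] := leP b a.
  apply: attained_ext attained0 => x _; rewrite indicE memNset//= in_itv/= => /andP[h1 h2]; lra.
pose p n x := iter n smoothstep (bump a b x).
apply: (@attained_lim (fun n x => 2 * (p n x * p n x) + -1 * p n x) _ (fun=> 3)).
- exact: Sq_cst_itv.
- move=> n; apply: multiplier_attained; have Mp : multiplier (p n) by apply: multiplier_smoothstep; exact: multiplier_bump.
  by apply: multiplierD; apply: multiplierZ => //; exact: multiplierM.
- move=> n x xD; have /andP[h1 h2] := iter_smoothstep01 n (bump01 a b x); rewrite -/(p n x) in h1 h2.
  by rewrite ler_norml; apply/andP; split; nra.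
- move=> x xD; rewrite indicE.
  have lim (z z' : R) : z' = 2 * (z * z) + -1 * z -> p n x @[n --> \oo] --> z ->
      2 * (p n x * p n x) + -1 * p n x @[n --> \oo] --> z'.
    move=> -> C; apply: cvgD; (apply: cvgM; first exact: cvg_cst) => //.
    exact: cvgM.
  have [xab|xab] := boolP (a < x < b).
    rewrite mem_set//= ?in_itv//=; apply: (lim 1); first by ring.
    have /andP[_ h] := bump01 a b x.
    by apply: iter_smoothstep_gt => //; exact: bump_gt.
  rewrite memNset/=; last by rewrite in_itv/=; exact/negP.
  have := bump_le a0 bl ab xD xab; rewrite le_eqVlt => /predU1P[E|lt2].
    apply: (lim 2^-1); first by field.
    apply: (@cvg_eqfun _ _ _ (fun=> (2^-1 : R))); last exact: cvg_cst.
    by move=> n; rewrite /p E iter_smoothstep_half.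
  apply: (lim 0); first by ring.
  by have /andP[h _] := bump01 a b x; exact: iter_smoothstep_lt.
Qed.

Lemma attained_itv_oc (a b : R) : attained \1_(`]a, b]%classic).
Proof.
pose bn n : R := Num.min (b + n.+1%:R^-1) l.
apply: (@attained_lim (fun n => \1_(`]Num.max a 0, bn n[%classic)) _ (fun=> 1)).
- exact: Sq_cst_itv.
- by move=> n; apply: attained_itv_oo; rewrite ?le_max ?lexx ?orbT// /bn ge_min lexx orbT.
- by move=> n x _; exact: indic_bounded.
- move=> x; rewrite /= in_itv/= => /andP[x0 xl].
  have E n : \1_(`]Num.max a 0, bn n[%classic) x = ((a < x) && (x < b + n.+1%:R^-1))%:R :> R.
    by rewrite indicE in_itvE in_itv/= gt_max x0 andbT /bn lt_min xl andbT.
  apply: (@cvg_eqfun _ _ _ (fun n : nat => ((a < x) && (x < b + n.+1%:R^-1))%:R : R)) => [n|]; first by rewrite E.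
  rewrite indicE in_itvE in_itv/=.
  have [ax|_] /= := boolP (a < x); last exact: cvg_cst.
  have [xb|bx] := leP x b.
    apply: (@cvg_eqfun _ _ _ (fun=> (1 : R))); last exact: cvg_cst.
    by move=> n; rewrite (le_lt_trans xb)// ltrDl invr_gt0.
  have C : (0 : R) @[n --> \oo] --> (0 : R) by exact: cvg_cst.
  apply: cvg_trans C; apply: near_eq_cvg; near=> n.
  have : n.+1%:R^-1 < x - b.
    by near: n; apply: near_infty_natSinv_lt (PosNum _) => //; rewrite subr_gt0.
  by move: (n.+1%:R^-1 : R) => y h; rewrite ltNge; have -> : b + y <= x by lra.
Unshelve. all: by end_near. Qed.

Lemma attained_sum (T : Type) (s : seq T) (f : T -> R -> R) : (forall i, attained (f i)) ->
  attained (fun x => \sum_(i <- s) f i x).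
Proof.
move=> Hf; elim: s => [|i s IH]; first by apply: attained_ext attained0 => x _; rewrite big_nil.
by apply: attained_ext (attainedD (Hf i) IH) => x _; rewrite big_cons.
Qed.

(** The pi-lambda theorem: the intervals ]a, b] generate the Borel sets and are
stable under intersection, and the class is closed under complements and
countable disjoint unions. *)
Lemma attained_measurable (E : set R) : measurable E -> attained \1_E.
Proof.
move: E; apply: (@dynkin_induction _ (measurableTypeR R) (@ocitv R)) => //.
- exact: ocitvI.
- by apply: attained_ext attained1 => x _; rewrite indicT.
- by move=> _ [[a b] _ <-]; exact: attained_itv_oc.
- move=> E _ HE; apply: attained_ext (attained_lincomb 1 (-1) attained1 HE) => x _; rewrite !indicE in_setC.
  by case: (x \in E) => /=; ring.
- move=> F mF tF HF; apply: (@attained_lim (fun n x => \sum_(i <- iota 0 n) \1_(F i) x) _ (fun=> 1)).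
  + exact: Sq_cst_itv.
  + by move=> n; exact: attained_sum.
  + move=> n x _; have [[k _ Fk]|nF] := pselect ((\bigcup_k F k) x).
      have E i : \1_(F i) x = (i == k)%:R :> R.
        rewrite indicE; congr ((_ : bool)%:R); apply/idP/eqP => [/set_mem Fi|->]; last exact: mem_set.
        by apply/tF => //; exists x.
      rewrite (eq_bigr (fun i => (i == k)%:R)) => [|i _]; last exact: E.
      have [kn|kn] := boolP (k \in iota 0 n).
        rewrite (bigD1_seq k) ?iota_uniq//= eqxx big1 ?addr0 ?normr1//.
        by move=> i /negbTE ->.
      rewrite big_seq big1 ?normr0//= => i iI; case: eqVneq => // ik.
      by move: kn; rewrite -ik iI.
    rewrite big1 ?normr0// => i _; rewrite indicE memNset// => Fi; apply: nF; by exists i.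
  + move=> x _; have [[k _ Fk]|nF] := pselect ((\bigcup_k F k) x); last first.
      rewrite indicE memNset//; apply: (@cvg_eqfun _ _ _ (fun=> 0)); last exact: cvg_cst.
      by move=> n; rewrite big1// => i _; rewrite indicE memNset// => Fi; apply: nF; exists i.
    rewrite indicE mem_set; last by exists k.
    have C : (1 : R) @[n --> \oo] --> (1 : R) by exact: cvg_cst.
    apply: cvg_trans C; apply: near_eq_cvg; near=> n.
    have kn : (k < n)%N by near: n; exact: nbhs_infty_gt.
    have E i : \1_(F i) x = (i == k)%:R :> R.
      rewrite indicE; congr ((_ : bool)%:R); apply/idP/eqP => [/set_mem Fi|->]; last exact: mem_set.
      by apply/tF => //; exists x.
    rewrite (eq_bigr (fun i => (i == k)%:R)) => [|i _]; last exact: E.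
    rewrite (bigD1_seq k) ?iota_uniq ?mem_iota//= eqxx big1 ?addr0//.
    by move=> i /negbTE ->.
Unshelve. all: by end_near. Qed.

Lemma attained_ge0 g : Sq g -> (forall x, 0 <= g x) -> attained g.
Proof.
move=> Sg g0; have mg : measurable_fun setT (EFin \o g) by apply/measurable_EFinP; exact: Sq_meas.
pose gn := nnsfun_approx measurableT mg.
apply: (@attained_lim (fun n x => gn n x) g g).
- exact: Sq_restr.
- move=> n; pose f (y x : R) : R := y * \1_(gn n @^-1` [set y]) x.
  (* a simple function is a finite combination of indicators of its level sets *)
  have S : attained (fun x => \sum_(y <- finmap.enum_fset (fset_set (range (gn n)))) f y x).
    by apply: attained_sum => y; apply: attainedZ; apply: attained_measurable; exact: measurable_funPTI.
  by apply: attained_ext S => x _; rewrite [RHS]fimfunE fsbig_finite.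
- move=> n x _; rewrite ger0_norm//; have := @le_approx _ _ R setT (EFin \o g) n x (fun x _ => g0 x) I.
  by rewrite lee_fin -nnsfun_approxE.
- move=> x _; have := @cvg_nnsfun_approx _ _ R setT measurableT _ mg (fun x _ => g0 x) x I.
  by move/fine_cvg.
Qed.

Lemma attained_Sq g : Sq (g \_ D) -> attained g.
Proof.
move=> Sg.
have H1 : attained (fun x => Num.max ((g \_ D) x) 0).
  apply: attained_ge0; last by move=> x; rewrite le_max lexx orbT.
  apply: (Sq_le _ _ Sg); first by apply: measurable_maxr => //; exact: Sq_meas.
  by move=> x; rewrite /Num.max; case: ifP => h; rewrite ?normr0// normrN.
have H2 : attained (fun x => Num.max (- (g \_ D) x) 0).
  apply: attained_ge0; last by move=> x; rewrite le_max lexx orbT.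
  apply: (Sq_le _ _ (SqN Sg)); first by apply: measurable_maxr => //; exact: Sq_meas (SqN Sg).
  by move=> x; rewrite /Num.max; case: ifP => h; rewrite ?normr0// normrN.
apply: attained_ext (attained_lincomb 1 (-1) H1 H2) => x xD; rewrite patchE mem_set//.
by rewrite /Num.max; case: ltP => h1; case: ltP => h2; lra.
Qed.

(** Write g as exp(i k x) (exp(- i k x) g), with k the wave number of index 0, and
apply [attained_Sq] to the real and imaginary parts of the second factor. *)
Lemma complete_real g : Sq (g \_ D) -> complete (g \_ D, fun=> 0).
Proof.
move=> Sg.
have S (t : R -> R) : measurable_fun setT t -> (forall x, `|t x| <= 1) -> Sq ((fun x => t x * g x) \_ D).
  move=> mt t1; apply: Sq_ext (SqM_bounded Sg mt t1) => x; rewrite !patchE; case: ifP => // _.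
  by rewrite mulr0.
have Hc := attained_Sq (S _ (measurable_cosM (wavenum 0)) (fun x => cos_max _)).
have Hs := attained_Sq (S _ (measurable_sinM (wavenum 0)) (fun x => sin_max _)).
have := complete_lincomb 1 (-1) Hc (complete_imul Hs); congr complete; congr (_, _); apply/funext => x /=.
  have E := cos2Dsin2 (wavenum 0 * x).
  transitivity ((cos (wavenum 0 * x) ^+ 2 + sin (wavenum 0 * x) ^+ 2) * (g x * \1_D x)); first by ring.
  rewrite E mul1r patchE indicE; case: ifP => _; rewrite ?mulr1 ?mulr0//.
ring.
Qed.

(** Bessel's inequality for finite sets is one half; completeness gives the other. *)
Lemma parseval g : Sq (g \_ D) ->
  (\esum_(n in [set: int])
    ((\int[mu]_(x in D) (g x * cos (wavenum n * x))) ^+ 2 +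
     (\int[mu]_(x in D) (g x * sin (wavenum n * x))) ^+ 2)%:E =
   (l * \int[mu]_(x in D) (g x ^+ 2))%:E)%E.
Proof.
move=> Sg; have [oF hF] := complete_real Sg; set F := (g \_ D, fun=> 0) in oF hF.
pose a n := coef_re n F ^+ 2 + coef_im n F ^+ 2.
have a0 n : 0 <= a n by rewrite addr_ge0// sqr_ge0.
have cE n : \int[mu]_(x in D) (g x * cos (wavenum n * x)) = coef_re n F.
  rewrite Rintegral_restr; apply: eq_Rintegral => x _ /=; rewrite [- wavenum n * x]mulNr cosN !patchE mulr0 subr0.
  by case: ifP => _; rewrite ?mulr0// mulrC.
have sE n : \int[mu]_(x in D) (g x * sin (wavenum n * x)) = - coef_im n F.
  have /L2pair_Int[_ I2] := L2pair_phase (- wavenum n) oF.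
  rewrite Rintegral_restr /coef_im -mulN1r -RintegralZl//; apply: eq_Rintegral => x _ /=; rewrite [- wavenum n * x]mulNr sinN !patchE mulr0 addr0.
  by case: ifP => _; [ring|rewrite !mulr0].
have NE : \int[mu]_(x in D) (g x ^+ 2) = norm2 F.
  rewrite Rintegral_restr; apply: eq_Rintegral => x _ /=; rewrite !patchE expr0n addr0.
  by case: ifP => _; rewrite ?expr0n.
rewrite NE (eq_esum (b := fun n => (a n)%:E)); last by move=> n _; rewrite cE sE sqrrN.
have dE A : defect A F = norm2 F - l^-1 * \sum_(n <- A) a n by [].
apply/eqP; rewrite eq_le; apply/andP; split.
  apply: ge_ereal_sup => _ [X [fX _] <-].
  rewrite fsbig_finite// sumEFin lee_fin.
  have := bessel (finmap.fset_uniq (fset_set X)) oF; rewrite dE subr_ge0.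
  by rewrite mulrC ler_pdivrMr// mulrC.
apply/lee_addgt0Pr => e e0.
have [A uA dA] := hF (e / l) (divr_gt0 e0 l0).
apply: (@le_trans _ _ ((\sum_(n <- A) a n)%:E + e%:E)%E).
  rewrite -EFinD lee_fin; move: dA; rewrite dE lerBlDr addrC -(ler_pM2l l0).
  by rewrite mulrDr mulrA mulfV ?gt_eqF// mul1r mulrCA mulfV ?gt_eqF// mulr1.
rewrite leeD2r//; apply: esum_ge; exists [set` A]; first by split => //; exact: finite_seq.
by rewrite -fsbig_seq// sumEFin.
Qed.

End Fourier.

(** * The modal sum and the energy estimates *)

Section Modal.
Context {R : realType}.
Variables (L v eta : R).
Hypothesis hL : 0 < L.
Hypothesis hv : 0 <= v < 1.
Hypothesis heta : 0 < eta.
Hypothesis heta1 : eta != 1.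
Local Notation mu := (@lebesgue_measure R).
Local Notation L_2 := (L_2 L v).
Local Notation gv := (gamma_v v).
Local Notation ge := (gamma_eta eta).
Local Notation D := (`]0, L_2[%classic : set R).
Local Notation decay_rate := (decay_rate L v eta).

Let v0 : 0 <= v. Proof. by case/andP: hv. Qed.
Let v1 : 0 < 1 - v. Proof. by rewrite subr_gt0; case/andP: hv. Qed.
Let vp : 0 < 1 + v. Proof. by have := v0; lra. Qed.
Let gv0 : 0 < gv. Proof. by apply: lt_le_trans (gamma_v_ge1 hv). Qed.

(** The common form of the extensions of the two initial data to ]0, L_2[. *)
Definition reflected (f : R -> R) (k x : R) : R := if x < L then f x else k * f (reflect_pt L v x).

Lemma Sq_reflected f k : L2 `]0, L[ f -> Sq (reflected f k \_ D).
Proof.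
move=> Lf; set f1 := (f \_ `]0, L[) in Lf.
have k0 : - gv^-1 != 0 by rewrite oppr_eq0 invr_eq0 gt_eqF.
have S2 := SqZ k (Sq_affine (2 * L / (1 + v)) k0 Lf).
(* corrects the value at the single point x = L, which both pieces miss *)
have S3 : Sq (fun x => (k * f L) * \1_(`[L, L]%classic) x) by apply: SqZ; exact: Sq_indic.
apply: Sq_ext (SqD (SqD Lf S2) S3) => x.
have L2E : L_2 = L + gv * L by rewrite /Defs.L_2 /gamma_v; field; rewrite gt_eqF.
have E : - gv^-1 * x + 2 * L / (1 + v) = reflect_pt L v x by rewrite /reflect_pt; ring.
have F : x = L + gv * (L - reflect_pt L v x).
  by rewrite /reflect_pt /gamma_v; field; rewrite !gt_eqF.
have gL : 0 < gv * L by rewrite mulr_gt0.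
set r := reflect_pt L v x in E F.
have r1 : (r < L) = (L < x).
  by rewrite F ltrDl pmulr_rgt0// subr_gt0.
have r2 : (0 < r) = (x < L_2).
  by rewrite F L2E ltrD2l ltr_pM2l// gtrBl.
rewrite /f1 !patchE !in_itvE !in_itv/= E indicE in_itvE in_itv/= r1 r2 /reflected -/r.
have [xL|xL|xL] := ltgtP x L.
- by rewrite andbF mulr0 !addr0 (lt_trans xL (L_lt_L_2 hL hv))/= !andbT; case: ifP => // _; rewrite mulr0 !addr0.
- rewrite (lt_trans hL xL)/= andbT -[point]/(0 : R); case: ifP => _; ring.
- rewrite xL hL (L_lt_L_2 hL hv)/= !mulr0 !add0r mulr1; congr (_ * f _).
  apply/esym; rewrite /r xL /reflect_pt /gamma_v; field; rewrite !gt_eqF//.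
Qed.

(** Both cases in one formula, since gamma_eta > 0 if eta < 1. *)
Lemma omegaE (n : int) : omega eta n =
  (- (ln `|ge| / 2) +i* (pi * (n%:~R + if eta < 1 then 2^-1 else 0)))%C.
Proof.
rewrite /omega; case: ifP => h.
  have g0 : 0 < ge by rewrite /gamma_eta divr_gt0 ?subr_gt0//; have := heta; lra.
  by rewrite gtr0_norm//; congr (_ +i* _)%C; field.
by congr (_ +i* _)%C; ring.
Qed.

Definition freq_shift : R := if eta < 1 then 2^-1 else 0.

Lemma ln_gamma_eta_gt0 : 0 < ln `|ge|.
Proof. by rewrite ln_gt0// (gamma_eta_gt1 heta heta1). Qed.

Lemma cexp_mode (n : int) (x : R) : cexp (- ((((1 - v) / L * x)%:C)%C * omega eta n)) =
  ((expR (decay_rate / 2 * x) * cos (wavenum L_2 freq_shift n * x)) +i* (- (expR (decay_rate / 2 * x) * sin (wavenum L_2 freq_shift n * x))))%C.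
Proof.
have E1 : complex.Re (- ((((1 - v) / L * x)%:C)%C * omega eta n)) = decay_rate / 2 * x.
  by rewrite omegaE /= /decay_rate /Defs.L_2; field; rewrite !gt_eqF.
have E2 : complex.Im (- ((((1 - v) / L * x)%:C)%C * omega eta n)) = - (wavenum L_2 freq_shift n * x).
  by rewrite omegaE /= /wavenum /omega1 /Defs.L_2 -/freq_shift; field; rewrite !gt_eqF.
by rewrite /cexp E1 E2 cosN sinN mulrN.
Qed.

Variables (dphi0 phi1 : R -> R).
Hypothesis h0 : L2 `]0, L[ dphi0.
Hypothesis h1 : L2 `]0, L[ phi1.

Definition profile_data x := dphi0_ext L v dphi0 x + phi1_ext L v phi1 x.
(** Its Fourier coefficients have the moduli |omega_n a_n|: the real part of omega_n,
which does not depend on n, becomes the exponential weight. *)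
Definition modal_fun x := (4 * ge)^-1 * (expR (decay_rate / 2 * x) * profile_data x).

Lemma Sq_profile_data : Sq (profile_data \_ D).
Proof.
have := SqD (Sq_reflected gv^-1 h0) (Sq_reflected (- gv^-1) h1); apply: Sq_ext => x.
rewrite !patchE; case: ifP => _; last by rewrite addr0.
by rewrite /profile_data /reflected /dphi0_ext /phi1_ext; case: ifP => // _; rewrite mulNr.
Qed.

Lemma Sq_modal_fun : Sq (modal_fun \_ D).
Proof.
pose g := (fun x => expR (decay_rate / 2 * x)) \_ D.
have mg : measurable_fun setT g.
  apply: measurable_restr => //; apply: measurable_funTS.
  apply: measurableT_comp; first exact: measurable_expR.
  exact: measurable_funM.
have r0 := decay_rate_ge0 hL hv heta heta1.
have gb x : `|g x| <= expR (decay_rate / 2 * L_2).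
  rewrite /g patchE in_itvE in_itv/=; case: ifP => [/andP[x0 xM]|_]; last by rewrite normr0 expR_ge0.
  rewrite ger0_norm ?expR_ge0// ler_expR; apply: ler_wpM2l; last exact: ltW.
  by rewrite divr_ge0.
apply: Sq_ext (SqZ (4 * ge)^-1 (SqM_bounded Sq_profile_data mg gb)) => x.
by rewrite /modal_fun /g !patchE; case: ifP => _ //; rewrite !mulr0.
Qed.

Lemma modal_fun_integrable (t : R -> R) : measurable_fun setT t -> (forall x, `|t x| <= 1) ->
  mu.-integrable D (EFin \o (fun x => modal_fun x * t x)).
Proof.
move=> mt t1; apply/Int_restrE => //; apply: L2_integrable.
apply: Sq_ext (SqM_bounded Sq_modal_fun mt t1) => x; rewrite !patchE; case: ifP => _; last by rewrite mulr0.
by rewrite mulrC.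
Qed.

(** The factor omega_n cancels the one in the denominator of a_n. *)
Lemma coef_modulus (n : int) : cmod (omega eta n * wave_coef L v eta dphi0 phi1 n) ^+ 2 =
  (\int[mu]_(x in D) (modal_fun x * cos (wavenum L_2 freq_shift n * x))) ^+ 2 +
  (\int[mu]_(x in D) (modal_fun x * sin (wavenum L_2 freq_shift n * x))) ^+ 2.
Proof.
have ge0' : ge != 0 by rewrite -normr_gt0; apply: lt_trans (gamma_eta_gt1 heta heta1).
have g40 : 4 * ge != 0 by rewrite mulf_neq0.
have w0 : omega eta n != 0.
  rewrite omegaE eq_complex /= negb_and oppr_eq0 mulf_neq0// gt_eqF ?ln_gamma_eta_gt0//.
set C := \int[mu]_(x in D) (modal_fun x * cos (wavenum L_2 freq_shift n * x)).
set S := \int[mu]_(x in D) (modal_fun x * sin (wavenum L_2 freq_shift n * x)).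
have -> : omega eta n * wave_coef L v eta dphi0 phi1 n = (C +i* (- S))%C.
  have -> : omega eta n * wave_coef L v eta dphi0 phi1 n = (((4 * ge)%:C)%C)^-1 *
     cintegral D (fun x => ((profile_data x)%:C)%C * cexp (- ((((1 - v) / L * x)%:C)%C * omega eta n))).
    rewrite /wave_coef mulrA; congr (_ * _).
    by rewrite mul1r invfM mulrCA mulfV// mulr1.
  have -> : (fun x => ((profile_data x)%:C)%C * cexp (- ((((1 - v) / L * x)%:C)%C * omega eta n))) =
      (fun x => ((profile_data x)%:C)%C * ((expR (decay_rate / 2 * x) * cos (wavenum L_2 freq_shift n * x)) +i* (- (expR (decay_rate / 2 * x) * sin (wavenum L_2 freq_shift n * x))))%C).
    by apply/funext => x; rewrite cexp_mode.
  rewrite -fmorphV /cintegral.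
  have I1 := modal_fun_integrable (measurable_cosM (wavenum L_2 freq_shift n)) (fun x => cos_max _).
  have I2 := modal_fun_integrable (measurable_sinM (wavenum L_2 freq_shift n)) (fun x => sin_max _).
  apply/eqP; rewrite eq_complex /= !mul0r subr0 addr0; apply/andP; split; apply/eqP.
    have E : 4 * ge * C = \int[mu]_(x in D) (4 * ge * (modal_fun x * cos (wavenum L_2 freq_shift n * x))) by rewrite RintegralZl.
    rewrite -[RHS](mulKf g40) E; apply: congr1; apply: eq_Rintegral => x _.
    by rewrite /= mul0r subr0 /modal_fun; field.
  have E : 4 * ge * (- S) = \int[mu]_(x in D) (- (4 * ge) * (modal_fun x * sin (wavenum L_2 freq_shift n * x))).
    by rewrite RintegralZl// mulNr mulrN.
  rewrite -[RHS](mulKf g40) E; apply: congr1; apply: eq_Rintegral => x _.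
  by rewrite /= mul0r addr0 /modal_fun; field.
by rewrite /cmod /= sqr_sqrtr ?addr_ge0 ?sqr_ge0// sqrrN.
Qed.

Lemma modal_sumE : modal_sum L v eta dphi0 phi1 =
  (2 / L * (L_2 * \int[mu]_(x in D) (modal_fun x ^+ 2)))%:E.
Proof.
rewrite /modal_sum [RHS]EFinM; congr (_ * _)%E.
rewrite -(parseval freq_shift (L_2_gt0 hL hv) Sq_modal_fun).
by apply: eq_esum => n _; rewrite coef_modulus.
Qed.

End Modal.

Section Final.
Context {R : realType}.
Local Notation mu := (@lebesgue_measure R).
Variables (L v eta : R).
Hypothesis hL : 0 < L.
Hypothesis hv : 0 <= v < 1.
Hypothesis heta : 0 < eta.
Hypothesis heta1 : eta != 1.
Variables (phi0 dphi0 phi1 : R -> R).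
Hypothesis hphi0 : H1_right0 0 L phi0 dphi0.
Hypothesis hphi1 : L2 `]0, L[ phi1.
Variables (phi phix phit : R -> R -> R).
Hypothesis hphi : WP_solution L v eta phi0 phi1 phi phix phit.
Local Notation ge := (gamma_eta eta).
Local Notation D := (`]0, L_2 L v[%classic : set R).
Local Notation period_energy := (period_energy L v eta phix phit).

(** By [profile_initial] the square of [modal_fun] is the integrand of the period
energy divided by (4 gamma_eta)^2, and L_2 / L = 2 / (1 - v). *)
Lemma modal_sum_energy : modal_sum L v eta dphi0 phi1 = ((4 * (1 - v) * ge ^+ 2)^-1 * period_energy)%:E.
Proof.
case: hphi => hH1 hC1 hW hB i0 i1.
have v1 : 0 < 1 - v by rewrite subr_gt0; case/andP: hv.
have g0 : ge != 0 by rewrite -normr_gt0; apply: lt_trans (gamma_eta_gt1 heta heta1).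
have h0 : L2 `]0, L[ dphi0 by case: hphi0 => -[].
rewrite (modal_sumE hL hv heta heta1 h0 hphi1); congr EFin.
suff -> : \int[mu]_(x in D) (modal_fun L v eta dphi0 phi1 x ^+ 2) = (4 * ge) ^- 2 * period_energy.
  by rewrite /L_2; field; rewrite g0 !gt_eqF.
have A := profile_initial hL hv hH1 hC1 hW hphi0 i0 i1.
have lw := loc_Int_weighted_sqr hL hv heta heta1 hH1 hC1.
rewrite -[period_energy]/(\int[mu]_(x in D) weighted_sqr L v eta phix phit x) -RintegralZl//; last exact: loc_Int_integrable.
rewrite /Rintegral; congr fine; apply: ae_eq_integral => //.
- apply/measurable_EFinP; apply: measurable_funX.
  by apply/(measurable_restrictT _ (measurable_itv _)); exact: Sq_meas (Sq_modal_fun hL hv heta heta1 h0 hphi1).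
- by have := integrable_scale ((4 * ge) ^- 2) (measurable_itv _) (loc_Int_integrable (L_2 L v) lw (lexx 0)) => /measurable_int.
- apply: ae_imp A => x H; rewrite /= in_itv/= => /H E; congr EFin.
  rewrite /modal_fun /weighted_sqr /profile_sqr E /profile_data.
  have -> : expR (decay_rate L v eta * x) = expR (decay_rate L v eta / 2 * x) ^+ 2.
    by rewrite expr2 -expRD; congr expR; field.
  by field.
Qed.

End Final.

Theorem corollary3 (R : realType) (L v eta : R)
  (hL : 0 < L) (hv : 0 <= v < 1) (heta : 0 < eta) (heta1 : eta != 1)
  (phi0 dphi0 phi1 : R -> R)
  (hphi0 : H1_right0 0 L phi0 dphi0) (hphi1 : L2 `]0, L[ phi1)
  (phi phix phit : R -> R -> R)
  (hphi : WP_solution L v eta phi0 phi1 phi phix phit)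
  (t : R) (ht : 0 <= t) :
  ((1 - v)%:E * modal_sum L v eta dphi0 phi1 * (decay L v eta t)%:E
     <= energy L v phix phit t
     <= (gamma_eta eta ^+ 2 * (1 + v))%:E * modal_sum L v eta dphi0 phi1
          * (decay L v eta t)%:E)%E
  /\
  ((1 / (gamma_eta eta ^+ 2 * gamma_v v))%:E * energy L v phix phit 0
       * (decay L v eta t)%:E
     <= energy L v phix phit t
     <= (gamma_eta eta ^+ 2 * gamma_v v)%:E * energy L v phix phit 0
          * (decay L v eta t)%:E)%E.
Proof.
rewrite (modal_sum_energy hL hv heta heta1 hphi0 hphi1 hphi).
case: hphi => hH1 hC1 hW hB i0 i1.
rewrite !(energy_profile hL hv hH1 hC1 hW)// -!EFinM !lee_fin.
set J := period_energy _ _ _ _ _.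
have [v0 v1] : 0 <= v /\ 0 < 1 - v by case/andP: hv => ? ?; split => //; rewrite subr_gt0.
have g0 : gamma_eta eta != 0 by rewrite -normr_gt0; apply: lt_trans (gamma_eta_gt1 heta heta1).
have g2 : 0 < gamma_eta eta ^+ 2 by rewrite exprn_even_gt0//= -normr_gt0; apply: lt_trans (gamma_eta_gt1 heta heta1).
have gv0 : 0 < gamma_v v by apply: lt_le_trans (gamma_v_ge1 hv).
have gg : 0 < gamma_eta eta ^+ 2 * gamma_v v by rewrite mulr_gt0.
have gvn : gamma_v v != 0 by rewrite gt_eqF.
have /andP[B1 B2] := profile_energy_bounds hL hv heta heta1 hH1 hC1 hW hB ht.
have /andP[C1 C2] := profile_energy_bounds hL hv heta heta1 hH1 hC1 hW hB (lexx 0).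
rewrite -/J in B1 B2 C1 C2.
have d0 : decay L v eta 0 = 1 by rewrite /decay mulr0 oppr0 expR0.
have dt : 0 < decay L v eta t by exact: expR_gt0.
rewrite d0 !mulr1 in C1 C2.
have e1 : (1 - v) * ((4 * (1 - v) * gamma_eta eta ^+ 2)^-1 * J) = 4^-1 * (J / gamma_eta eta ^+ 2).
  by field; rewrite g0 !gt_eqF.
have e2 : gamma_eta eta ^+ 2 * (1 + v) * ((4 * (1 - v) * gamma_eta eta ^+ 2)^-1 * J) = 4^-1 * (gamma_v v * J).
  by rewrite /gamma_v; field; rewrite g0 !gt_eqF.
rewrite e1 e2; split; apply/andP; split => //.
- apply: le_trans B1; rewrite ler_pM2r// mul1r ler_pdivrMl//.
  by apply: le_trans C2 _; apply: eq_ler; field.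
- apply: le_trans B2 _; rewrite ler_pM2r//.
  rewrite -ler_pdivrMl//; apply: le_trans C1.
  by apply: eq_ler; field; rewrite ?g0 ?gvn.
Qed.
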